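(* Let $K\ge 1$ and $m$ be positive integers. For $k=1,\dots,K$ let $\sigma_k^2>0$, $P_k>0$, $\lambda_k\in[0,1)$, and let $\mathcal N_0>0$. Let $\vartheta_{k,l}$ ($0\le k\le K$, $1\le l\le m$) be independent circularly-symmetric complex Gaussian random variables with zero mean and unit variance, and define $$|h_k|=\sqrt{\tfrac{\sigma_k^2}{m}}\,\Big\|\sqrt{1-\lambda_k^2}\,(\vartheta_{k,1},\dots,\vartheta_{k,m})^T+\lambda_k(\vartheta_{0,1},\dots,\vartheta_{0,m})^T\Big\|,\qquad \gamma_k=\frac{P_k|h_k|^2}{\mathcal N_0},$$ and $G_K=\prod_{k=1}^K(1+\gamma_k)$. Put $\Omega_k=\frac{P_k\sigma_k^2(1-\lambda_k^2)}{m\mathcal N_0}$, $w_k=\frac{\lambda_k^2}{1-\lambda_k^2}\big(1+\sum_{l=1}^K\frac{\lambda_l^2}{1-\lambda_l^2}\big)^{-1}$, and for $\boldsymbol\ell=(\ell_1,\dots,\ell_K)\in\mathbb N_0^K$ $$W_{\boldsymbol\ell}=\frac{\Gamma(m+\sum_{k=1}^K\ell_k)}{\Gamma(m)}\Big(1+\sum_{k=1}^K\frac{\lambda_k^2}{1-\lambda_k^2}\Big)^{-m}\prod_{k=1}^K\frac{w_k^{\ell_k}}{\ell_k!}.$$ For each $\boldsymbol\ell$ let $R_{\boldsymbol\ell,1},\dots,R_{\boldsymbol\ell,K}$ be independent with $R_{\boldsymbol\ell,k}\sim\mathcal G(m+\ell_k,\Omega_k)$, let $\mathcal A_{\boldsymbol\ell}=\prod_{k=1}^K(1+R_{\boldsymbol\ell,k})$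 and let $F_{\mathcal A_{\boldsymbol\ell}}$ be its CDF. Then the CDF of $G_K$ is $$F_{G_K}(x)=\sum_{\ell_1,\dots,\ell_K=0}^\infty W_{\boldsymbol\ell}\,F_{\mathcal A_{\boldsymbol\ell}}(x),$$ and $$F_{\mathcal A_{\boldsymbol\ell}}(x)=Y_{1,K+1}^{K,1}\left[\left.\begin{array}{c}(1,1,0,1)\\ (1,1,\tfrac{1}{\Omega_1},m+\ell_1),\dots,(1,1,\tfrac{1}{\Omega_K},m+\ell_K),(0,1,0,1)\end{array}\right|\frac{x}{\prod_{k=1}^K\Omega_k}\right].$$
   Context: $\mathcal G(a,b)$ denotes the Gamma distribution with shape $a$ and scale $b$, i.e. density $x^{a-1}e^{-x/b}/(\Gamma(a)b^a)$ on $x>0$. $\Psi(\alpha,\gamma;z)=\frac{1}{\Gamma(\alpha)}\int_0^\infty e^{-zt}t^{\alpha-1}(1+t)^{\gamma-\alpha-1}dt$ is Tricomi's confluent hypergeometric function. The generalized Fox H function is defined by the Mellin–Barnes integral $$Y_{p,q}^{m,n}\left[\left.\begin{array}{c}(a_1,\alpha_1,A_1,\varphi_1),\dots,(a_p,\alpha_p,A_p,\varphi_p)\\(b_1,\beta_1,B_1,\phi_1),\dots,(b_q,\beta_q,B_q,\phi_q)\end{array}\right|x\right]=\frac{1}{2\pi i}\int_{\mathcal L}M_{p,q}^{m,n}[s]\,x^{-s}ds,$$ where $\mathcal L$ is a contour from $c-i\infty$ to $c+i\infty$ ($c\in\mathbb R$) and $$M_{p,q}^{m,n}[s]=\frac{\prod_{j=1}^m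 B_j^{\phi_j+b_j+\beta_js-1}\Psi(\phi_j,\phi_j+b_j+\beta_js;B_j)}{\prod_{i=n+1}^p A_i^{\varphi_i+a_i+\alpha_is-1}\Psi(\varphi_i,\varphi_i+a_i+\alpha_is;A_i)}\cdot\frac{\prod_{i=1}^n A_i^{\varphi_i-a_i-\alpha_is}\Psi(\varphi_i,\varphi_i+1-a_i-\alpha_is;A_i)}{\prod_{j=m+1}^q B_j^{\phi_j-b_j-\beta_js}\Psi(\phi_j,\phi_j+1-b_j-\beta_js;B_j)}.$$
   Formalization: The factors of Y with A=0 or B=0, literally of the undefined form 0·∞, are read as their limit as the parameter tends to 0+, giving Γ(−s)/Γ(1−s); the contour is any vertical line with c<0, and the identity for Y is stated for x>0, where x^{-s} is defined. *)

(* Defs.v *)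
From HB Require Import structures.
From mathcomp Require Import all_boot all_order all_algebra.
From mathcomp Require Import all_classical all_reals all_analysis.
From mathcomp Require Import complex.

Set Implicit Arguments.
Unset Strict Implicit.
Unset Printing Implicit Defensive.

Import Order.TTheory GRing.Theory Num.Theory.
Local Open Scope classical_set_scope.
Local Open Scope ring_scope.

Section Defs.
Context {R : realType}.
Local Notation mu := (@lebesgue_measure R).

Definition cexpC (z : R[i]) : R[i] :=
  Complex (expR (complex.Re z) * cos (complex.Im z))
          (expR (complex.Re z) * sin (complex.Im z)).

Definition cpowR (a : R) (w : R[i]) : R[i] := cexpC (w * (real_complex R (ln a))).

Definition CInt (D : set R) (f : R -> R[i]) : R[i] :=
  Complex (Rintegral mu D (fun x => complex.Re (f x)))
          (Rintegral mu D (fun x => complex.Im (f x))).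

Definition GammaR (a : R) : R :=
  Rintegral mu `]0, +oo[ (fun t => t `^ (a - 1) * expR (- t)).

Definition GammaC (z : R[i]) : R[i] :=
  CInt `]0, +oo[ (fun t => cpowR t (z - 1) * real_complex R (expR (- t))).

Definition Tricomi (al : R) (ga : R[i]) (z : R) : R[i] :=
  real_complex R (GammaR al)^-1 *
  CInt `]0, +oo[ (fun t => real_complex R (expR (- (z * t)) * t `^ (al - 1)) *
                           cpowR (1 + t) (ga - real_complex R al - 1)).

(** Every factor of M[s] has the form A^(ga-1) Psi(phi, ga; A).  For A > 0 this
    is evaluated literally; for A = 0 it is understood as its limit as A -> 0+,
    namely Gamma(ga-1)/Gamma(phi) (valid for Re ga > 1). *)
Definition PsiFactor (phi : R) (ga : R[i]) (A : R) : R[i] :=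
  if 0 < A then cpowR A (ga - 1) * Tricomi phi ga A
  else GammaC (ga - 1) / real_complex R (GammaR phi).

(** Generalized Fox H function Y^{m,n}_{p,q}.  A parameter tuple
    (a, alpha, A, phi) is encoded as ((a, alpha), (A, phi)); p = size ap,
    q = size bq.  The Mellin-Barnes contour is the vertical line Re s = c. *)
Definition param := ((R * R) * (R * R))%type.
Definition par_a (t : param) := t.1.1.
Definition par_al (t : param) := t.1.2.
Definition par_A (t : param) := t.2.1.
Definition par_phi (t : param) := t.2.2.

Definition foxM (m n : nat) (ap bq : seq param) (s : R[i]) : R[i] :=
  let p := size ap in let q := size bq in
  let cA i := nth ((0, 0), (0, 0)) ap i in
  let cB j := nth ((0, 0), (0, 0)) bq j in
  let rc x := real_complex R x in
  ((\prod_(0 <= j < m) PsiFactor (par_phi (cB j))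
       (rc (par_phi (cB j) + par_a (cB j)) + rc (par_al (cB j)) * s) (par_A (cB j)))
   / (\prod_(n <= i < p) PsiFactor (par_phi (cA i))
       (rc (par_phi (cA i) + par_a (cA i)) + rc (par_al (cA i)) * s) (par_A (cA i))))
  * ((\prod_(0 <= i < n) PsiFactor (par_phi (cA i))
       (rc (par_phi (cA i) + 1 - par_a (cA i)) - rc (par_al (cA i)) * s) (par_A (cA i)))
   / (\prod_(m <= j < q) PsiFactor (par_phi (cB j))
       (rc (par_phi (cB j) + 1 - par_a (cB j)) - rc (par_al (cB j)) * s) (par_A (cB j)))).

(* Y = 1/(2 pi i) int_{c - i oo}^{c + i oo} M[s] x^{-s} ds
     = 1/(2 pi) int_{-oo}^{+oo} M[c + i t] x^{-(c + i t)} dt   (x > 0) *)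
Definition foxY (m n : nat) (ap bq : seq param) (c x : R) : R[i] :=
  real_complex R (pi *+ 2)^-1 *
  CInt setT (fun t => foxM m n ap bq (Complex c t) * cpowR x (- Complex c t)).

Definition gamma_pdf (a b x : R) : R :=
  if 0 < x then x `^ (a - 1) * expR (- (x / b)) / (GammaR a * b `^ a) else 0.

Definition gamma_distributed d (T : measurableType d) (P : probability T R)
  (X : T -> R) (a b : R) : Prop :=
  forall B : set R, measurable B ->
    P (X @^-1` B) = (\int[mu]_(x in B) (gamma_pdf a b x)%:E)%E.

Definition normal_distributed d (T : measurableType d) (P : probability T R)
  (X : T -> R) (mean var : R) : Prop :=
  forall B : set R, measurable B ->
    P (X @^-1` B) = normal_prob mean (Num.sqrt var) B.

Definition mutually_independent d (T : measurableType d) (P : probability T R)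
  (I : finType) (X : I -> T -> R) : Prop :=
  forall B : I -> set R, (forall i, measurable (B i)) ->
    P (\bigcap_(i in [set: I]) (X i @^-1` B i)) =
    (\prod_(i : I) P (X i @^-1` B i))%E.

End Defs.

(* Main.v *)
(** First part.  Given the common variables theta_0, the gain snr_k / Omega_k is a
    sum of 2m squares of shifted Gaussians, whose Laplace transform shows it to be
    a Poisson mixture of Gamma variables of shape m + l.  Since |theta_0|^2 is
    itself a Gamma variable, integrating the product of the Poisson weights over it
    gives exactly W_l.  Hence E (G_K ^ -j) = sum_l W_l E (A_l ^ -j) for every natural
    number j, and the moments E (exp (- j X)) determine the law of X = ln G_K >= 0.

    Second part.  Each Psi factor in the numerator of M[s] is Omega_k^-s times the
    Mellin moment E ((1 + R_k)^s), and the remaining quotient is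
    Gamma(-s) / Gamma(1 - s) = -1/s, so the integrand is -1/s E ((A / x)^s).  On the
    line Re s = -a < 0 it is, up to normalization, the Fourier transform of
    y |-> exp (- a y) P (ln (A / x) <= y).  One integration by
    parts in a single Gamma variable makes the integrand O(1 / (1 + |t|)^2), and the
    inversion is done by Abel summation with the factor exp (- e |t|), whose Fourier
    transform is the Poisson kernel.  The limit is P (A < x) + P (A = x) / 2, and A
    has no atoms. *)

Require Import Defs.
From HB Require Import structures.
From mathcomp Require Import all_boot all_order all_algebra.
From mathcomp Require Import all_classical all_reals all_analysis.
From mathcomp Require Import measurable_realfun.
From mathcomp Require Import complex ring lra.
Import Order.TTheory GRing.Theory Num.Theory.
Import numFieldNormedType.Exports.
Local Open Scope classical_set_scope.
Local Open Scope ring_scope.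
Set Implicit Arguments.
Unset Strict Implicit.
Unset Printing Implicit Defensive.

(** * Independence and decoupling *)

(** Independence is given only on rectangles and theta_0 is shared by all gains, so the law of [G_K]
    is reached through expectations of products. The functions (1 + y)^-j are the right tests: once
    theta_0 is frozen they split over k, they are bounded, and natural j suffices because indicators
    of rays are limits of polynomials in exp (- x). On the contour the bound at hand is only 1 /
    |s|, so neither the Mellin-Barnes integral nor its exchange with the expectation is absolutely
    convergent. Decay of the Mellin moments, available because K >= 1, settles the first; the Abel
    factor settles the second and is then removed using that same decay. The half-plane Re s < 0
    serves twice: Gamma(- s) is a convergent integral there, and (1 + R)^s is bounded by 1. Reducing
    Gamma(- s) / Gamma(1 - s) to - 1 / s divides by Gamma(- s), so Gamma must be shown not to
    vanish. A zero z would propagate to all z + n by the functional equation, and far to the right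
    an explicit lower bound of the integral excludes it. *)

Section decoupling.
Context d (T : measurableType d) (R : realType) (P : probability T R).

(** In the variable [A] both sides are finite measures, the restriction of [P] to [B] and a multiple
    of [P]. They agree on a pi-system containing the whole space, hence on the sigma-algebra it
    generates. *)
Lemma indep_sigma_half (C : set (set T)) (B : set T) :
  C `<=` measurable -> setI_closed C -> C setT -> measurable B ->
  (forall A, C A -> P (A `&` B) = (P A * P B)%E) ->
  forall A, <<s C >> A -> P (A `&` B) = (P A * P B)%E.
Proof.
move=> mC CI CT mB ind A sA.
have PBfin : P B \is a fin_num by exact: fin_num_measure.
have PB0 : (0 <= fine (P B))%R by exact: fine_ge0.
have cov : \bigcup_(k in [set: nat]) [set: T] = setT.
  by rewrite bigcup_const//; exists 0%N.
have /= := @g_sigma_algebra_measure_unique _ R T C mC (fun _ => setT)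
  (fun _ => CT) cov (mrestr P mB) (mscale (NngNum PB0) P) CI.
rewrite /mrestr /mscale/= fineK// => ->//.
- by rewrite muleC.
- by move=> X CX; rewrite ind// muleC.
- by move=> _; rewrite setTI ltey_eq PBfin.
Qed.

Variables C1 C2 : set (set T).
Hypotheses (mC1 : C1 `<=` measurable) (mC2 : C2 `<=` measurable).
Hypotheses (C1I : setI_closed C1) (C2I : setI_closed C2).
Hypotheses (C1T : C1 setT) (C2T : C2 setT).
Hypothesis indC : forall A B, C1 A -> C2 B -> P (A `&` B) = (P A * P B)%E.

Lemma indep_sigma (A B : set T) :
  <<s C1 >> A -> <<s C2 >> B -> P (A `&` B) = (P A * P B)%E.
Proof.
move=> sA sB.
have mA : measurable A.
  exact: (smallest_sub (@sigma_algebra_measurable _ T) mC1).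
rewrite setIC muleC; apply: (@indep_sigma_half C2) => // {B sB} B CB.
rewrite setIC muleC; apply: (@indep_sigma_half C1) => //; first exact: mC2.
by move=> X CX; exact: indC.
Qed.

Local Notation T1 := (g_sigma_algebraType C1).
Local Notation T2 := (g_sigma_algebraType C2).

Lemma measurable_id_sigma (C : set (set T)) : C `<=` measurable ->
  measurable_fun [set: T] (id : T -> g_sigma_algebraType C).
Proof.
move=> mC _ A mA; rewrite setTI preimage_id.
exact: (smallest_sub (@sigma_algebra_measurable _ T) mC).
Qed.

(** Independence of the two sigma-algebras says exactly that the diagonal t |-> (t, t), seen as a
    map into the product of [T] with the first and [T] with the second, transports [P] to a product
    measure. Tonelli then separates the two sample points. *)
Lemma decouple (F : T1 * T2 -> \bar R) :
  measurable_fun setT F -> (forall z, 0 <= F z)%E ->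
  (\int[P]_t F (t, t) = \int[P]_t \int[P]_u F (t, u))%E.
Proof.
move=> mF F0.
have mid1 : measurable_fun [set: T] (id : T -> T1) by exact: measurable_id_sigma.
have mid2 : measurable_fun [set: T] (id : T -> T2) by exact: measurable_id_sigma.
pose i1 : {mfun T >-> T1} := HB.pack (id : T -> T1) (isMeasurableFun.Build _ _ _ _ _ mid1).
pose i2 : {mfun T >-> T2} := HB.pack (id : T -> T2) (isMeasurableFun.Build _ _ _ _ _ mid2).
have mdiag : measurable_fun [set: T] ((fun t => (t, t)) : T -> T1 * T2).
  exact/measurable_fun_pair.
pose diag : {mfun T >-> (T1 * T2)%type} :=
  HB.pack ((fun t => (t, t)) : T -> T1 * T2) (isMeasurableFun.Build _ _ _ _ _ mdiag).
transitivity (\int[distribution P diag]_z F z)%E.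
  by rewrite ge0_integral_distribution.
transitivity (\int[distribution P i1 \x distribution P i2]_z F z)%E.
  apply: eq_measure_integral => /= A mA _.
  apply/esym/product_measure_unique => // X Y mX mY.
  exact: indep_sigma.
rewrite fubini_tonelli1//.
have mFF : measurable_fun setT (fubini_F (distribution P i2) F).
  exact: measurable_fun_fubini_tonelli_F.
rewrite ge0_integral_distribution//; last first.
  by move=> y; exact: integral_ge0.
apply: eq_integral => t _ /=; rewrite /fubini_F ge0_integral_distribution//.
exact: measurableT_comp.
Qed.

End decoupling.

Section independent_family.
Context d (T : measurableType d) (R : realType) (P : probability T R).
Variables (I : finType) (X : I -> T -> R).
Hypothesis mX : forall i, measurable_fun setT (X i).
Hypothesis indX : mutually_independent P X.

(** A pi-system generating the sigma-algebra of the [X i] with [i] in [J]. Unconstrained coordinates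
    carry the whole line, so that cylinders over complementary index sets intersect coordinatewise
    and the product formula applies. *)
Definition cylinders (J : pred I) : set (set T) :=
  [set A | exists B : I -> set R, [/\ forall i, measurable (B i),
     forall i, ~~ J i -> B i = setT &
     A = \bigcap_(i in [set: I]) (X i @^-1` B i)]].

Lemma measurable_cylinders J : cylinders J `<=` measurable.
Proof.
move=> _ [B [mB _ ->]]; apply: fin_bigcap_measurable; first exact: finite_finset.
by move=> i _; rewrite -[_ @^-1` _]setTI; exact: mX.
Qed.

Lemma cylinders_setI J : setI_closed (cylinders J).
Proof.
move=> _ _ [B [mB BJ ->]] [B' [mB' BJ' ->]].
exists (fun i => B i `&` B' i); split.
- by move=> i; exact: measurableI.
- by move=> i iJ; rewrite BJ// BJ'// setTI.
- by rewrite -bigcapI; apply: eq_bigcapr.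
Qed.

Lemma cylindersT J : cylinders J setT.
Proof.
by exists (fun=> setT); split => //; apply/seteqP; split.
Qed.

Lemma cylinders_indep J A B :
  cylinders J A -> cylinders (predC J) B -> P (A `&` B) = (P A * P B)%E.
Proof.
move=> [A' [mA AJ ->]] [B' [mB BJ ->]].
rewrite -bigcapI (_ : \bigcap_(i in _) _ =
    \bigcap_(i in [set: I]) (X i @^-1` (A' i `&` B' i))); last first.
  by apply: eq_bigcapr.
rewrite !indX//; last by move=> i; exact: measurableI.
rewrite -big_split/=; apply: eq_bigr => i _.
have [iJ|iJ] := boolP (J i).
  by rewrite BJ//= ?iJ// setIT preimage_setT probability_setT mule1.
by rewrite AJ//= setTI preimage_setT probability_setT mul1e.
Qed.

Lemma measurable_cylinder_fun (J : pred I) i : J i ->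
  measurable_fun setT (X i : g_sigma_algebraType (cylinders J) -> R).
Proof.
move=> iJ _ B mB; rewrite setTI; apply: sub_sigma_algebra.
exists (fun j => if j == i then B else setT); split.
- by move=> j; case: ifP.
- by move=> j; case: eqP => // ->; rewrite iJ.
- apply/seteqP; split => [t Bt j _|t /(_ i Logic.I)/=]; last by rewrite eqxx.
  by rewrite /=; case: eqP => // ->.
Qed.

Lemma cylindersS J J' : {subset J <= J'} -> cylinders J `<=` cylinders J'.
Proof.
move=> JJ' _ [B [mB BJ ->]]; exists B; split => // i iJ'; apply: BJ.
by apply: contra iJ' => /JJ'.
Qed.

Lemma decouple_family J
    (F : g_sigma_algebraType (cylinders J) *
         g_sigma_algebraType (cylinders (predC J)) -> \bar R) :
  measurable_fun setT F -> (forall z, 0 <= F z)%E ->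
  (\int[P]_t F (t, t) = \int[P]_t \int[P]_u F (t, u))%E.
Proof.
apply: decouple; [exact: measurable_cylinders|exact: measurable_cylinders|
  exact: cylinders_setI|exact: cylinders_setI|exact: cylindersT|
  exact: cylindersT|exact: cylinders_indep].
Qed.

Lemma measurable_cylindersW J J' d' (T' : measurableType d') (f : T -> T') :
  {subset J <= J'} ->
  measurable_fun setT (f : g_sigma_algebraType (cylinders J) -> T') ->
  measurable_fun setT (f : g_sigma_algebraType (cylinders J') -> T').
Proof.
move=> JJ' mf _ B mB; have := mf measurableT B mB.
by apply: sub_sigma_algebra2; exact: cylindersS.
Qed.

Lemma measurable_cylindersT J d' (T' : measurableType d') (f : T -> T') :
  measurable_fun setT (f : g_sigma_algebraType (cylinders J) -> T') ->
  measurable_fun [set: T] f.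
Proof.
move=> mf _ B mB; have := mf measurableT B mB; rewrite !setTI.
by apply: (smallest_sub (@sigma_algebra_measurable _ T)); exact: measurable_cylinders.
Qed.

Lemma expectation_indepM J (f g : T -> R) :
  measurable_fun setT (f : g_sigma_algebraType (cylinders J) -> R) ->
  measurable_fun setT (g : g_sigma_algebraType (cylinders (predC J)) -> R) ->
  (forall t, 0 <= f t) -> (forall t, 0 <= g t) ->
  (\int[P]_t (f t * g t)%:E = (\int[P]_t (f t)%:E) * \int[P]_t (g t)%:E)%E.
Proof.
move=> mf mg f0 g0.
have mf' := measurable_cylindersT mf; have mg' := measurable_cylindersT mg.
rewrite (@decouple_family J (fun z => (f z.1 * g z.2)%:E)); last 2 first.
- apply/measurable_EFinP/measurable_funM.
    exact: (measurableT_comp mf measurable_fst).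
  exact: (measurableT_comp mg measurable_snd).
- by move=> z; rewrite lee_fin mulr_ge0.
under eq_integral => t _.
  under eq_integral do rewrite EFinM /=.
  rewrite /= ge0_integralZl_EFin//; last first.
  - exact/measurable_EFinP.
  - by move=> u _; rewrite lee_fin.
  over.
rewrite ge0_integralZr//.
- exact/measurable_EFinP.
- by move=> t _; rewrite lee_fin.
- by apply: integral_ge0 => t _; rewrite lee_fin.
Qed.

Lemma expectation_indep_prod (K : finType) (J : K -> pred I) (f : K -> T -> R) :
  (forall k k' i, J k i -> J k' i -> k = k') ->
  (forall k, measurable_fun setT (f k : g_sigma_algebraType (cylinders (J k)) -> R)) ->
  (forall k t, 0 <= f k t) ->
  (\int[P]_t (\prod_k f k t)%:E = \prod_k \int[P]_t (f k t)%:E)%E.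
Proof.
move=> Jdis mf f0.
have : uniq (index_enum K) by exact: index_enum_uniq.
elim: (index_enum K) => [_|k s ih /= /andP[ks us]].
  under eq_integral do rewrite big_nil.
  rewrite big_nil integral_cst//.
  by rewrite [X in (_ * X)%E](_ : _ = 1%E) ?mule1//; exact: probability_setT.
under eq_integral do rewrite big_cons.
rewrite big_cons -ih//; apply: (@expectation_indepM (J k)) => //.
- apply: measurable_prod => j js.
  apply: measurable_cylindersW (mf j) => i ij; rewrite inE/=.
  by apply: contra ks => ik; rewrite (Jdis _ _ _ ik ij).
- by move=> t; exact: prodr_ge0.
Qed.

End independent_family.

(** * Integration on the half-line *)

Section pointwise_derivatives.
Context {R : realType}.
Implicit Types (f g : R -> R) (x : R).

Lemma derC (c : R) x : is_derive x (1 : R) (fun=> c) (0 : R).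
Proof. exact: is_derive_cst. Qed.

Lemma derI x : is_derive x (1 : R) (fun y => y) (1 : R).
Proof. exact: is_derive_id. Qed.

Lemma derD f g x (df dg : R) : is_derive x (1 : R) f df -> is_derive x (1 : R) g dg ->
  is_derive x (1 : R) (fun y => f y + g y) (df + dg).
Proof. by move=> hf hg; exact: is_deriveD. Qed.

Lemma derN f x (df : R) : is_derive x (1 : R) f df ->
  is_derive x (1 : R) (fun y => - f y) (- df).
Proof. by move=> hf; exact: is_deriveN. Qed.

Lemma derM f g x (df dg : R) : is_derive x (1 : R) f df -> is_derive x (1 : R) g dg ->
  is_derive x (1 : R) (fun y => f y * g y) (f x * dg + g x * df).
Proof. by move=> hf hg; exact: is_deriveM. Qed.

Lemma derX f n x (df : R) : is_derive x (1 : R) f df ->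
  is_derive x (1 : R) (fun y => f y ^+ n) (n%:R * f x ^+ n.-1 * df).
Proof.
move=> hf; have := @is_deriveX _ _ f n x 1 df hf.
by congr (is_derive _ _ _ _); apply/funext => y; rewrite fctE.
Qed.

Lemma derV f x (df : R) : f x != 0 -> is_derive x (1 : R) f df ->
  is_derive x (1 : R) (fun y => (f y)^-1) (- f x ^- 2 * df).
Proof. by move=> f0 hf; exact: is_deriveV. Qed.

Lemma der_comp f g x (df dg : R) : is_derive (g x) (1 : R) f df ->
  is_derive x (1 : R) g dg -> is_derive x (1 : R) (fun y => f (g y)) (df * dg).
Proof. by move=> hf hg; exact: (is_derive1_comp hf hg). Qed.

Lemma der_expR f x (df : R) : is_derive x (1 : R) f df ->
  is_derive x (1 : R) (fun y => expR (f y)) (expR (f x) * df).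
Proof. by move=> hf; apply: der_comp hf; exact: is_derive_expR. Qed.

Lemma der_cos f x (df : R) : is_derive x (1 : R) f df ->
  is_derive x (1 : R) (fun y => cos (f y)) (- sin (f x) * df).
Proof. by move=> hf; apply: der_comp hf; exact: is_derive_cos. Qed.

Lemma der_sin f x (df : R) : is_derive x (1 : R) f df ->
  is_derive x (1 : R) (fun y => sin (f y)) (cos (f x) * df).
Proof. by move=> hf; apply: der_comp hf; exact: is_derive_sin. Qed.

Lemma der_ln f x (df : R) : 0 < f x -> is_derive x (1 : R) f df ->
  is_derive x (1 : R) (fun y => ln (f y)) ((f x)^-1 * df).
Proof. by move=> f0 hf; apply: der_comp hf; exact: is_derive1_ln. Qed.

Lemma der_atan f x (df : R) : is_derive x (1 : R) f df ->
  is_derive x (1 : R) (fun y => atan (f y)) ((1 + f x ^+ 2)^-1 * df).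
Proof. by move=> hf; apply: der_comp hf; exact: is_derive1_atan. Qed.

Lemma der_eq f x (df df' : R) : is_derive x (1 : R) f df' -> df' = df ->
  is_derive x (1 : R) f df.
Proof. by move=> h <-. Qed.

Lemma der_continuous f x (df : R) : is_derive x (1 : R) f df -> {for x, continuous f}.
Proof. by case=> h _; apply/differentiable_continuous/derivable1_diffP. Qed.

End pointwise_derivatives.

(** Differentiation directed by the shape of the function; the side conditions of [ln] and of
    inverses remain as goals. *)
Ltac derive_step := lazymatch goal with
  | |- is_derive _ _ (fun _ => ?c) _ => apply derC
  | |- is_derive _ _ (fun y => y) _ => apply derI
  | |- is_derive _ _ (fun y => @?f y + @?g y) _ => eapply derD
  | |- is_derive _ _ (fun y => - @?f y) _ => eapply derN
  | |- is_derive _ _ (fun y => @?f y * @?g y) _ => eapply derM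
  | |- is_derive _ _ (fun y => @?f y ^+ ?n) _ => eapply derX
  | |- is_derive _ _ (fun y => (@?f y)^-1) _ => eapply derV
  | |- is_derive _ _ (fun y => expR (@?f y)) _ => eapply der_expR
  | |- is_derive _ _ (fun y => cos (@?f y)) _ => eapply der_cos
  | |- is_derive _ _ (fun y => sin (@?f y)) _ => eapply der_sin
  | |- is_derive _ _ (fun y => ln (@?f y)) _ => eapply der_ln
  | |- is_derive _ _ (fun y => atan (@?f y)) _ => eapply der_atan
  | |- is_derive _ _ (GRing.mul ?b) _ => eapply (derM (f := fun=> b) (g := fun y => y))
  | |- is_derive _ _ (GRing.add ?b) _ => eapply (derD (f := fun=> b) (g := fun y => y))
  | |- is_derive _ _ (@GRing.opp _) _ => eapply (derN (f := fun y => y))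
  | |- is_derive _ _ (@expR _) _ => eapply (der_expR (f := fun y => y))
  | |- is_derive _ _ (@cos _) _ => eapply (der_cos (f := fun y => y))
  | |- is_derive _ _ (@sin _) _ => eapply (der_sin (f := fun y => y))
  | |- is_derive _ _ (@ln _) _ => eapply (der_ln (f := fun y => y))
  | |- is_derive _ _ _ _ => eassumption
  end.
Ltac der := eapply der_eq; [repeat derive_step | cbv beta].
Section half_line.
Context {R : realType}.
Notation mu := (@lebesgue_measure R).
Implicit Types f F : R -> R.

(** Compact intervals [1 / (n + 2), n + 2] exhausting the open half-line. The shift keeps them
    nondegenerate already at n = 0, as the fundamental theorem on a segment requires. *)
Let A (n : nat) : set R := `[harmonic n.+1, n.+2%:R]%classic.

Let bigcup_A : \bigcup_n A n = `]0, +oo[%classic.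
Proof.
apply/seteqP; split => [x [n _]|x].
  rewrite /A/= !in_itv/= andbT => /andP[+ _]; apply: lt_le_trans.
  exact: harmonic_gt0.
rewrite /= in_itv/= andbT => x0.
have xV0 : 0 <= x^-1 by rewrite invr_ge0 ltW.
exists (maxn (Num.truncn x) (Num.truncn x^-1)) => //.
rewrite /A /= in_itv/=; apply/andP; split.
- rewrite /harmonic -[leRHS]invrK lef_pV2 ?posrE ?invr_gt0//.
  apply: (le_trans (ltW (truncnS_gt x^-1))); rewrite ler_nat.
  by rewrite (leq_trans _ (leqnSn _))// ltnS leq_maxr.
- apply: (le_trans (ltW (truncnS_gt x))); rewrite ler_nat.
  by rewrite (leq_trans _ (leqnSn _))// ltnS leq_maxl.
Qed.

Let ndA : nondecreasing_seq A.
Proof.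
move=> m n mn; rewrite subsetEset => x; rewrite /A /= !in_itv/= => /andP[h1 h2].
rewrite (le_trans _ h1)/= ?(le_trans h2) ?ler_nat ?ltnS//.
by rewrite /harmonic lef_pV2 ?posrE// ler_nat !ltnS.
Qed.

Let A_gt0 n x : A n x -> 0 < x.
Proof.
by rewrite /A/= in_itv/= => /andP[+ _]; apply: lt_le_trans; exact: harmonic_gt0.
Qed.

Let FTC2_A f F n : (forall x : R, 0 < x -> {for x, continuous f}) ->
  (forall x : R, 0 < x -> is_derive x (1 : R) F (f x)) ->
  (\int[mu]_(x in A n) (f x)%:E = (F n.+2%:R - F (harmonic n.+1))%:E)%E.
Proof.
move=> cf dF; rewrite EFinB.
have h0 : (0:R) < harmonic n.+1 by exact: harmonic_gt0.
have cF x : 0 < x -> {for x, continuous F}.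
  by move=> x0; apply/differentiable_continuous/derivable1_diffP; case: (dF x x0).
apply: continuous_FTC2.
- by apply: (@le_lt_trans _ _ 1); rewrite /harmonic ?invf_le1 ?ler1n ?ltr1n.
- apply: continuous_in_subspaceT => x; rewrite inE => /A_gt0; exact: cf.
- split => [x||].
  + rewrite in_itv/= => /andP[xa _]; have x0 := lt_trans h0 xa.
    by case: (dF x x0).
  + by apply: cvg_at_right_filter; exact: cF.
  + by apply: cvg_at_left_filter; exact: cF.
- move=> x; rewrite in_itv/= => /andP[xa _]; have x0 := lt_trans h0 xa.
  by rewrite derive1E; case: (dF x x0).
Qed.

Let cvg_A F (L0 L : R) : F x @[x --> 0^'+] --> L0 -> F x @[x --> +oo] --> L ->
  F n.+2%:R - F (harmonic n.+1) @[n --> \oo] --> L - L0.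
Proof.
move=> F0 Fy; apply: cvgB.
  apply: ((cvg_pinftyP F L).1 Fy).
  by have := @cvgr_idn R; rewrite -(cvg_shiftn 2)/=; under eq_fun do rewrite addn2.
apply: ((cvg_at_rightP _ _ _).1 F0); split; first by move=> n; exact: harmonic_gt0.
by have := @cvg_harmonic R; rewrite -(cvg_shiftn 1)/=; under eq_fun do rewrite addn1.
Qed.

Lemma measurable_continuous_pos f : (forall x : R, 0 < x -> {for x, continuous f}) ->
  measurable_fun (`]0, +oo[ : set R) f.
Proof.
move=> cf; apply: open_continuous_measurable_fun => //.
by move=> x; rewrite inE/= in_itv/= andbT; exact: cf.
Qed.

Lemma ge0_FTC2_0y f F (L0 L : R) :
  (forall x : R, 0 < x -> {for x, continuous f}) ->
  (forall x : R, 0 < x -> is_derive x (1 : R) F (f x)) ->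
  F x @[x --> 0^'+] --> L0 -> F x @[x --> +oo] --> L ->
  (forall x : R, 0 < x -> 0 <= f x) ->
  (\int[mu]_(x in `]0%R, +oo[) (f x)%:E = (L - L0)%:E)%E.
Proof.
move=> cf dF F0 Fy f0.
have mf := measurable_continuous_pos cf.
have : (\int[mu]_(x in A n) (f x)%:E @[n --> \oo] -->
    \int[mu]_(x in \bigcup_n A n) (f x)%:E)%E.
  apply: ge0_nondecreasing_set_cvg_integral => //.
  - by move=> n; exact: measurable_itv.
  - move=> n; apply/measurable_EFinP; apply: measurable_funS mf => //.
    by move=> x /A_gt0; rewrite /= in_itv/= andbT.
  - by move=> n x /A_gt0 x0; rewrite lee_fin f0.
rewrite bigcup_A => /cvg_unique; apply => //.
rewrite (_ : (fun n => _) = EFin \o (fun n => F n.+2%:R - F (harmonic n.+1))).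
  by apply: cvg_EFin; [exact: nearW|exact: cvg_A].
by apply/funext => n; rewrite (FTC2_A _ cf dF).
Qed.

(** For oscillating integrands monotone convergence is replaced by dominated convergence with
    majorant |f|, which is why integrability is assumed here. The primitive needs only a limit at 0,
    so that it may involve [ln]. *)
Lemma FTC2_0y f F (L0 L : R) :
  (forall x : R, 0 < x -> {for x, continuous f}) ->
  (forall x : R, 0 < x -> is_derive x (1 : R) F (f x)) ->
  F x @[x --> 0^'+] --> L0 -> F x @[x --> +oo] --> L ->
  mu.-integrable `]0, +oo[ (EFin \o f) ->
  (\int[mu]_(x in `]0%R, +oo[) (f x)%:E = (L - L0)%:E)%E.
Proof.
move=> cf dF F0 Fy intf.
have mf := measurable_continuous_pos cf.
have A0y n : A n `<=` `]0, +oo[%classic.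
  by move=> x /A_gt0; rewrite /= in_itv/= andbT.
have := @dominated_convergence _ _ R mu `]0, +oo[%classic (measurable_itv _)
  (fun n => (EFin \o f) \_ (A n)) (EFin \o f) (abse \o (EFin \o f)).
case.
- move=> n; apply: (@measurable_restrict _ _ _ _ (A n) _ (EFin \o f) _ _).1 => //.
    exact: measurable_itv.
  by rewrite setIidr//; apply/measurable_EFinP; exact: measurable_funS mf.
- exact/measurable_EFinP.
- apply: aeW => x; rewrite -bigcup_A => -[N _ ANx].
  apply: cvg_near_cst; exists N => // n /= Nn.
  by rewrite patchE mem_set//; have /subsetPset := ndA Nn; exact.
- exact: integrable_abse.
- apply: aeW => x n _; rewrite patchE; case: ifP => // _.
  by rewrite (_ : point = 0%E)// abse0 abse_ge0.
move=> _ _ /cvg_unique; apply => //.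
rewrite (_ : (fun n => _) = EFin \o (fun n => F n.+2%:R - F (harmonic n.+1))).
  by apply: cvg_EFin; [exact: nearW|exact: cvg_A].
apply/funext => n; rewrite /= -(FTC2_A _ cf dF) [RHS]integral_mkcond.
rewrite [LHS]integral_mkcond; apply: eq_integral => x _.
rewrite !patchE; case: ifPn => //; case: ifPn => //.
by rewrite inE => /A0y xA; rewrite mem_set.
Qed.

End half_line.

(** * Gamma integrals with integer shape *)

Section gamma_integrals.
Context {R : realType}.
Notation mu := (@lebesgue_measure R).

Lemma cvg_expn_expR (n : nat) (b : R) : 0 < b ->
  x ^+ n * expR (- (b * x)) @[x --> +oo] --> (0 : R).
Proof.
(* From exp y >= y^(n+1) / (n+1)! at y = b x: the product is at most C / x. *)
move=> b0; pose C : R := n.+1`!%:R / b ^+ n.+1.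
apply: (@squeeze_cvgr _ _ _ _ (cst 0) (fun x => C * x^-1)).
- near=> x; have x0 : 0 < x by near: x; exact: nbhs_pinfty_gt.
  rewrite mulr_ge0 ?exprn_ge0 ?expR_ge0 ?(ltW x0)//=.
  have bx0 : 0 <= b * x by rewrite mulr_ge0// ltW.
  have := expR_ge1Dxn n bx0.
  rewrite expRN ler_pdivrMr ?expR_gt0// => h.
  rewrite mulrAC ler_pdivlMr// -exprSr.
  apply: (@le_trans _ _ (C * ((b * x) ^+ n.+1 / n.+1`!%:R))); last first.
    rewrite ler_wpM2l ?divr_ge0 ?exprn_ge0 ?(ltW b0)//.
    by rewrite (le_trans _ h)// lerDr.
  by rewrite /C exprMn mulrA mulrA divfK ?expf_neq0 ?gt_eqF// mulrAC divff ?mul1r// pnatr_eq0 -lt0n fact_gt0.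
- exact: cvg_cst.
- rewrite -[X in _ --> X](mulr0 C); apply: cvgM; first exact: cvg_cst.
  by apply/gtr0_cvgV0; [near=> x; near: x; exact: nbhs_pinfty_gt|exact: cvg_id].
Unshelve. all: by end_near. Qed.

Lemma is_derive_expRNM (b x : R) :
  is_derive x (1 : R) (fun x => expR (- (b * x))) (- b * expR (- (b * x))).
Proof.
by der; ring.
Qed.

Lemma continuous_expRNM (b : R) : continuous (fun x : R => expR (- (b * x))).
Proof.
move=> x; apply/differentiable_continuous/derivable1_diffP.
by case: (is_derive_expRNM b x).
Qed.

Lemma continuous_expn_expR (n : nat) (b : R) :
  continuous (fun x : R => x ^+ n * expR (- (b * x))).
Proof.
by move=> x; apply: cvgM; [exact: exprn_continuous|exact: continuous_expRNM].
Qed.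

(** The primitive of x^n exp (- b x) obtained by repeated integration by parts. It vanishes at
    infinity, so its value at 0 is minus the Gamma integral. *)
Fixpoint gamma_primitive (b : R) (n : nat) (x : R) : R :=
  if n is n'.+1 then - b^-1 * (x ^+ n * expR (- (b * x))) +
                     n%:R / b * gamma_primitive b n' x
  else - b^-1 * expR (- (b * x)).

Lemma is_derive_gamma_primitive b n x : b != 0 ->
  is_derive x (1 : R) (gamma_primitive b n) (x ^+ n * expR (- (b * x))).
Proof.
move=> b0; elim: n => [|n ih] /=.
  by der; rewrite expr0; field.
by der; rewrite /= exprS; field.
Qed.

Lemma gamma_primitive_cvgy b n : 0 < b -> gamma_primitive b n x @[x --> +oo] --> (0 : R).
Proof.
move=> b0; elim: n => [|n ih] /=.
  rewrite -[X in _ --> X](mulr0 (- b^-1)); apply: cvgM; first exact: cvg_cst.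
  have := cvg_expn_expR 0 b0.
  by under eq_fun do rewrite expr0 mul1r.
rewrite -[X in _ --> X](addr0 0); apply: cvgD.
  rewrite -[X in _ --> X](mulr0 (- b^-1)); apply: cvgM; first exact: cvg_cst.
  exact: cvg_expn_expR.
rewrite -[X in _ --> X](mulr0 (n.+1%:R / b)); apply: cvgM; [exact: cvg_cst|exact: ih].
Qed.

Lemma gamma_primitive0 b n : b != 0 -> gamma_primitive b n 0 = - (n`!%:R / b ^+ n.+1).
Proof.
move=> b0; elim: n => [|n ih] /=.
  by rewrite mulr0 oppr0 expR0 mulr1 fact0 expr1 mul1r.
rewrite ih expr0n/= mul0r mulr0 add0r factS natrM !exprS.
by field; rewrite b0 expf_neq0.
Qed.

Lemma integral_expn_expR (n : nat) (b : R) : 0 < b ->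
  (\int[mu]_(x in `]0%R, +oo[) (x ^+ n * expR (- (b * x)))%:E =
   (n`!%:R / b ^+ n.+1)%:E)%E.
Proof.
move=> b0; have bN0 : b != 0 by rewrite gt_eqF.
have cf (x : R) : 0 < x -> {for x, continuous (fun x : R => x ^+ n * expR (- (b * x)))}.
  by move=> _; exact: continuous_expn_expR.
have dF (x : R) : 0 < x ->
    is_derive x (1 : R) (gamma_primitive b n) (x ^+ n * expR (- (b * x))).
  by move=> _; exact: is_derive_gamma_primitive.
have F0 : gamma_primitive b n x @[x --> 0^'+] --> gamma_primitive b n 0.
  apply: cvg_at_right_filter; apply: der_continuous.
  exact: is_derive_gamma_primitive.
rewrite (ge0_FTC2_0y cf dF F0 (gamma_primitive_cvgy n b0)).
  by rewrite gamma_primitive0// sub0r opprK.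
by move=> x x0; rewrite mulr_ge0 ?expR_ge0// exprn_ge0// ltW.
Qed.

Lemma integrable_expn_expR (n : nat) (b : R) : 0 < b ->
  mu.-integrable `]0%R, +oo[ (EFin \o (fun x => x ^+ n * expR (- (b * x)))).
Proof.
move=> b0; apply/integrableP; split.
  apply/measurable_EFinP; apply: measurable_continuous_pos => x _.
  exact: continuous_expn_expR.
rewrite (_ : (\int[mu]_(x in _) _)%E =
    \int[mu]_(x in `]0%R, +oo[) (x ^+ n * expR (- (b * x)))%:E)%E.
  by rewrite integral_expn_expR// ltry.
apply: eq_integral => x; rewrite inE/= in_itv/= andbT => x0.
by rewrite ger0_norm// mulr_ge0 ?expR_ge0// exprn_ge0// ltW.
Qed.

Lemma GammaRS (n : nat) : GammaR n.+1%:R = n`!%:R :> R.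
Proof.
rewrite /GammaR /Rintegral.
have := integral_expn_expR n (@ltr01 R); rewrite expr1n divr1 => h.
rewrite (_ : integral _ _ _ = (n`!%:R)%:E)// -h.
apply: eq_integral => x; rewrite inE/= in_itv/= andbT => x0.
by rewrite mul1r -natr1 addrK powR_mulrn// ltW.
Qed.

Lemma gamma_pdfE (n : nat) (b x : R) : 0 < x -> 0 < b ->
  gamma_pdf n.+1%:R b x = (n`!%:R * b ^+ n.+1)^-1 * (x ^+ n * expR (- (b^-1 * x))).
Proof.
move=> x0 b0; rewrite /gamma_pdf x0 GammaRS -[in LHS]natr1 addrK natr1.
by rewrite (powR_mulrn n (ltW x0)) (powR_mulrn n.+1 (ltW b0)) [x / b]mulrC [LHS]mulrC.
Qed.

Lemma gamma_pdf_ge0 (n : nat) (b x : R) : 0 < b -> 0 <= gamma_pdf n.+1%:R b x.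
Proof.
move=> b0; have [x0|x0] := ltP 0 x; last by rewrite /gamma_pdf ltNge x0.
rewrite gamma_pdfE// mulr_ge0 ?mulr_ge0 ?expR_ge0// ?invr_ge0 ?mulr_ge0 ?exprn_ge0//; exact: ltW.
Qed.

Lemma measurable_gamma_pdf (n : nat) (b : R) : 0 < b ->
  measurable_fun setT (gamma_pdf n.+1%:R b).
Proof.
move=> b0; pose g (x : R) := (n`!%:R * b ^+ n.+1)^-1 * (x ^+ n * expR (- (b^-1 * x))).
have -> : gamma_pdf n.+1%:R b = (fun x => if 0 < x then g x else 0).
  apply/funext => x; case: ifPn => [x0|]; first by rewrite gamma_pdfE.
  by rewrite /gamma_pdf; case: ifP.
apply: measurable_fun_ifT => //.
  exact: measurable_fun_ltr.
apply: measurable_funM => //; apply: continuous_measurable_fun.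
exact: continuous_expn_expR.
Qed.

Lemma integral_gamma_pdfM (n : nat) (b : R) (h : R -> R) : 0 < b ->
  measurable_fun setT h -> (forall x, 0 <= h x) ->
  (\int[mu]_x (gamma_pdf n.+1%:R b x * h x)%:E =
   \int[mu]_(x in `]0%R, +oo[)
     ((n`!%:R * b ^+ n.+1)^-1 * (x ^+ n * expR (- (b^-1 * x)) * h x))%:E)%E.
Proof.
move=> b0 mh h0; rewrite [RHS]integral_mkcond; apply: eq_integral => x _.
rewrite patchE; case: ifPn; rewrite ?inE ?notin_setE/= in_itv/= andbT => x0.
  by rewrite gamma_pdfE// !mulrA.
by rewrite /gamma_pdf; case: ifPn => //; rewrite mul0r.
Qed.

Lemma integral_gamma_pdf_expR (n : nat) (b s : R) : 0 < b -> 0 <= s ->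
  (\int[mu]_x (gamma_pdf n.+1%:R b x * expR (- (s * x)))%:E =
   ((1 + b * s) ^- n.+1)%:E)%E.
Proof.
move=> b0 s0; rewrite integral_gamma_pdfM//; last first.
  exact: (continuous_measurable_fun (@continuous_expRNM s)).
have bs0 : 0 < b^-1 + s by rewrite ltr_wpDr ?invr_gt0.
under eq_integral do rewrite -[X in _ * X]mulrA -expRD -opprD -mulrDl EFinM.
rewrite ge0_integralZl_EFin//; last 3 first.
- move=> x; rewrite /= in_itv/= andbT => x0.
  by rewrite lee_fin mulr_ge0 ?expR_ge0// exprn_ge0// ltW.
- apply/measurable_EFinP; apply: measurable_continuous_pos => x _.
  exact: continuous_expn_expR.
- by rewrite invr_ge0 mulr_ge0// exprn_ge0// ltW.
rewrite integral_expn_expR// -EFinM; congr EFin.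
have -> : 1 + b * s = b * (b^-1 + s) by field; rewrite gt_eqF.
rewrite exprMn; field.
by rewrite !expf_neq0 ?gt_eqF// pnatr_eq0 -lt0n fact_gt0.
Qed.

End gamma_integrals.

(** * Uniqueness for Laplace transforms *)

Section laplace_uniqueness.
Context {R : realType}.

Lemma bernoulli_ineq (u : R) (q : nat) : 0 <= u <= 1 -> 1 - q%:R * u <= (1 - u) ^+ q.
Proof.
move=> /andP[u0 u1]; elim: q => [|q ih]; first by rewrite mul0r subr0 expr0.
rewrite exprS; apply: (@le_trans _ _ ((1 - u) * (1 - q%:R * u))); last first.
  by rewrite ler_wpM2l// subr_ge0.
rewrite -natr1 -subr_ge0.
rewrite (_ : _ - _ = q%:R * u ^+ 2); last by ring.
by rewrite mulr_ge0// sqr_ge0.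
Qed.

(* [threshold t n] converges pointwise to the indicator of ]t, +oo[ on [0, +oo[ while
   being a polynomial in [expR (- x)]. *)
Let deg (t : R) (n : nat) := (Num.truncn (n%:R * expR (n%:R * t))).+1.
Let threshold (t : R) (n : nat) (x : R) := (1 - expR (- (n%:R * x))) ^+ deg t n.

Let expR_itv (n : nat) (x : R) : 0 <= x -> 0 <= expR (- (n%:R * x)) <= 1.
Proof. by move=> x0; rewrite expR_ge0 expR_le1 oppr_le0 mulr_ge0. Qed.

Let threshold_itv (t : R) n x : 0 <= x -> 0 <= threshold t n x <= 1.
Proof.
move=> x0; have /andP[e0 e1] := expR_itv n x0.
by rewrite exprn_ge0 ?subr_ge0// exprn_ile1 ?subr_ge0// lerBlDr lerDl.
Qed.

Lemma cvgn_expn_expR (k : nat) (b : R) : 0 < b ->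
  n%:R ^+ k * expR (- (b * n%:R)) @[n --> \oo] --> (0 : R).
Proof.
move=> b0; have /cvg_pinftyP := @cvg_expn_expR R k b b0.
by apply; exact: cvgr_idn.
Qed.

(** The exponent is about n exp (n t). For x > t, Bernoulli bounds the defect from 1 by n exp (- n
    (x - t)) + exp (- n x). For x <= t, 1 - u <= exp (- u) bounds the power by exp (- n); the extra
    factor n in the exponent is what covers x = t. *)
Let cvg_threshold (t x : R) : 0 <= t -> 0 <= x ->
  threshold t n x @[n --> \oo] --> (\1_(`]t, +oo[) x : R).
Proof.
move=> t0 x0; rewrite indicE; have [tx|xt] := ltP t x.
  rewrite mem_set/= ?in_itv/= ?tx//.
  pose v n : R := n%:R ^+ 1 * expR (- ((x - t) * n%:R)) + n%:R ^+ 0 * expR (- (x * n%:R)).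
  apply: (@squeeze_cvgr _ _ _ _ (fun n => 1 - v n) (cst 1)).
  - apply: nearW => n; have /andP[_ ->] := threshold_itv t n x0; rewrite andbT.
    apply: le_trans (bernoulli_ineq _ (expR_itv n x0)).
    rewrite lerD2l lerN2 /v expr1 expr0 mul1r.
    have -> : expR (- ((x - t) * n%:R)) = expR (n%:R * t) * expR (- (n%:R * x)).
      by rewrite -expRD; congr expR; ring.
    rewrite mulrA [x * _]mulrC -[X in _ + X]mul1r -mulrDl ler_wpM2r ?expR_ge0//.
    rewrite -natr1 lerD2r truncn_le mulr_ge0 ?expR_ge0//.
  - rewrite -[X in _ --> X](subr0 1); apply: cvgB; first exact: cvg_cst.
    rewrite -[X in _ --> X](addr0 0); apply: cvgD; apply: cvgn_expn_expR.
      by rewrite subr_gt0.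
    exact: le_lt_trans tx.
  - exact: cvg_cst.
rewrite memNset/= ?in_itv/= ?ltNge ?xt//.
apply: (@squeeze_cvgr _ _ _ _ (cst 0) (fun n => n%:R ^+ 0 * expR (- (1 * n%:R)))).
- apply: nearW => n; have /andP[-> _] := threshold_itv t n x0.
  rewrite expr0 !mul1r /= /threshold.
  have /andP[e0 e1] := expR_itv n x0.
  apply: (@le_trans _ _ (expR (- expR (- (n%:R * x))) ^+ deg t n)).
    rewrite lerXn2r ?nnegrE ?subr_ge0 ?expR_ge0//.
    exact: expR_ge1Dx.
  rewrite -expRM_natl ler_expR mulrN lerN2.
  apply: (@le_trans _ _ (n%:R * expR (n%:R * t) * expR (- (n%:R * x)))).
    rewrite -mulrA -expRD ler_peMr// -expR0 ler_expR -mulrBr mulr_ge0// subr_ge0//.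
  by rewrite ler_wpM2r ?expR_ge0// ltW// truncnS_gt.
- exact: cvg_cst.
- by apply: cvgn_expn_expR.
Qed.

Let D : set R := `[0, +oo[%classic.

Let mD : measurable D. Proof. exact: measurable_itv. Qed.

(** The factor exp (- j x) carries the induction on [q]: raising [q] by one subtracts the same
    function with [j + n] in place of [j]. Integrals of all these functions are thus determined by
    the moments with q = 0. *)
Let f (n j q : nat) (x : R) := expR (- (j%:R * x)) * (1 - expR (- (n%:R * x))) ^+ q.

Let mf n j q : measurable_fun [set: measurableTypeR R] (f n j q).
Proof.
suff : measurable_fun [set: R] (f n j q) by [].
apply: measurable_funM.
  exact: (continuous_measurable_fun (@continuous_expRNM R j%:R)).
apply: measurable_funX; apply: measurable_funB => //.
exact: (continuous_measurable_fun (@continuous_expRNM R n%:R)).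
Qed.

Let f_ge0 n j q x : 0 <= x -> 0 <= f n j q x.
Proof.
move=> x0; rewrite /f mulr_ge0 ?expR_ge0// exprn_ge0// subr_ge0.
by have /andP[] := expR_itv n x0.
Qed.

Let f_le1 n j q x : 0 <= x -> f n j q x <= 1.
Proof.
move=> x0; have /andP[e0 e1] := expR_itv n x0; have /andP[e0' e1'] := expR_itv j x0.
rewrite /f mulr_ile1 ?exprn_ge0 ?subr_ge0//.
by rewrite exprn_ile1 ?subr_ge0// lerBlDr lerDl.
Qed.

Let integral_fS (m : {measure set (measurableTypeR R) -> \bar R}) n j q :
  (\int[m]_(x in D) (f n j q x)%:E =
   \int[m]_(x in D) (f n j q.+1 x)%:E + \int[m]_(x in D) (f n (j + n) q x)%:E)%E.
Proof.
rewrite -ge0_integralD//=.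
- apply: eq_integral => x _; rewrite -EFinD; congr EFin.
  by rewrite /f natrD mulrDl opprD expRD exprS; ring.
- by move=> x; rewrite /D/= in_itv/= andbT lee_fin; exact: f_ge0.
- by apply/measurable_EFinP; exact: measurable_funTS.
- by move=> x; rewrite /D/= in_itv/= andbT lee_fin; exact: f_ge0.
- by apply/measurable_EFinP; exact: measurable_funTS.
Qed.

Let integral_f_lty (m : {measure set (measurableTypeR R) -> \bar R}) n j q :
  (m D < +oo)%E -> (\int[m]_(x in D) (f n j q x)%:E < +oo)%E.
Proof.
move=> mfin; apply: (@le_lt_trans _ _ (\int[m]_(x in D) (cst 1%E) x)%E).
  apply: ge0_le_integral => //.
  - by move=> x; rewrite /D/= in_itv/= andbT lee_fin; exact: f_ge0.
  - by apply/measurable_EFinP; exact: measurable_funTS.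
  - by move=> x; rewrite /D/= in_itv/= andbT lee_fin; exact: f_le1.
by rewrite integral_cst// mul1e.
Qed.

Lemma integral_restrict_ge0 (m : {measure set (measurableTypeR R) -> \bar R}) (j : nat) :
  m `]-oo, 0[%classic = 0%E ->
  (\int[m]_(x in `[0%R, +oo[) (expR (- (j%:R * x)))%:E =
   \int[m]_x (expR (- (j%:R * x)))%:E)%E.
Proof.
have mexp : measurable_fun setT ((fun x => expR (- (j%:R * x))) : measurableTypeR R -> R).
  exact: (continuous_measurable_fun (@continuous_expRNM R j%:R)).
move=> m0; rewrite [in RHS](_ : setT = `]-oo, 0[%classic `|` `[0, +oo[%classic :> set R).
  rewrite ge0_integral_setU//; first last.
  - by apply/disj_setPLR => x /=; rewrite !in_itv/= andbT => h; apply/negP; rewrite -ltNge.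
  - by apply/measurable_EFinP; exact: measurable_funTS.
  rewrite [X in (X + _)%E]null_set_integral ?add0e//.
  by apply: measurable_funTS; exact/measurable_EFinP.
by apply/seteqP; split => // x _; rewrite /= !in_itv/= andbT; case: (ltP x 0); [left|right].
Qed.

(** Equal moments give equal integrals of polynomials in exp (- x), hence equal masses of the rays
    ]t, +oo[ with t >= 0 by bounded convergence; rays with t < 0 have the full mass. Rays form a
    generating pi-system. The moment j = 0 transfers finiteness from [m1] to [m2]. *)
Lemma laplace_unique (m1 m2 : {measure set (measurableTypeR R) -> \bar R}) :
  (m1 [set: R] < +oo)%E -> m1 `]-oo, 0[%classic = 0%E -> m2 `]-oo, 0[%classic = 0%E ->
  (forall j : nat, \int[m1]_(x in `[0%R, +oo[) (expR (- (j%:R * x)))%:E =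
                   \int[m2]_(x in `[0%R, +oo[) (expR (- (j%:R * x)))%:E)%E ->
  forall B, measurable B -> m1 B = m2 B.
Proof.
move=> m1fin m1n m2n m12.
have m1D : (m1 D < +oo)%E.
  by apply: le_lt_trans m1fin; apply: le_measure; rewrite ?inE//; exact: measurableT.
have mDE (m : {measure set (measurableTypeR R) -> \bar R}) : (\int[m]_(x in D) (expR (- (0%:R * x)))%:E = m D)%E.
  rewrite (eq_integral (cst 1%E)); first by rewrite integral_cst// mul1e.
  by move=> x _; rewrite mul0r oppr0 expR0.
have m2D : (m2 D < +oo)%E by rewrite -mDE -m12 mDE.
have int_f n q j : (\int[m1]_(x in D) (f n j q x)%:E = \int[m2]_(x in D) (f n j q x)%:E)%E.
  elim: q j => [j|q ih j].
    under eq_integral do rewrite /f expr0 mulr1.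
    by under [RHS]eq_integral do rewrite /f expr0 mulr1.
  have h (m : {measure set (measurableTypeR R) -> \bar R}) : (m D < +oo)%E -> (\int[m]_(x in D) (f n j q.+1 x)%:E =
      \int[m]_(x in D) (f n j q x)%:E - \int[m]_(x in D) (f n (j + n) q x)%:E)%E.
    move=> mfin; rewrite (integral_fS m n j q) addeK//.
    rewrite ge0_fin_numE ?integral_f_lty//; apply: integral_ge0 => x.
    by rewrite /D/= in_itv/= andbT lee_fin; exact: f_ge0.
  by rewrite !h// !ih.
have cvgm (m : {measure set (measurableTypeR R) -> \bar R}) t : (m D < +oo)%E -> 0 <= t ->
    (\int[m]_(x in D) (f n 0 (deg t n) x)%:E @[n --> \oo] --> m `]t, +oo[%classic)%E.
  move=> mfin t0.
  have -> : m `]t, +oo[%classic = (\int[m]_(x in D) (\1_(`]t, +oo[) x)%:E)%E.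
    rewrite integral_indic// ?setIidl// => x; rewrite /D/= !in_itv/= !andbT => tx.
    exact: le_trans t0 (ltW tx).
  have [] := @dominated_convergence _ _ R m D mD
    (fun n x => (f n 0 (deg t n) x)%:E) (fun x => (\1_(`]t, +oo[) x)%:E) (cst 1%E).
  - by move=> n; apply/measurable_EFinP; exact: measurable_funTS.
  - by apply/measurable_EFinP; exact: (@measurable_indic _ (measurableTypeR R)).
  - apply: aeW => x; rewrite /D/= in_itv/= andbT => x0.
    apply: cvg_EFin; first exact: nearW.
    rewrite [X in X @ _](_ : _ = (fun n => threshold t n x)); first exact: cvg_threshold.
    by apply/funext => n /=; rewrite /f mul0r oppr0 expR0 mul1r.
  - apply/integrableP; split; first exact: measurable_cst.
    rewrite (eq_integral (cst 1%E)); first by rewrite integral_cst// mul1e.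
    by move=> x _; rewrite /= normr1.
  - apply: aeW => x n; rewrite /D/= in_itv/= andbT => x0.
    by rewrite /= ger0_norm ?f_ge0// lee_fin f_le1.
  by move=> _ _.
have ray t : m1 `]t, +oo[%classic = m2 `]t, +oo[%classic.
  have [t0|t0] := leP 0 t.
    have := cvgm _ _ m1D t0; under eq_fun do rewrite int_f.
    by move=> /cvg_unique; apply => //; exact: cvgm.
  have h (m : {measure set (measurableTypeR R) -> \bar R}) : m `]-oo, 0[%classic = 0%E -> m `]t, +oo[%classic = m D.
    move=> m0; have -> : `]t, +oo[%classic = `]t, 0[%classic `|` D.
      by rewrite /D -itv_bndbnd_setU// bnd_simp ltW.
    rewrite setUC.
    rewrite measureU0//; last first.
      apply/eqP; rewrite eq_le measure_ge0 andbT -m0.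
      apply: le_measure; rewrite ?inE; [exact: measurable_itv|exact: measurable_itv|].
      by move=> x/=; rewrite !in_itv/= => /andP[].
  by rewrite !h// -!mDE m12.
move=> B mB.
apply: (@measure_unique _ R (measurableTypeR R) (@RGenOInfty.G R) (fun n : nat => `](- n%:R : R), +oo[%classic)) => //.
- exact: RGenOInfty.measurableE.
- move=> _ _ [x ->] [y ->]; exists (Num.max x y).
  by apply/seteqP; split => z/=; rewrite !in_itv/= !andbT gt_max => /andP.
- by move=> n; exists (- n%:R).
- apply/seteqP; split => // x _; exists (Num.truncn `|x|).+1 => //=.
  rewrite in_itv/= andbT ltrNl; apply: (le_lt_trans (ler_norm _)).
  by rewrite normrN; exact: truncnS_gt.
- by move=> _ [x ->].
- move=> n; apply: le_lt_trans m1fin; apply: le_measure; rewrite ?inE//.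
Qed.

End laplace_uniqueness.

(** * Expectations through densities; squares of Gaussian variables *)

Section density.
Context d (T : measurableType d) (R : realType).
Variables (mu m : {measure set T -> \bar R}) (p : T -> R).
Hypotheses (mp : measurable_fun setT p) (p0 : forall x, 0 <= p x).
Hypothesis mE : forall B, measurable B -> m B = (\int[mu]_(x in B) (p x)%:E)%E.

Import HBNNSimple.

Let integral_density_indic (E : set T) : measurable E ->
  (\int[m]_x (\1_E x)%:E = \int[mu]_x ((p x)%:E * (\1_E x)%:E))%E.
Proof.
move=> mEE; rewrite integral_indic// setIT mE// integral_mkcond.
apply: eq_integral => x _; rewrite patchE indicE.
by case: ifPn => xE; rewrite ?mule1 ?mule0.
Qed.

Let integral_density_nnsfun (f : {nnsfun T >-> R}) :
  (\int[m]_x (f x)%:E = \int[mu]_x ((p x)%:E * (f x)%:E))%E.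
Proof.
under [LHS]eq_integral do rewrite fimfunE -fsumEFin//.
rewrite [LHS]ge0_integral_fsum//; last 2 first.
  - by move=> r; exact/measurable_EFinP/measurableT_comp.
  - by move=> n x _; rewrite EFinM nnfun_muleindic_ge0.
under [RHS]eq_integral.
  move=> x xD; rewrite fimfunE -fsumEFin// ge0_mule_fsumr; last first.
    by move=> r; rewrite EFinM nnfun_muleindic_ge0.
  over.
rewrite [RHS]ge0_integral_fsum//; last 2 first.
  - move=> r; apply: emeasurable_funM; first exact/measurable_EFinP.
    by apply/measurable_EFinP/measurableT_comp.
  - move=> n x _; apply: mule_ge0; first by rewrite lee_fin.
    by rewrite EFinM nnfun_muleindic_ge0.
apply: eq_fsbigr => r _.
have [r0|r0] := ltP r 0.
  have frE : f @^-1` [set r] = set0 by rewrite preimage_nnfun0.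
  rewrite frE !integral0_eq//= => x _; by rewrite indic0 mulr0 ?mule0.
under eq_integral do rewrite EFinM.
rewrite ge0_integralZl_EFin//; last exact/measurable_EFinP.
rewrite integral_density_indic//.
under [RHS]eq_integral do rewrite EFinM muleCA.
rewrite ge0_integralZl_EFin//.
- by move=> x _; rewrite mule_ge0 ?lee_fin.
- by apply: emeasurable_funM; apply/measurable_EFinP.
Qed.

Lemma ge0_integral_density (f : T -> \bar R) :
  measurable_fun setT f -> (forall x, 0 <= f x)%E ->
  (\int[m]_x f x = \int[mu]_x ((p x)%:E * f x))%E.
Proof.
move=> mf f0; pose f_ := nnsfun_approx measurableT mf.
transitivity (lim (\int[m]_x (f_ n x)%:E @[n --> \oo])%E).
  rewrite -monotone_convergence//=.
  - apply: eq_integral => ? /[!inE] xD; apply/esym/cvg_lim => //=.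
    exact: cvg_nnsfun_approx.
  - by move=> n; exact/measurable_EFinP/measurable_funTS.
  - by move=> n ? _; rewrite lee_fin.
  - by move=> ? _ ? ? mn; rewrite lee_fin; exact/lefP/nd_nnsfun_approx.
rewrite [RHS](_ : _ = lim (\int[mu]_x ((p x)%:E * (f_ n x)%:E) @[n --> \oo])%E).
  by apply: congr_lim; apply/funext => n /=; exact: integral_density_nnsfun.
rewrite -monotone_convergence//=.
- apply: eq_integral => x _; apply/esym/cvg_lim => //; apply: cvgeZl => //.
  exact: cvg_nnsfun_approx.
- by move=> n; apply: emeasurable_funM; exact/measurable_EFinP.
- by move=> n x _; rewrite mule_ge0 ?lee_fin.
- by move=> x _ a b ab; rewrite lee_wpmul2l ?lee_fin//; exact/lefP/nd_nnsfun_approx.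
Qed.

End density.

Section random_variable_density.
Context d (T : measurableType d) (R : realType) (P : probability T R).
Notation mu := (@lebesgue_measure R).

Lemma expectation_density (X : {RV P >-> R}) (p : R -> R) (f : R -> R) :
  measurable_fun setT p -> (forall x, 0 <= p x) ->
  (forall B, measurable B -> P (X @^-1` B) = (\int[mu]_(x in B) (p x)%:E)%E) ->
  measurable_fun setT f -> (forall x, 0 <= f x) ->
  (\int[P]_t (f (X t))%:E = \int[mu]_x (p x * f x)%:E)%E.
Proof.
move=> mp p0 XP mf f0.
have mX : measurable_fun setT (X : T -> measurableTypeR R).
  by move=> _ B mB; exact: (measurable_funP X).
have mf' : measurable_fun setT (f : measurableTypeR R -> R).
  by move=> _ B mB; exact: mf.
pose X' : {mfun T >-> measurableTypeR R} :=
  HB.pack (X : T -> measurableTypeR R) (isMeasurableFun.Build _ _ _ _ _ mX).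
have <- := @ge0_integral_distribution _ _ _ _ _ P X' (EFin \o f).
- rewrite (@ge0_integral_density _ (measurableTypeR R) R mu (distribution P X') p)//.
  exact/measurable_EFinP.
- exact/measurable_EFinP.
- by move=> x; rewrite lee_fin.
Qed.

(** Completing the square: the integrand is a constant times the normal density of mean - s a / (1 +
    s) and variance 1 / (2 (1 + s)). The variance 1/2 is that of the real and imaginary parts of a
    unit complex Gaussian. *)
Lemma integral_expR_sqr (s a : R) : 0 <= s ->
  (\int[mu]_x (normal_pdf 0 (Num.sqrt 2^-1) x * expR (- (s * (x + a) ^+ 2)))%:E =
   ((Num.sqrt (1 + s))^-1 * expR (- (s / (1 + s) * a ^+ 2)))%:E)%E.
Proof.
move=> s0; pose v := 1 + s.
have v0 : 0 < v by rewrite ltr_wpDr.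
pose sg := Num.sqrt ((v *+ 2)^-1).
have v20 : 0 < (v *+ 2)^-1 by rewrite invr_gt0 pmulrn_lgt0.
have sg0 : sg != 0 by rewrite gt_eqF// sqrtr_gt0.
have h20 : Num.sqrt 2^-1 != 0 :> R by rewrite gt_eqF// sqrtr_gt0 invr_gt0.
transitivity (\int[mu]_x (((Num.sqrt v)^-1 * expR (- (s / v * a ^+ 2)))%:E *
   (normal_pdf (- (s * a / v)) sg x)%:E))%E.
  apply: eq_integral => x _; rewrite -EFinM; congr EFin.
  rewrite !normal_pdfE// /normal_peak /normal_fun !sqr_sqrtr ?ltW ?invr_gt0//.
  have -> : 2^-1 * pi *+ 2 = pi :> R by field.
  have -> : (v *+ 2)^-1 * pi *+ 2 = pi / v by field; rewrite gt_eqF.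
  have -> : Num.sqrt (pi / v) = Num.sqrt pi / Num.sqrt v.
    by rewrite sqrtrM ?pi_ge0// sqrtrV// ltW.
  rewrite -[LHS]mulrA -expRD [RHS]mulrACA -expRD.
  have -> : (Num.sqrt v)^-1 * (Num.sqrt pi / Num.sqrt v)^-1 = (Num.sqrt pi)^-1.
    by field; rewrite !gt_eqF ?sqrtr_gt0 ?pi_gt0.
  congr (_ * expR _); rewrite /v; field.
  by rewrite gt_eqF.
  by rewrite pmulrn_lgt0.
rewrite ge0_integralZl_EFin//.
- by rewrite integral_normal_pdf mule1.
- by move=> x _; rewrite lee_fin normal_pdf_ge0.
- by apply/measurable_EFinP; exact: measurable_normal_pdf.
Qed.

Lemma expectation_gaussian_sqr (X : {RV P >-> R}) (s a : R) :
  normal_distributed P X 0 2^-1 -> 0 <= s ->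
  (\int[P]_t (expR (- (s * (X t + a) ^+ 2)))%:E =
   ((Num.sqrt (1 + s))^-1 * expR (- (s / (1 + s) * a ^+ 2)))%:E)%E.
Proof.
move=> Xn s0; rewrite -integral_expR_sqr//.
apply: (@expectation_density X (normal_pdf 0 (Num.sqrt 2^-1))
  (fun x => expR (- (s * (x + a) ^+ 2)))) => //.
- exact: measurable_normal_pdf.
- exact: normal_pdf_ge0.
- apply: measurableT_comp => //; apply: measurableT_comp => //.
  apply: measurable_funM => //; apply: measurable_funX.
  exact: measurable_funD.
Qed.

End random_variable_density.

(** * Unordered sums over multi-indices *)

Section series.
Context {R : realType}.

Lemma nneseries_expR (x : R) : 0 <= x ->
  (\sum_(0 <= l <oo) (x ^+ l / l`!%:R)%:E = (expR x)%:E)%E.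
Proof.
move=> x0; rewrite /expR -EFin_lim; last exact: is_cvg_series_exp_coeff.
apply/congr_lim/funext => n /=; rewrite /series/= sumEFin.
by congr EFin; apply: eq_bigr.
Qed.

(** Enumerating by [pickle], with 0 at the integers that code nothing, reduces unordered sums to
    series and so gives them scaling and exchange with integrals. *)
Lemma esum_countE (I : countType) (a : I -> \bar R) : (forall i, 0 <= a i)%E ->
  (\esum_(i in [set: I]) a i = \sum_(0 <= n <oo) oapp a 0 (pickle_inv n))%E.
Proof.
move=> a0; pose b n := oapp a 0%E (@pickle_inv I n).
have b0 n : (0 <= b n)%E by rewrite /b; case: pickle_inv.
rewrite nneseries_esumT//.
transitivity (\esum_(n in range (@pickle I)) b n)%E.
  rewrite esum_image; last by move=> i j _ _; exact: (pcan_inj pickleK).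
  by apply: eq_esum => i _; rewrite /b pickleK_inv.
rewrite esum_mkcond; apply: eq_esum => n _; case: ifPn => //.
rewrite notin_setE /= => nr; rewrite /b; case E : (pickle_inv n) => [i|]//=.
exfalso; apply: nr; exists i => //.
by have := @pickle_invK I n; rewrite E.
Qed.

Lemma esumZl (I : countType) (a : I -> \bar R) (x : R) : (forall i, 0 <= a i)%E ->
  0 <= x -> (\esum_(i in [set: I]) (x%:E * a i) = x%:E * \esum_(i in [set: I]) a i)%E.
Proof.
move=> a0 x0; rewrite !esum_countE//; last by move=> i; rewrite mule_ge0.
rewrite -nneseriesZl//.
  by apply: eq_eseriesr => n _; case: pickle_inv => //=; rewrite mule0.
by move=> n _; case: pickle_inv.
Qed.

Lemma integral_esum d (T : measurableType d) (mu : {measure set T -> \bar R})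
    (I : countType) (f : I -> T -> \bar R) :
  (forall i, measurable_fun setT (f i)) -> (forall i t, 0 <= f i t)%E ->
  (\int[mu]_t (\esum_(i in [set: I]) f i t) =
   \esum_(i in [set: I]) (\int[mu]_t f i t))%E.
Proof.
move=> mf f0; under eq_integral do rewrite esum_countE//.
rewrite esum_countE; last by move=> i; exact: integral_ge0.
rewrite integral_nneseries//.
- apply: eq_eseriesr => n _; case: pickle_inv => //=.
  by rewrite integral0_eq.
- by move=> n; case: pickle_inv => //=.
- by move=> n t _; case: pickle_inv => //=.
Qed.

Lemma prod_nneseries (K : finType) (a : K -> nat -> R) (s : K -> R) :
  (forall k l, 0 <= a k l) -> (forall k, \sum_(0 <= l <oo) (a k l)%:E = (s k)%:E)%E ->
  (\esum_(ell in [set: {ffun K -> nat}]) (\prod_k a k (ell k))%:E = (\prod_k s k)%:E)%E.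
Proof.
move=> a0 aE.
(* Coordinates outside [r] are pinned at 0, so that [S (k :: r)] is in bijection with nat times
   [S r] and each step of the induction multiplies by one series. *)
pose S (r : seq K) : set {ffun K -> nat} := [set ell | forall k, k \notin r -> ell k = 0%N].
suff H r : uniq r -> (\esum_(ell in S r) (\prod_(k <- r) a k (ell k))%:E =
    (\prod_(k <- r) s k)%:E)%E.
  rewrite -H ?index_enum_uniq//; congr esum.
  by apply/seteqP; split => // ell _ k; rewrite mem_index_enum.
elim: r => [_|k r ih /= /andP[kr ur]].
  have -> : S [::] = [set [ffun=> 0%N]].
    apply/seteqP; split => [ell|_ ->] /=; last by move=> k _; rewrite ffunE.
    by move=> h; apply/ffunP => k; rewrite ffunE h.
  by rewrite esum_set1 ?lee_fin !big_nil.
have s0 j : 0 <= s j.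
  by rewrite -lee_fin -aE; apply: nneseries_ge0 => n _ _; rewrite lee_fin.
have p0 (r' : seq K) (ell : {ffun K -> nat}) : 0 <= \prod_(j <- r') a j (ell j).
  exact: prodr_ge0.
pose upd (p : nat * {ffun K -> nat}) : {ffun K -> nat} :=
  [ffun j => if j == k then p.1 else p.2 j].
have bij : set_bij ([set: nat] `*`` (fun=> S r)) (S (k :: r)) upd.
  split.
  - move=> [l ell] [_ /= h] j; rewrite inE negb_or => /andP[jk jr].
    by rewrite ffunE (negbTE jk) h.
  - move=> [l ell] [l' ell']; rewrite !inE /= => -[_ h] [_ h'] /ffunP e.
    have := e k; rewrite !ffunE eqxx /= => ->; congr pair.
    apply/ffunP => j; have [->|jk] := eqVneq j k; first by rewrite h// h'.
    by have := e j; rewrite !ffunE (negbTE jk).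
  - move=> ell h /=; exists (ell k, [ffun j => if j == k then 0%N else ell j]).
      split => //= j jr; rewrite ffunE; case: eqVneq => // jk.
      by apply: h; rewrite inE negb_or jk.
    by apply/ffunP => j; rewrite !ffunE /=; case: eqVneq => // ->.
rewrite (@reindex_esum _ _ _ _ _ upd _ bij).
transitivity (\esum_(p in [set: nat] `*`` (fun=> S r))
    ((a k p.1)%:E * (\prod_(j <- r) a j (p.2 j))%:E))%E.
  apply: eq_esum => -[l ell] _ /=; rewrite big_cons -EFinM ffunE eqxx.
  congr (_ * _)%:E; apply: eq_big_seq => j jr; rewrite ffunE.
  by have [jk|//] := eqVneq j k; rewrite -jk jr in kr.
rewrite -(esum_esum (a := fun l (ell : {ffun K -> nat}) => ((a k l)%:E * (\prod_(j <- r) a j (ell j))%:E)%E)); last first.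
  by move=> l ell _ _; rewrite -EFinM lee_fin mulr_ge0.
have h l : (\esum_(ell in S r) ((a k l)%:E * (\prod_(j <- r) a j (ell j))%:E) =
    (\prod_(j <- r) s j)%:E * (a k l)%:E)%E.
  rewrite -ih// esum_mkcond [in RHS]esum_mkcond muleC -esumZl//.
    by apply: eq_esum => ell _; case: ifP => // _; rewrite mule0.
  by move=> ell; case: ifP => // _; rewrite lee_fin.
rewrite (eq_esum (b := fun l => ((\prod_(j <- r) s j)%:E * (a k l)%:E)%E)); last by move=> l _.
rewrite esumZl//; [|by move=> l; rewrite lee_fin|exact: prodr_ge0].
have -> : (\esum_(l in [set: nat]) (a k l)%:E = (s k)%:E)%E.
  by rewrite -aE nneseries_esumT// => l; rewrite lee_fin.
by rewrite -EFinM big_cons mulrC.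
Qed.

End series.

Section gamma_prob.
Context {R : realType}.
Notation mu := (@lebesgue_measure R).
Variables (n : nat) (b : {posnum R}).

Definition gamma_prob (V : set (measurableTypeR R)) : \bar R :=
  (\int[mu]_(x in V) (gamma_pdf n.+1%:R b%:num x)%:E)%E.

Let mgamma : measurable_fun [set: measurableTypeR R] (EFin \o gamma_pdf n.+1%:R b%:num).
Proof. by apply/measurable_EFinP; exact: measurable_gamma_pdf. Qed.

Let gamma_prob0 : gamma_prob set0 = 0%E.
Proof. by rewrite /gamma_prob integral_set0. Qed.

Let gamma_prob_ge0 V : (0 <= gamma_prob V)%E.
Proof. by apply: integral_ge0 => x _; rewrite lee_fin gamma_pdf_ge0. Qed.

Let gamma_prob_sigma_additive : semi_sigma_additive gamma_prob.
Proof.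
move=> /= F mF tF mUF; rewrite /gamma_prob ge0_integral_bigcup//.
- apply: is_cvg_ereal_nneg_natsum_cond => k _ _.
  by apply: integral_ge0 => x _; rewrite lee_fin gamma_pdf_ge0.
- exact: measurable_funTS.
- by move=> x _; rewrite lee_fin gamma_pdf_ge0.
Qed.

HB.instance Definition _ := isMeasure.Build _ _ _ gamma_prob
  gamma_prob0 gamma_prob_ge0 gamma_prob_sigma_additive.

Lemma integral_gamma_prob (f : measurableTypeR R -> R) :
  measurable_fun setT f -> (forall x, 0 <= f x) ->
  (\int[gamma_prob]_x (f x)%:E = \int[mu]_x (gamma_pdf n.+1%:R b%:num x * f x)%:E)%E.
Proof.
move=> mf f0.
rewrite (@ge0_integral_density _ (measurableTypeR R) R mu gamma_prob
  (gamma_pdf n.+1%:R b%:num))//.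
- exact: measurable_gamma_pdf.
- by move=> x; rewrite gamma_pdf_ge0.
- exact/measurable_EFinP.
Qed.

Lemma gamma_prob_lt0 : gamma_prob `]-oo, 0[%classic = 0%E.
Proof.
apply: integral0_eq => x; rewrite /= in_itv/= => x0.
by rewrite /gamma_pdf ltNge ltW.
Qed.

End gamma_prob.

(** * Noncentral chi-square laws as Poisson mixtures *)

Section noncentral.
Context d (T : measurableType d) (R : realType) (P : probability T R).
Variables (I : finType) (X : I -> {RV P >-> R}).
Hypothesis indX : mutually_independent P (fun i => (X i : T -> R)).
Hypothesis Xlaw : forall i, normal_distributed P (X i) 0 2^-1.
Variables (J : finType) (e : J -> I) (m : nat).
Hypotheses (e_inj : injective e) (Jm : #|J| = m.+1.*2).

Let mX i : measurable_fun setT (X i : T -> R).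
Proof. exact: measurable_funP. Qed.

(** Each Gaussian contributes the factor (1 + c s)^(-1/2). Their even number 2 (m + 1) makes this an
    integer power, the Laplace transform of a Gamma law of shape m + 1. *)
Lemma expectation_noncentral_expR (c s : R) (a : J -> R) : 0 < c -> 0 <= s ->
  (\int[P]_t (expR (- (s * (c * \sum_j (X (e j) t + a j) ^+ 2))))%:E =
   ((1 + c * s) ^- m.+1 * expR (- ((c * s) / (1 + c * s) * \sum_j a j ^+ 2)))%:E)%E.
Proof.
move=> c0 s0; have cs0 : 0 <= c * s by rewrite mulr_ge0// ltW.
transitivity (\int[P]_t (\prod_j expR (- (c * s * (X (e j) t + a j) ^+ 2)))%:E)%E.
  apply: eq_integral => t _; congr EFin.
  rewrite -expR_sum; congr expR; rewrite sumrN mulrA [s * c]mulrC.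
  by rewrite mulr_sumr.
rewrite (expectation_indep_prod mX indX (J := fun j => pred1 (e j))).
- under eq_bigr do rewrite expectation_gaussian_sqr//.
  rewrite prodEFin; congr EFin; rewrite big_split/=; congr (_ * _).
    rewrite prodr_const -exprVn; transitivity ((Num.sqrt (1 + c * s))^-1 ^+ m.+1.*2).
      by rewrite -Jm; congr (_ ^+ _).
    by rewrite -mul2n exprM exprVn sqr_sqrtr// addr_ge0.
  by rewrite -expR_sum sumrN mulr_sumr.
- by move=> j j' i /eqP -> /eqP /e_inj.
- move=> j; apply: measurableT_comp => //; apply: measurableT_comp => //.
  apply: measurable_funM => //; apply: measurable_funX; apply: measurable_funD => //.
  by apply: measurable_cylinder_fun => /=; rewrite eqxx.
- by move=> j t; exact: expR_ge0.
Qed.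

Definition poisson_weight (z : R) (l : nat) : R := expR (- z) * (z ^+ l / l`!%:R).

Lemma poisson_weight_ge0 (z : R) l : 0 <= z -> 0 <= poisson_weight z l.
Proof. by move=> z0; rewrite mulr_ge0 ?expR_ge0// divr_ge0// exprn_ge0. Qed.

(** Both sides integrate [f] against a measure on the half-line, the law of the quadratic form and
    the Poisson mixture [nu] of Gamma laws. The two have the same Laplace transform, so they
    coincide. *)
Lemma integral_noncentral (c : {posnum R}) (a : J -> R) (f : R -> R) :
  measurable_fun setT f -> (forall x, 0 <= f x) ->
  (\int[P]_t (f (c%:num * \sum_j (X (e j) t + a j) ^+ 2))%:E =
   \sum_(0 <= l <oo) ((poisson_weight (\sum_j a j ^+ 2) l)%:E *
      \int[gamma_prob (m + l) c]_x (f x)%:E))%E.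
Proof.
move=> mf f0; pose z := \sum_j a j ^+ 2.
have z0 : 0 <= z by apply: sumr_ge0 => j _; exact: sqr_ge0.
pose Q (t : T) : measurableTypeR R := c%:num * \sum_j (X (e j) t + a j) ^+ 2.
have mQ : measurable_fun setT Q.
  suff : measurable_fun setT (Q : T -> R) by [].
  apply: measurable_funM => //; apply: measurable_sum => j.
  by apply: measurable_funX; exact: measurable_funD.
have Q0 t : 0 <= Q t.
  by rewrite /Q mulr_ge0//; apply: sumr_ge0 => j _; exact: sqr_ge0.
pose Q' : {mfun T >-> measurableTypeR R} := HB.pack Q (isMeasurableFun.Build _ _ _ _ _ mQ).
pose nu : {measure set (measurableTypeR R) -> \bar R} :=
  mseries (fun l => mscale (NngNum (poisson_weight_ge0 l z0)) (gamma_prob (m + l) c)) 0.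
have nuE (h : measurableTypeR R -> R) : measurable_fun setT h -> (forall x, 0 <= h x) ->
    (\int[nu]_x (h x)%:E = \sum_(0 <= l <oo) ((poisson_weight z l)%:E *
      \int[gamma_prob (m + l) c]_x (h x)%:E))%E.
  move=> mh h0; rewrite ge0_integral_measure_series//.
  - apply: eq_eseriesr => l _; rewrite ge0_integral_mscale//.
      exact/measurable_EFinP.
    by move=> x _; rewrite lee_fin.
  - by move=> x _; rewrite lee_fin.
  - exact/measurable_EFinP.
have mexp (s : R) : measurable_fun setT ((fun x => expR (- (s * x))) : measurableTypeR R -> R).
  exact: (continuous_measurable_fun (@continuous_expRNM R s)).
have distE (h : measurableTypeR R -> R) : measurable_fun setT h -> (forall x, 0 <= h x) ->
    (\int[distribution P Q']_x (h x)%:E = \int[P]_t (h (Q t))%:E)%E.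
  move=> mh h0; rewrite ge0_integral_distribution//; exact/measurable_EFinP.
have dist_lt0 : distribution P Q' `]-oo, 0[%classic = 0%E.
  rewrite /distribution /pushforward (_ : _ @^-1` _ = set0) ?measure0//.
  by apply/seteqP; split => // t /=; rewrite in_itv/= ltNge Q0.
have nu_lt0 : nu `]-oo, 0[%classic = 0%E.
  rewrite /nu /= /mseries eseries0// => l _ _ /=.
  by rewrite /mscale/= gamma_prob_lt0 mule0.
have law (B : set (measurableTypeR R)) : measurable B -> distribution P Q' B = nu B.
  apply: laplace_unique => //.
  - by rewrite [ltLHS](_ : _ = 1%E) ?ltry//; exact: (probability_setT P).
  - move=> j; rewrite !integral_restrict_ge0// distE//.
    rewrite nuE//.
    rewrite /Q expectation_noncentral_expR//.
    pose v : R := c%:num * j%:R.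
    have v0 : 0 <= v by rewrite mulr_ge0.
    have v1 : 0 < 1 + v by rewrite ltr_wpDr.
    (* The Gamma law of shape m + 1 + l contributes (1 + v)^-(m + 1 + l). Summing the exponential
       series in z / (1 + v) leaves exp (- z + z / (1 + v)), which equals exp (- z v / (1 + v)). *)
    transitivity (\sum_(0 <= l <oo) ((1 + v) ^- m.+1 * expR (- z))%:E *
        ((z / (1 + v)) ^+ l / l`!%:R)%:E)%E; last first.
      apply: eq_eseriesr => l _; rewrite integral_gamma_prob//.
      rewrite integral_gamma_pdf_expR// -!EFinM; congr EFin.
      rewrite /poisson_weight -/v -addSn exprD exprMn exprVn invfM.
      by ring.
    rewrite nneseriesZl; last by move=> l _; rewrite lee_fin divr_ge0// exprn_ge0// divr_ge0// ltW.
    rewrite nneseries_expR; last by rewrite divr_ge0// ltW.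
    rewrite -EFinM; congr EFin; rewrite -[RHS]mulrA -expRD; congr (_ * expR _).
    by rewrite -/v -/z; field; rewrite gt_eqF.
have mf' : measurable_fun [set: measurableTypeR R] (f : measurableTypeR R -> R) by exact: mf.
rewrite -nuE// -distE//.
by apply: eq_measure_integral => A mA _; exact: law.
Qed.

End noncentral.

(** * Averaging over the common Gaussian vector *)

Section mixture.
Context d (T : measurableType d) (R : realType) (P : probability T R).
Variables (K m : nat).
Local Notation J := ('I_m.+1 * bool)%type.
Variable X : 'I_K.+1 * 'I_m.+1 * bool -> {RV P >-> R}.
Hypothesis indX : mutually_independent P (fun i => (X i : T -> R)).
Hypothesis Xlaw : forall i, normal_distributed P (X i) 0 2^-1.
Variables (r : 'I_K -> R) (c : 'I_K -> {posnum R}).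

(** The common vector is read at [t] and the individual one at [u]: the two-point form to which
    decoupling applies, the diagonal being the quantity of interest. *)
Definition quad_form (k : 'I_K) (t u : T) : R :=
  \sum_(j : J) (X (lift ord0 k, j.1, j.2) u + r k * X (ord0, j.1, j.2) t) ^+ 2.

(** The weight W_l with m + 1 in place of m and [r k ^+ 2] for lambda_k^2 / (1 - lambda_k^2); the
    Gamma functions at integers are written as factorials. *)
Definition mix_weight (ell : {ffun 'I_K -> nat}) : R :=
  (m + \sum_(k < K) ell k)`!%:R / m`!%:R * (1 + \sum_(k < K) r k ^+ 2) ^- m.+1 *
  \prod_(k < K) ((r k ^+ 2 / (1 + \sum_(k < K) r k ^+ 2)) ^+ ell k / (ell k)`!%:R).

Let S : R := \sum_(k < K) r k ^+ 2.

Let S1 : 0 < 1 + S.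
Proof. by rewrite ltr_wpDr// sumr_ge0// => k _; exact: sqr_ge0. Qed.

Lemma mix_weight_ge0 ell : 0 <= mix_weight ell.
Proof.
rewrite /mix_weight mulr_ge0//.
  by rewrite mulr_ge0 ?divr_ge0// invr_ge0 exprn_ge0// ltW.
apply: prodr_ge0 => k _; rewrite divr_ge0// exprn_ge0// divr_ge0 ?sqr_ge0//.
exact: ltW.
Qed.

Let cardJ : #|{: J}| = m.+1.*2.
Proof. by rewrite card_prod card_ord card_bool muln2. Qed.

Let Z (t : T) : R := \sum_(j : J) X (ord0, j.1, j.2) t ^+ 2.

Let Z0 t : 0 <= Z t.
Proof. by apply: sumr_ge0 => j _; exact: sqr_ge0. Qed.

(** The absolute value makes the product nonnegative on the whole line, as integration against the
    law of [Z] demands; at [Z t] it changes nothing. *)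
Let prod_poisson (ell : {ffun 'I_K -> nat}) (z : R) : R :=
  \prod_(k < K) poisson_weight (r k ^+ 2 * `|z|) (ell k).

Let measurable_poisson_weight (l : nat) d' (U : measurableType d') (g : U -> R) :
  measurable_fun setT g -> measurable_fun setT (fun u => poisson_weight (g u) l).
Proof.
move=> mg; apply: measurable_funM.
  by apply: measurableT_comp => //; exact: measurableT_comp.
by apply: measurable_funM => //; exact: measurable_funX.
Qed.

Let prod_poisson_ge0 ell z : 0 <= prod_poisson ell z.
Proof.
by apply: prodr_ge0 => k _; rewrite poisson_weight_ge0// mulr_ge0// sqr_ge0.
Qed.

Let measurable_prod_poisson ell : measurable_fun setT (prod_poisson ell).
Proof.
apply: measurable_prod => k _; apply: measurable_poisson_weight.
by apply: measurable_funM => //; exact: measurableT_comp.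
Qed.

(** The law of [Z] is the noncentral case with zero shift: the Poisson weight sits at l = 0 and
    leaves the Gamma law of shape m + 1 and scale 1. What remains is the integral of x^(m + sum of
    l_k) exp (- (1 + S) x), whose factorial and power of 1 + S are those of the weight. *)
Let integral_prod_poisson ell :
  (\int[P]_t (prod_poisson ell (Z t))%:E = (mix_weight ell)%:E)%E.
Proof.
have e_inj : injective (fun j : J => (ord0 : 'I_K.+1, j.1, j.2)).
  by move=> [j b] [j' b'] /= [-> ->].
transitivity (\int[P]_t (prod_poisson ell ((PosNum (@ltr01 R))%:num *
    \sum_(j : J) (X (ord0, j.1, j.2) t + (fun=> 0) j) ^+ 2))%:E)%E.
  apply: eq_integral => t _; rewrite mul1r; congr (prod_poisson _ _)%:E.
  by apply: eq_bigr => j _; rewrite addr0.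
rewrite (integral_noncentral indX Xlaw e_inj cardJ)//.
rewrite big1; last by move=> j _; rewrite expr0n.
rewrite nneseries_recl//; last first.
  move=> l _; rewrite mule_ge0 ?lee_fin ?poisson_weight_ge0//.
  by apply: integral_ge0 => x _; rewrite lee_fin.
rewrite eseries0; last first.
  by move=> l l1 _; rewrite /poisson_weight expr0n gtn_eqF// mul0r mulr0 mul0e.
rewrite adde0 /poisson_weight oppr0 expR0 expr0 mul1r fact0 divr1 mul1e addn0.
rewrite integral_gamma_prob//; last exact: measurable_prod_poisson.
rewrite (@integral_gamma_pdfM R m 1 (prod_poisson ell) (@ltr01 R))//=.
pose C : R := (m`!%:R)^-1 * \prod_(k < K) ((r k ^+ 2) ^+ ell k / (ell k)`!%:R).
have C0 : 0 <= C.
  rewrite /C mulr_ge0 ?invr_ge0// prodr_ge0// => k _.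
  by rewrite divr_ge0// exprn_ge0// sqr_ge0.
transitivity (\int[lebesgue_measure]_(x in `]0%R, +oo[)
   (C%:E * (x ^+ (m + \sum_(k < K) ell k) * expR (- ((1 + S) * x)))%:E))%E.
  apply: eq_integral => x; rewrite inE/= in_itv/= andbT => x0.
  rewrite -EFinM; congr EFin.
  rewrite /prod_poisson (eq_bigr (fun k => expR (- (r k ^+ 2 * x)) *
     (((r k ^+ 2) ^+ ell k / (ell k)`!%:R) * x ^+ ell k))); last first.
    move=> k _; rewrite /poisson_weight gtr0_norm// exprMn; congr (_ * _).
    by rewrite mulrAC.
  rewrite !big_split/= -expR_sum sumrN -mulr_suml -/S -expr_sum.
  rewrite mulrDl mul1r opprD expRD exprD expr1n mulr1 invr1 mul1r /C -big_split/=.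
  by ring.
rewrite ge0_integralZl_EFin//; last 2 first.
- move=> x; rewrite /= in_itv/= andbT => x0.
  by rewrite lee_fin mulr_ge0 ?expR_ge0// exprn_ge0// ltW.
- apply/measurable_EFinP; apply: measurable_continuous_pos => x _.
  exact: continuous_expn_expR.
rewrite integral_expn_expR// -EFinM; congr EFin; rewrite /mix_weight -/S /C.
rewrite [in RHS](eq_bigr (fun k => ((r k ^+ 2) ^+ ell k / (ell k)`!%:R) *
   (1 + S) ^- ell k)); last by move=> k _; rewrite expr_div_n mulrAC.
rewrite [X in _ = _ * X](_ : _ = (\prod_(k < K) ((r k ^+ 2) ^+ ell k / (ell k)`!%:R)) *
    (1 + S) ^- (\sum_(k < K) ell k)); last by rewrite big_split/= prodfV expr_sum.
rewrite -addSn exprD invfM.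
by ring.
Qed.

Variable h : 'I_K -> R -> R.
Hypotheses (mh : forall k, measurable_fun setT (h k)).
Hypotheses (h0 : forall k x, 0 <= h k x) (h1 : forall k x, h k x <= 1).

Let Jz : pred ('I_K.+1 * 'I_m.+1 * bool) := fun i => i.1.1 == ord0.

Let mX i : measurable_fun setT (X i : T -> R).
Proof. exact: measurable_funP. Qed.

Let gamma_mean k l : R := fine (\int[gamma_prob (m + l) (c k)]_x (h k x)%:E)%E.

Let gamma_meanE k l :
  (\int[gamma_prob (m + l) (c k)]_x (h k x)%:E = (gamma_mean k l)%:E)%E.
Proof.
rewrite fineK// ge0_fin_numE; last by apply: integral_ge0 => x _; rewrite lee_fin.
apply: (@le_lt_trans _ _ (\int[gamma_prob (m + l) (c k)]_x (cst 1 x))%E).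
  apply: ge0_le_integral => //=.
  - by move=> x _; rewrite lee_fin.
  - by apply/measurable_EFinP; exact: mh.
  - by move=> x _; rewrite lee_fin.
have -> : (\int[gamma_prob (m + l) (c k)]_x (cst 1 x) =
    \int[gamma_prob (m + l) (c k)]_x (expR (- (0 * x)))%:E)%E.
  by apply: eq_integral => x _; rewrite mul0r oppr0 expR0.
rewrite integral_gamma_prob//=; last first.
  exact: (continuous_measurable_fun (@continuous_expRNM R 0)).
by rewrite integral_gamma_pdf_expR// ltry.
Qed.

Let gamma_mean_ge0 k l : 0 <= gamma_mean k l.
Proof.
by rewrite fine_ge0//; apply: integral_ge0 => x _; rewrite lee_fin.
Qed.

(** Boundedness of [h] keeps the conditional expectations finite, so their product over k is a
    product of real series and expands over multi-indices. All terms are nonnegative, hence the sum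
    commutes with the average over the common vector. *)
Lemma expectation_mixture :
  (\int[P]_t (\prod_(k < K) h k ((c k)%:num * quad_form k t t))%:E =
   \esum_(ell in [set: {ffun 'I_K -> nat}]) ((mix_weight ell)%:E *
     (\prod_(k < K) gamma_mean k (ell k))%:E))%E.
Proof.
rewrite (decouple_family mX indX (J := Jz)
  (F := fun z => (\prod_(k < K) h k ((c k)%:num * quad_form k z.1 z.2))%:E)).
- under eq_integral => t _.
    rewrite /= (expectation_indep_prod mX indX (J := fun k i => i.1.1 == lift ord0 k)); last 3 first.
    + by move=> k k' i /eqP -> /eqP /lift_inj.
    + move=> k; apply: measurableT_comp => //; apply: measurable_funM => //.
      apply: measurable_sum => j; apply: measurable_funX; apply: measurable_funD => //.
      by apply: measurable_cylinder_fun => /=; rewrite eqxx.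
    + by [].
    over.
  have inner t k : (\int[P]_u (h k ((c k)%:num * quad_form k t u))%:E =
      \sum_(0 <= l <oo) (poisson_weight (r k ^+ 2 * `|Z t|) l * gamma_mean k l)%:E)%E.
    have e_inj : injective (fun j : J => (lift ord0 k : 'I_K.+1, j.1, j.2)).
      by move=> [j b] [j' b'] /= [-> ->].
    rewrite (integral_noncentral indX Xlaw e_inj cardJ _ (fun j => r k * X (ord0, j.1, j.2) t))//.
    apply: eq_eseriesr => l _; rewrite gamma_meanE -EFinM; congr (poisson_weight _ _ * _)%:E.
    rewrite ger0_norm// /Z mulr_sumr; apply: eq_bigr => j _.
    by rewrite exprMn.
  have inner_fin t k : (\int[P]_u (h k ((c k)%:num * quad_form k t u))%:E =
      (fine (\int[P]_u (h k ((c k)%:num * quad_form k t u))%:E))%:E)%E.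
    rewrite fineK// ge0_fin_numE; last by apply: integral_ge0 => x _; rewrite lee_fin.
    apply: (@le_lt_trans _ _ (\int[P]_x (cst 1 x))%E).
      apply: ge0_le_integral => //=.
      - by move=> x _; rewrite lee_fin.
      - apply/measurable_EFinP; apply: measurableT_comp => //; apply: measurable_funM => //.
        by apply: measurable_sum => j; apply: measurable_funX; apply: measurable_funD.
      - by move=> x _; rewrite lee_fin.
    rewrite integral_cst// mul1e [ltLHS](_ : _ = 1%E) ?ltry//.
    exact: probability_setT.
  under eq_integral => t _.
    under eq_bigr do rewrite inner_fin.
    rewrite prodEFin -(@prod_nneseries _ _ (fun k l => poisson_weight (r k ^+ 2 * `|Z t|) l * gamma_mean k l)); last 2 first.
    + by move=> k l; rewrite mulr_ge0// poisson_weight_ge0// mulr_ge0// sqr_ge0.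
    + by move=> k; rewrite -inner inner_fin.
    over.
  rewrite /= integral_esum; last 2 first.
  + move=> ell; apply/measurable_EFinP; apply: measurable_prod => k _.
    apply: measurable_funM => //; apply: measurable_poisson_weight.
    apply: measurable_funM => //; apply: measurableT_comp => //.
    by apply: measurable_sum => j; exact: measurable_funX.
  + move=> ell t; rewrite lee_fin prodr_ge0// => k _.
    by rewrite mulr_ge0// poisson_weight_ge0// mulr_ge0// sqr_ge0.
  apply: eq_esum => ell _.
  rewrite -integral_prod_poisson muleC -ge0_integralZl_EFin//.
  + by apply: eq_integral => t _; rewrite -EFinM big_split/= mulrC.
  + by move=> t _; rewrite lee_fin.
  + apply/measurable_EFinP; apply: measurableT_comp => //.
    by apply: measurable_sum => j; exact: measurable_funX.
  + exact: prodr_ge0.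
- apply/measurable_EFinP; apply: measurable_prod => k _.
  apply: measurableT_comp => //; apply: measurable_funM => //.
  apply: measurable_sum => j; apply: measurable_funX; apply: measurable_funD.
    apply: (measurableT_comp _ measurable_snd).
    by apply: measurable_cylinder_fun; rewrite /Jz /=.
  apply: measurable_funM => //; apply: (measurableT_comp _ measurable_fst).
  by apply: measurable_cylinder_fun; rewrite /Jz /=.
- by move=> z; rewrite lee_fin prodr_ge0.
Qed.

End mixture.

(** * Identification of the law of the product with the mixture *)

Lemma eq_measure_off_null d (T : measurableType d) (R : realType)
    (mu : {measure set T -> \bar R}) (A B N : set T) :
  measurable A -> measurable B -> measurable N -> mu N = 0%E ->
  A `\` N = B `\` N -> mu A = mu B.
Proof.
move=> mA mB mN N0 AB.
have E C : measurable C -> mu C = mu (C `\` N).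
  move=> mC; rewrite (measureDI mu mC mN) [X in (_ + X)%E](_ : _ = 0%E) ?adde0//.
  apply/eqP; rewrite eq_le measure_ge0 andbT -N0.
  by apply: le_measure; rewrite ?inE//; exact: measurableI.
by rewrite (E A)// (E B)// AB.
Qed.

Section gamma_variables.
Context d (T : measurableType d) (R : realType) (P : probability T R).
Variables (K : nat) (c : 'I_K -> {posnum R}) (n : 'I_K -> nat).
Variable Y : 'I_K -> {RV P >-> R}.
Hypothesis indY : mutually_independent P (fun k => (Y k : T -> R)).
Hypothesis Ylaw : forall k, gamma_distributed P (Y k) (n k).+1%:R (c k)%:num.

Let mY k : measurable_fun setT (Y k : T -> R).
Proof. exact: measurable_funP. Qed.

Lemma gamma_lt0_null : P (\bigcup_(k in [set: 'I_K]) (Y k @^-1` `]-oo, 0[)) = 0%E.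
Proof.
have Y0 k : P (Y k @^-1` `]-oo, 0[) = 0%E.
  by rewrite Ylaw//; exact: (gamma_prob_lt0 (n k) (c k)).
rewrite (_ : [set: 'I_K] = [set` index_enum 'I_K]); last first.
  by apply/seteqP; split => // k _ /=; rewrite mem_index_enum.
rewrite bigcup_seq; elim: (index_enum _) => [|k s ih]; first by rewrite big_nil measure0.
rewrite big_cons measureU0//.
- exact: Y0.
- by rewrite -[_ @^-1` _]setTI; exact: mY.
- apply: bigsetU_measurable => j _.
  by rewrite -[_ @^-1` _]setTI; exact: mY.
Qed.

(** A Gamma variable is nonnegative only almost surely. With absolute values every factor is at
    least 1 at every sample point, so logarithms and negative powers of the product are controlled
    everywhere. *)
Lemma gamma_prod_cdf_abs (x : R) :
  P [set t | \prod_(k < K) (1 + Y k t) <= x] = P [set t | \prod_(k < K) (1 + `|Y k t|) <= x].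
Proof.
have mle (f : T -> R) : measurable_fun setT f -> measurable [set t | f t <= x].
  move=> mf; rewrite -[X in measurable X]setTI; apply: measurable_fun_le => //.
apply: (@eq_measure_off_null _ _ _ P _ _ (\bigcup_(k in [set: 'I_K]) (Y k @^-1` `]-oo, 0[))) => //.
- by apply: mle; apply: measurable_prod => k _; exact: measurable_funD.
- apply: mle; apply: measurable_prod => k _; apply: measurable_funD => //.
  exact: measurableT_comp.
- apply: fin_bigcup_measurable; first exact: finite_finset.
  by move=> k _; rewrite -[_ @^-1` _]setTI; exact: measurable_funP.
- exact: gamma_lt0_null.
- have E t : ~ (\bigcup_(k in [set: 'I_K]) (Y k @^-1` `]-oo, 0[)) t ->
      \prod_(k < K) (1 + `|Y k t|) = \prod_(k < K) (1 + Y k t).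
    move=> nt; apply: eq_bigr => k _; rewrite ger0_norm// leNgt; apply/negP => Yk.
    by apply: nt; exists k => //=; rewrite in_itv.
  by apply/seteqP; split => t [] /= + nt; rewrite E.
Qed.

Lemma expectation_gamma (k : 'I_K) (h : R -> R) :
  measurable_fun setT h -> (forall x, 0 <= h x) ->
  (\int[P]_t (h (Y k t))%:E = \int[gamma_prob (n k) (c k)]_x (h x)%:E)%E.
Proof.
move=> mh h0; rewrite integral_gamma_prob//.
apply: expectation_density => //; last exact: Ylaw.
- exact: measurable_gamma_pdf.
- by move=> x; rewrite gamma_pdf_ge0.
Qed.

Lemma expectation_gamma_prod (h : 'I_K -> R -> R) :
  (forall k, measurable_fun setT (h k)) -> (forall k x, 0 <= h k x) ->
  (\int[P]_t (\prod_(k < K) h k (Y k t))%:E =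
   \prod_(k < K) \int[gamma_prob (n k) (c k)]_x (h k x)%:E)%E.
Proof.
move=> mh h0; rewrite (expectation_indep_prod mY indY (J := fun k => pred1 k))//.
- by apply: eq_bigr => k _; exact: expectation_gamma.
- by move=> k k' i /eqP -> /eqP.
- move=> k; apply: measurableT_comp => //.
  by apply: measurable_cylinder_fun => /=.
Qed.

End gamma_variables.

Section mixture_cdf.
Context d (T : measurableType d) (R : realType) (P : probability T R).
Context d' (T' : measurableType d') (P' : probability T' R).
Variables (K m : nat).
Variable X : 'I_K.+1 * 'I_m.+1 * bool -> {RV P >-> R}.
Hypothesis indX : mutually_independent P (fun i => (X i : T -> R)).
Hypothesis Xlaw : forall i, normal_distributed P (X i) 0 2^-1.
Variables (r : 'I_K -> R) (c : 'I_K -> {posnum R}).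
Variable Y : {ffun 'I_K -> nat} -> 'I_K -> {RV P' >-> R}.
Hypothesis indY : forall ell, mutually_independent P' (fun k => (Y ell k : T' -> R)).
Hypothesis Ylaw : forall ell k,
  gamma_distributed P' (Y ell k) (m + ell k).+1%:R (c k)%:num.

Let Q (k : 'I_K) (t : T) : R := (c k)%:num * quad_form X r k t t.

Let Q0 k t : 0 <= Q k t.
Proof. by rewrite mulr_ge0// sumr_ge0// => j _; exact: sqr_ge0. Qed.

Let mQ k : measurable_fun setT (Q k).
Proof.
apply: measurable_funM => //; apply: measurable_sum => j.
by apply: measurable_funX; apply: measurable_funD => //; exact: measurable_funM.
Qed.

Let prod_ge1 (y : 'I_K -> R) : (forall k, 0 <= y k) -> 1 <= \prod_(k < K) (1 + y k).
Proof.
move=> y0; elim/big_ind : _ => // [a b a1 b1|k _]; last by rewrite lerDl.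
by rewrite mulr_ege1.
Qed.

Let L (t : T) : measurableTypeR R := ln (\prod_(k < K) (1 + Q k t)).

Let L' ell (t : T') : measurableTypeR R := ln (\prod_(k < K) (1 + `|Y ell k t|)).

Let mL : measurable_fun setT L.
Proof.
suff : measurable_fun setT (L : T -> R) by [].
apply: measurableT_comp; first exact: measurable_ln.
by apply: measurable_prod => k _; exact: measurable_funD.
Qed.

Let mL' ell : measurable_fun setT (L' ell).
Proof.
suff : measurable_fun setT (L' ell : T' -> R) by [].
apply: measurableT_comp; first exact: measurable_ln.
apply: measurable_prod => k _; apply: measurable_funD => //.
exact: measurableT_comp.
Qed.

Let Lm : {mfun T >-> measurableTypeR R} := HB.pack L (isMeasurableFun.Build _ _ _ _ _ mL).

Let Lm' ell : {mfun T' >-> measurableTypeR R} :=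
  HB.pack (L' ell) (isMeasurableFun.Build _ _ _ _ _ (mL' ell)).

(** The mixture as a series of measures over nat: multi-indices are enumerated by [pickle], with the
    zero measure at integers that code none. *)
Let nu_ (j : nat) : {measure set (measurableTypeR R) -> \bar R} :=
  if pickle_inv j is Some ell then
    mscale (NngNum (mix_weight_ge0 m r ell)) (distribution P' (Lm' ell)) else mzero.

Let nu : {measure set (measurableTypeR R) -> \bar R} := mseries nu_ 0.

Let nuE (B : set (measurableTypeR R)) :
  nu B = (\esum_(ell in [set: {ffun 'I_K -> nat}])
    ((mix_weight m r ell)%:E * P' (L' ell @^-1` B)))%E.
Proof.
rewrite esum_countE; last by move=> ell; rewrite mule_ge0 ?lee_fin ?mix_weight_ge0.
rewrite /nu/= /mseries; apply: eq_eseriesr => j _; rewrite /nu_.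
by case: pickle_inv.
Qed.

Let integral_nu (f : measurableTypeR R -> R) : measurable_fun setT f ->
  (forall x, 0 <= f x) ->
  (\int[nu]_x (f x)%:E = \esum_(ell in [set: {ffun 'I_K -> nat}])
    ((mix_weight m r ell)%:E * \int[P']_t (f (L' ell t))%:E))%E.
Proof.
move=> mf f0; rewrite esum_countE; last first.
  move=> ell; rewrite mule_ge0 ?lee_fin ?mix_weight_ge0//.
  by apply: integral_ge0 => t _; rewrite lee_fin.
rewrite ge0_integral_measure_series//; last 2 first.
- by move=> t _; rewrite lee_fin.
- exact/measurable_EFinP.
apply: eq_eseriesr => j _; rewrite /nu_; case: pickle_inv => [ell|] /=.
  rewrite ge0_integral_mscale//; last 2 first.
  - exact/measurable_EFinP.
  - by move=> t _; rewrite lee_fin.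
  congr (_ * _)%E; rewrite ge0_integral_distribution//; exact/measurable_EFinP.
exact: integral_measure_zero.
Qed.

Let h (j : nat) (x : R) : R := (1 + `|x|) ^- j.

Let mh j : measurable_fun setT (h j).
Proof.
have -> : h j = (fun x => (1 + `|x|)^-1 ^+ j) by apply/funext => x; rewrite /h exprVn.
apply: measurable_funX; apply: continuous_measurable_fun => x.
apply: cvgV; first by rewrite gt_eqF// ltr_pwDl.
by apply: cvgD; [exact: cvg_cst|exact: (cvg_norm cvg_id)].
Qed.

Let h_ge0 j x : 0 <= h j x.
Proof. by rewrite invr_ge0 exprn_ge0// addr_ge0. Qed.

Let h_le1 j x : h j x <= 1.
Proof. by rewrite invf_le1 ?exprn_ege1 ?lerDl// exprn_gt0// ltr_pwDl. Qed.

Let expR_ln_prod (j : nat) (y : 'I_K -> R) :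
  expR (- (j%:R * ln (\prod_(k < K) (1 + `|y k|)))) = \prod_(k < K) h j (y k).
Proof.
rewrite expRN expRM_natl lnK ?posrE; last first.
  by rewrite (lt_le_trans ltr01)// prod_ge1.
by rewrite -prodrXl prodfV.
Qed.

Let dist_lt0 : distribution P Lm `]-oo, 0[%classic = 0%E.
Proof.
rewrite /distribution /pushforward (_ : _ @^-1` _ = set0) ?measure0//.
apply/seteqP; split => // t /=; rewrite in_itv/= ltNge ln_ge0//.
exact: prod_ge1.
Qed.

Let nu_lt0 : nu `]-oo, 0[%classic = 0%E.
Proof.
rewrite nuE esum1// => ell _; rewrite (_ : _ @^-1` _ = set0) ?measure0 ?mule0//.
apply/seteqP; split => // t /=; rewrite in_itv/= ltNge ln_ge0//.
by apply: prod_ge1 => k.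
Qed.

Let law (B : set (measurableTypeR R)) : measurable B -> distribution P Lm B = nu B.
Proof.
apply: laplace_unique.
- by rewrite [ltLHS](_ : _ = 1%E) ?ltry//; exact: (probability_setT P).
- exact: dist_lt0.
- exact: nu_lt0.
move=> j; rewrite !integral_restrict_ge0 ?dist_lt0 ?nu_lt0//.
have mexp : measurable_fun setT ((fun x => expR (- (j%:R * x))) : measurableTypeR R -> R).
  exact: (continuous_measurable_fun (@continuous_expRNM R j%:R)).
rewrite integral_nu// ge0_integral_distribution//; last exact/measurable_EFinP.
transitivity (\int[P]_t (\prod_(k < K) h j ((c k)%:num * quad_form X r k t t))%:E)%E.
  apply: eq_integral => t _ /=; rewrite -expR_ln_prod /L; congr (expR (- (_ * ln _)))%:E.
  by apply: eq_bigr => k _; rewrite ger0_norm ?Q0.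
rewrite (expectation_mixture indX Xlaw r c (h := fun=> h j))//.
apply: eq_esum => ell _; congr (_ * _)%E.
rewrite -prodEFin; under [RHS]eq_integral do rewrite expR_ln_prod.
rewrite (expectation_gamma_prod (indY ell) (Ylaw ell) (h := fun=> h j))//.
apply: eq_bigr => k _; rewrite fineK//.
rewrite -(expectation_gamma (n := fun k => (m + ell k)%N) (Ylaw ell) k (h := h j))//.
rewrite ge0_fin_numE; last by apply: integral_ge0 => x _; rewrite lee_fin.
apply: (@le_lt_trans _ _ (\int[P']_x (cst 1 x))%E).
  apply: ge0_le_integral => //=.
  - by move=> x _; rewrite lee_fin.
  - by apply/measurable_EFinP; apply: measurableT_comp.
  - by move=> x _; rewrite lee_fin.
rewrite integral_cst// mul1e [ltLHS](_ : _ = 1%E) ?ltry//.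
exact: probability_setT.
Qed.

Theorem mixture_cdf (x : R) :
  P [set t | \prod_(k < K) (1 + (c k)%:num * quad_form X r k t t) <= x] =
  (\esum_(ell in [set: {ffun 'I_K -> nat}]) ((mix_weight m r ell)%:E *
     P' [set t | (\prod_(k < K) (1 + Y ell k t) <= x)%R]))%E.
Proof.
under eq_esum do rewrite (gamma_prod_cdf_abs (n := fun k => (m + _ k)%N) (Ylaw _)).
(* For x <= 0 both sides vanish, the products being at least 1; only for x > 0 can the inequality be
   taken to logarithms. *)
have [x0|x0] := ltP 0 x; last first.
  rewrite [X in P X](_ : _ = set0); last first.
    apply/seteqP; split => // t /= /(le_trans (prod_ge1 (fun k => Q0 k t))).
    by move=> /le_trans/(_ x0); rewrite ler10.
  rewrite measure0 esum1// => ell _; rewrite [X in P' X](_ : _ = set0) ?measure0 ?mule0//.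
  apply/seteqP; split => // t /= /(le_trans (prod_ge1 (fun k => normr_ge0 (Y ell k t)))).
  by move=> /le_trans/(_ x0); rewrite ler10.
have lnx (y : 'I_K -> R) : (forall k, 0 <= y k) ->
    (ln (\prod_(k < K) (1 + y k)) <= ln x) = (\prod_(k < K) (1 + y k) <= x).
  by move=> y0; rewrite ler_ln ?posrE// (lt_le_trans ltr01)// prod_ge1.
transitivity (distribution P Lm `]-oo, ln x]%classic).
  congr (P _); apply/seteqP; split => t /=; rewrite in_itv/= /L lnx//; exact: Q0.
rewrite law; last exact: measurable_itv.
rewrite nuE; apply: eq_esum => ell _; congr (_ * P' _)%E.
by apply/seteqP; split => t /=; rewrite in_itv/= /L' lnx.
Qed.

End mixture_cdf.

Section real_integrable.
Context d (T : measurableType d) (R : realType) (m : {measure set T -> \bar R}).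
Variables (D : set T) (mD : measurable D).

Lemma integrable_EFinZ (r : R) (f : T -> R) :
  m.-integrable D (EFin \o f) -> m.-integrable D (EFin \o (fun t => r * f t)).
Proof.
move=> h; have := integrableZl mD r h.
by apply: eq_integrable => // t _; rewrite /= EFinM.
Qed.

Lemma integrable_EFinD (f g : T -> R) :
  m.-integrable D (EFin \o f) -> m.-integrable D (EFin \o g) ->
  m.-integrable D (EFin \o (fun t => f t + g t)).
Proof.
move=> hf hg; have := integrableD mD hf hg.
by apply: eq_integrable => // t _; rewrite /= EFinD.
Qed.

Lemma integrable_EFinB (f g : T -> R) :
  m.-integrable D (EFin \o f) -> m.-integrable D (EFin \o g) ->
  m.-integrable D (EFin \o (fun t => f t - g t)).
Proof.
move=> hf hg; have := integrableB mD hf hg.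
by apply: eq_integrable => // t _; rewrite /= EFinB.
Qed.

End real_integrable.

(** * The complex Gamma function *)

Section elementary_inequalities.
Context {R : realType}.
Implicit Types (f df : R -> R) (x y a b v : R).

Lemma ge0_of_derive f df : f 0 = 0 -> (forall x, is_derive x (1 : R) f (df x)) ->
  (forall x, 0 <= x -> 0 <= df x) -> forall x, 0 <= x -> 0 <= f x.
Proof.
move=> f0 dfE df0 x x0.
have [|c] := @MVT_segment R f df 0 x x0 (fun y _ => dfE y).
  by apply: continuous_subspaceT => y; exact: der_continuous (dfE y).
rewrite f0 !subr0 in_itv/= => /andP[c0 _] ->.
by rewrite mulr_ge0// df0.
Qed.

Lemma sin_lex x : 0 <= x -> sin x <= x.
Proof.
move=> x0; have d y : is_derive y (1 : R) (fun x => x - sin x) (1 - cos y) by der; ring.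
rewrite -subr_ge0; move: x x0; apply: (ge0_of_derive _ d).
- by rewrite sin0 subrr.
- by move=> x _; rewrite subr_ge0 cos_le1.
Qed.

Lemma cos_ge x : 1 - x ^+ 2 / 2 <= cos x.
Proof.
wlog x0 : x / 0 <= x.
  move=> h; have [/h//|/ltW x0] := leP 0 x.
  by rewrite -sqrrN -cosN h// oppr_ge0.
rewrite -subr_ge0; move: x x0.
apply: (ge0_of_derive (df := (fun x => x - sin x))).
- by rewrite cos0 expr0n mul0r; ring.
- by move=> x; der; rewrite /=; field.
- by move=> x x0; rewrite subr_ge0 sin_lex.
Qed.

(** At v = ln u the bound reads (ln u)^2 <= u - 2 + 1 / u, which replaces a squared logarithm under
    a Gamma integral by Gamma integrals at neighbouring arguments. *)
Lemma sqr_le_coshB2 v : v ^+ 2 <= expR v - 2 + expR (- v).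
Proof.
wlog v0 : v / 0 <= v.
  move=> h; have [/h//|/ltW v0] := leP 0 v.
  have := h (- v); rewrite sqrrN opprK oppr_ge0 => /(_ v0) /le_trans; apply.
  by rewrite addrAC [leRHS]addrAC [X in _ <= X - 2]addrC.
have E y : 0 <= y -> 0 <= expR y - expR (- y) - 2 * y.
  apply: (ge0_of_derive (f := fun x => expR x - expR (- x) - 2 * x) (df := fun x => expR x + expR (- x) - 2)).
  - by rewrite oppr0 mulr0; ring.
  - by move=> x; der; ring.
  - move=> x _; have e0 := expR_gt0 x.
    rewrite expRN (_ : _ - 2 = (expR x - 1) ^+ 2 / expR x); last by field; rewrite gt_eqF.
    by rewrite divr_ge0 ?sqr_ge0// ltW.
rewrite -subr_ge0; move: v v0.
apply: (ge0_of_derive (f := fun x => expR x - 2 + expR (- x) - x ^+ 2) (df := fun x => expR x - expR (- x) - 2 * x)) => //.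
- by rewrite oppr0 expR0 expr0n/=; ring.
- by move=> x; der; rewrite /=; ring.
Qed.

Lemma ln_leB1 x : 0 < x -> ln x <= x - 1.
Proof.
move=> x0; rewrite lerBrDl; apply: (le_trans (expR_ge1Dx _)).
by rewrite lnK.
Qed.

(** The tangent of the concave function ln at x = a / b. Exponentiated, it bounds x^a by an explicit
    constant times exp (b x) for real a. *)
Lemma ln_le_linear a b x : 0 < a -> 0 < b -> 0 < x ->
  a * ln x <= b * x + a * (ln (a / b) - 1).
Proof.
move=> a0 b0 x0.
have := ln_leB1 (mulr_gt0 x0 (divr_gt0 b0 a0)).
have E : ln (b / a) = - ln (a / b) by rewrite -lnV ?posrE ?divr_gt0// invf_div.
rewrite [ln (x * _)]lnM ?posrE ?divr_gt0// E => h.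
have : a * (ln x - ln (a / b)) <= a * (x * (b / a) - 1) by rewrite ler_pM2l.
rewrite [a * (x * _ - 1)](_ : _ = b * x - a); last by field; rewrite gt_eqF.
lra.
Qed.

End elementary_inequalities.

Section gamma_function.
Context {R : realType}.
Notation mu := (@lebesgue_measure R).
Implicit Types a b tau phi t : R.

Definition gamma_kernel a t : R := expR ((a - 1) * ln t) * expR (- t).

Lemma gamma_kernel_ge0 a t : 0 <= gamma_kernel a t.
Proof. by rewrite mulr_ge0. Qed.

Lemma gamma_kernelS a t : 0 < t -> gamma_kernel (a + 1) t = t * gamma_kernel a t.
Proof.
move=> t0; rewrite /gamma_kernel addrK mulrA; congr (_ * _).
by rewrite -{2}(lnK (t0 : t \is Num.pos)) -expRD; congr expR; ring.
Qed.

Lemma derive_gamma_kernelS a t : 0 < t ->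
  is_derive t (1 : R) (gamma_kernel (a + 1)) (a * gamma_kernel a t - gamma_kernel (a + 1) t).
Proof.
move=> t0; have -> : gamma_kernel (a + 1) = (fun t => expR (a * ln t) * expR (- t)).
  by apply/funext => u; rewrite /gamma_kernel addrK.
der => //; rewrite /gamma_kernel.
have -> : expR ((a - 1) * ln t) = expR (a * ln t) / t.
  by rewrite mulrBl mul1r expRD expRN lnK.
by ring.
Qed.

Lemma gamma_kernel_cvg0 a : 0 < a -> gamma_kernel (a + 1) t @[t --> 0^'+] --> (0 : R).
Proof.
move=> a0; apply: (@squeeze_cvgr _ _ _ _ (cst 0) (fun t => t `^ a)).
- near=> t; rewrite gamma_kernel_ge0/= /gamma_kernel addrK.
  have t0 : 0 < t by near: t; exact: nbhs_right_gt.
  rewrite /powR gt_eqF// ler_piMr ?expR_ge0// -expR0 ler_expR oppr_le0; exact: ltW.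
- exact: cvg_cst.
- exact: powR_cvg0.
Unshelve. all: by end_near. Qed.

Lemma gamma_kernel_cvgy a : 0 < a -> gamma_kernel (a + 1) t @[t --> +oo] --> (0 : R).
Proof.
move=> a0; have h0 : (0 : R) < 1 / 2 by [].
pose C : R := expR (a * (ln (a / (1 / 2)) - 1)).
apply: (@squeeze_cvgr _ _ _ _ (cst 0) (fun t => C * (t ^+ 0 * expR (- (1 / 2 * t))))).
- near=> t; rewrite gamma_kernel_ge0/= /gamma_kernel addrK.
  have t0 : 0 < t by near: t; exact: nbhs_pinfty_gt.
  rewrite expr0 mul1r -!expRD ler_expR.
  have := ln_le_linear a0 h0 t0; lra.
- exact: cvg_cst.
- by rewrite -[X in _ --> X](mulr0 C); apply: cvgM; [exact: cvg_cst|exact: cvg_expn_expR].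
Unshelve. all: by end_near. Qed.

(** This is a t^(a-1) / (1 + t)^(a+1), the derivative of (t / (1 + t))^a, so its integral is 1. It
    serves as an integrable majorant of t^(a-1) exp (- t) for real a > 0, being of the right order
    at 0. *)
Let beta_kernel a t : R := a * expR ((a - 1) * ln t) * expR (- ((a + 1) * ln (1 + t))).

Let integral_beta_kernel a : 0 < a ->
  (\int[mu]_(t in `]0%R, +oo[) (beta_kernel a t)%:E = 1)%E.
Proof.
move=> a0; pose F t := expR (a * ln t) * expR (- (a * ln (1 + t))).
have cf t : 0 < t -> {for t, continuous (beta_kernel a)}.
  move=> t0; have t1 : 0 < 1 + t by rewrite addr_gt0.
  eapply der_continuous; rewrite /beta_kernel.
  by (repeat derive_step).
have dF t : 0 < t -> is_derive t (1 : R) F (beta_kernel a t).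
  move=> t0; have t1 : 0 < 1 + t by rewrite addr_gt0.
  rewrite /F; der => //; rewrite /beta_kernel.
  rewrite (_ : expR ((a - 1) * ln t) = expR (a * ln t) / t); last first.
    by rewrite mulrBl mul1r expRD expRN lnK.
  have -> : expR (- ((a + 1) * ln (1 + t))) = expR (- (a * ln (1 + t))) / (1 + t).
    by rewrite mulrDl mul1r opprD expRD [expR (- ln _)]expRN lnK.
  by field; rewrite !gt_eqF.
have F0 : F t @[t --> 0^'+] --> (0 : R).
  apply: (@squeeze_cvgr _ _ _ _ (cst 0) (fun t => t `^ a)).
  - near=> t; rewrite /F mulr_ge0//=.
    have t0 : 0 < t by near: t; exact: nbhs_right_gt.
    rewrite /powR gt_eqF// ler_piMr ?expR_ge0// expR_le1 oppr_le0.
    by rewrite mulr_ge0 ?(ltW a0)// ln_ge0// lerDl ltW.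
  - exact: cvg_cst.
  - exact: powR_cvg0.
have Fy : F t @[t --> +oo] --> (1 : R).
  (* F (t) = (1 + 1 / t)^-a = G (1 / t), so the limit at infinity is the value of the continuous [G]
     at 0. *)
  pose G t : R := expR (- (a * ln (1 + t))).
  have cG : {for 0, continuous G}.
    eapply der_continuous; rewrite /G.
    by (repeat derive_step); rewrite addr0.
  have G0 : G 0 = 1 by rewrite /G addr0 ln1 mulr0 oppr0 expR0.
  have : G t^-1 @[t --> +oo] --> (1 : R).
    rewrite -G0; apply: (@cvg_comp _ _ _ (fun t : R => t^-1) G _ (nbhs (0 : R))) => //.
    apply/gtr0_cvgV0; [near=> t; near: t; exact: nbhs_pinfty_gt|exact: cvg_id].
  apply: cvg_trans; apply: near_eq_cvg; near=> t.
  have t0 : 0 < t by near: t; exact: nbhs_pinfty_gt.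
  have t1 : 0 < 1 + t by rewrite addr_gt0.
  rewrite /F /G -expRD; congr expR.
  rewrite (_ : 1 + t^-1 = (1 + t) / t); last by field; rewrite gt_eqF.
  by rewrite ln_div ?posrE//; ring.
rewrite (ge0_FTC2_0y cf dF F0 Fy) ?subr0// => t t0.
by rewrite /beta_kernel !mulr_ge0 ?expR_ge0// ltW.
Unshelve. all: by end_near. Qed.

Lemma continuous_gamma_kernel_cos a tau phi t : 0 < t ->
  {for t, continuous (fun t => gamma_kernel a t * cos (tau * ln t + phi))}.
Proof.
move=> t0; eapply der_continuous; rewrite /gamma_kernel.
by (repeat derive_step).
Qed.

Lemma integrable_gamma_kernel_cos a tau phi : 0 < a ->
  mu.-integrable `]0%R, +oo[
    (EFin \o (fun t => gamma_kernel a t * cos (tau * ln t + phi))).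
Proof.
move=> a0; have a1 : 0 < a + 1 by rewrite ltr_wpDr// ltW.
(* The constant in exp (- t) <= a C (1 + t)^-(a + 1), from the tangent bound for (a + 1) ln (1 + t)
   with slope 1. *)
pose C : R := expR (1 + (a + 1) * (ln ((a + 1) / 1) - 1)) / a.
have mB : mu.-integrable `]0%R, +oo[ (fun t => C%:E * (beta_kernel a t)%:E)%E.
  apply: integrableZl => //; apply/integrableP; split.
    apply/measurable_EFinP; apply: measurable_continuous_pos => t t0.
    have t1 : 0 < 1 + t by rewrite addr_gt0.
    eapply der_continuous; rewrite /beta_kernel.
    by (repeat derive_step).
  rewrite [ltLHS](_ : _ = \int[mu]_(t in `]0%R, +oo[) (beta_kernel a t)%:E)%E.
    by rewrite integral_beta_kernel// ltry.
  apply: eq_integral => t _; rewrite /= ger0_norm//.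
  by rewrite /beta_kernel !mulr_ge0 ?expR_ge0// ltW.
apply: le_integrable mB => //.
  apply/measurable_EFinP; apply: measurable_continuous_pos => t t0.
  exact: continuous_gamma_kernel_cos.
move=> t; rewrite /= in_itv/= andbT => t0; have t1 : 0 < 1 + t by rewrite addr_gt0.
rewrite lee_fin normrM (ger0_norm (gamma_kernel_ge0 _ _)).
apply: (@le_trans _ _ (gamma_kernel a t)).
  by rewrite ler_piMr ?gamma_kernel_ge0// cos_max.
rewrite (_ : C * _ = expR ((a - 1) * ln t) *
    expR (1 + (a + 1) * (ln ((a + 1) / 1) - 1) - (a + 1) * ln (1 + t))); last first.
  by rewrite /C /beta_kernel [in RHS]expRD; field; rewrite gt_eqF.
apply: le_trans (ler_norm _); rewrite /gamma_kernel ler_wpM2l ?expR_ge0// ler_expR.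
have := ln_le_linear a1 ltr01 t1; lra.
Qed.

(** The real part of exp (i phi) Gamma(a + i tau). Phase 0 gives the real part of Gamma and phase -
    pi / 2 the imaginary part; a free phase lets one real identity express a complex one. *)
Definition gamma_integral a tau phi : R :=
  \int[mu]_(t in `]0%R, +oo[) (gamma_kernel a t * cos (tau * ln t + phi)).

(** The functional equation in real form: the derivative of t^a exp (- t) cos (tau ln t + phi)
    integrates to 0, since a > 0 kills the boundary term at 0. The sine it produces is a cosine of
    phase shifted by - pi / 2. *)
Lemma gamma_integralS a tau phi : 0 < a ->
  gamma_integral (a + 1) tau phi =
  a * gamma_integral a tau phi - tau * gamma_integral a tau (phi - pi / 2).
Proof.
move=> a0; have a1 : 0 < a + 1 by rewrite ltr_wpDr// ltW.
pose f t := a * (gamma_kernel a t * cos (tau * ln t + phi)) -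
  tau * (gamma_kernel a t * cos (tau * ln t + (phi - pi / 2))) -
  gamma_kernel (a + 1) t * cos (tau * ln t + phi).
pose F t := gamma_kernel (a + 1) t * cos (tau * ln t + phi).
have intZ (r b ta ph : R) : 0 < b -> mu.-integrable `]0%R, +oo[
    (EFin \o (fun t => r * (gamma_kernel b t * cos (ta * ln t + ph)))).
  by move=> b0; apply: integrable_EFinZ => //; exact: integrable_gamma_kernel_cos.
have i1 := intZ a a tau phi a0.
have i2 := intZ tau a tau (phi - pi / 2) a0.
have i3 := integrable_gamma_kernel_cos tau phi a1.
have i12 : mu.-integrable `]0%R, +oo[ (EFin \o (fun t =>
    a * (gamma_kernel a t * cos (tau * ln t + phi)) -
    tau * (gamma_kernel a t * cos (tau * ln t + (phi - pi / 2))))).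
  exact: (integrable_EFinB _ i1 i2).
have intf : mu.-integrable `]0%R, +oo[ (EFin \o f).
  exact: (integrable_EFinB _ i12 i3).
have cf t : 0 < t -> {for t, continuous f}.
  by move=> t0; eapply der_continuous; rewrite /f /gamma_kernel; (repeat derive_step).
have dF t : 0 < t -> is_derive t (1 : R) F (f t).
  move=> t0; rewrite /F /f; have dk := derive_gamma_kernelS a t0.
  der => //; rewrite addrA cosBpihalf gamma_kernelS//; field.
  by rewrite gt_eqF.
have F0 (l : set_system R) (FF : ProperFilter l) : gamma_kernel (a + 1) t @[t --> l] --> (0 : R) ->
    F t @[t --> l] --> (0 : R).
  move=> h; apply/norm_cvg0P; apply: (@squeeze_cvgr _ _ _ _ (cst 0) (gamma_kernel (a + 1))) => //; last exact: cvg_cst.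
  apply: nearW => t /=; rewrite normr_ge0/= /F normrM (ger0_norm (gamma_kernel_ge0 _ _)).
  by rewrite ler_piMr ?gamma_kernel_ge0// cos_max.
have := FTC2_0y cf dF (F0 _ (at_right_proper_filter _) (gamma_kernel_cvg0 a0))
  (F0 _ proper_pinfty_nbhs (gamma_kernel_cvgy a0)) intf.
rewrite subrr => E0; have : \int[mu]_(t in `]0%R, +oo[) f t = 0 by rewrite /Rintegral E0.
rewrite /f.
rewrite RintegralB// RintegralB// !RintegralZl//; last 2 first.
- exact: integrable_gamma_kernel_cos.
- exact: integrable_gamma_kernel_cos.
by rewrite /gamma_integral => /eqP; rewrite subr_eq0 => /eqP ->.
Qed.

Lemma gamma_integral_phase a tau phi : 0 < a ->
  gamma_integral a tau phi =
  cos phi * gamma_integral a tau 0 - sin phi * gamma_integral a tau (0 - pi / 2).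
Proof.
move=> a0; rewrite /gamma_integral -!RintegralZl ?integrable_gamma_kernel_cos//.
have intZ (r ph : R) : mu.-integrable `]0%R, +oo[
    (EFin \o (fun t => r * (gamma_kernel a t * cos (tau * ln t + ph)))).
  by apply: integrable_EFinZ => //; exact: integrable_gamma_kernel_cos.
rewrite -RintegralB//; apply: eq_Rintegral => t _.
by rewrite addrA !addr0 cosBpihalf cosD; ring.
Qed.

Lemma gamma_integral00_gt0 a : 1 <= a -> 0 < gamma_integral a 0 0.
Proof.
move=> a1; have a0 : 0 < a by exact: lt_le_trans a1.
have := integrable_gamma_kernel_cos 0 0 a0.
have -> : (fun t => gamma_kernel a t * cos (0 * ln t + 0)) = gamma_kernel a.
  by apply/funext => t; rewrite mul0r addr0 cos0 mulr1.
move=> ik; rewrite /gamma_integral.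
under eq_Rintegral do rewrite mul0r addr0 cos0 mulr1.
apply: (@lt_le_trans _ _ (expR (- 2))); first exact: expR_gt0.
rewrite -lee_fin fineK; last by exact: integrable_fin_num.
have mk : measurable_fun (`]0%R, +oo[%classic : set R) (EFin \o gamma_kernel a).
  by case/integrableP : ik.
have s12 : `[1%R, 2%R] `<=` (`]0%R, +oo[%classic : set R).
  by move=> t; rewrite /= !in_itv/= andbT => /andP[+ _]; apply: lt_le_trans.
apply: (@le_trans _ _ (\int[mu]_(t in `[1%R, 2%R]) (gamma_kernel a t)%:E)%E); last first.
  apply: ge0_subset_integral => // t _; rewrite lee_fin; exact: gamma_kernel_ge0.
apply: (@le_trans _ _ (\int[mu]_(t in `[1%R, 2%R]) (expR (- 2))%:E)%E).
  have mu1 : mu `[1%R, 2%R]%classic = 1%E.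
    by rewrite lebesgue_measure_itv/= lte_fin ltr1n -EFinB (_ : 2 - 1 = 1)//; ring.
  by rewrite integral_cst// [X in (_ * X)%E](_ : _ = 1%E) ?mule1.
apply: ge0_le_integral => //; first exact: measurable_funS mk.
move=> t; rewrite /= in_itv/= => /andP[t1 t2].
rewrite lee_fin /gamma_kernel -expRD ler_expR.
have := mulr_ge0 (_ : 0 <= a - 1) (ln_ge0 t1).
rewrite subr_ge0 => /(_ a1); lra.
Qed.

(* With u = t / b, the lower bound cos (tau ln u) >= 1 - tau^2 (u - 2 + 1 / u) / 2 integrates
   against t^b e^(-t) to Gamma (b + 1) (1 - tau^2 / (2 b)). *)
Lemma gamma_integral_gt0 b tau : 0 < b -> tau ^+ 2 < 2 * b ->
  0 < gamma_integral (b + 1) tau (- (tau * ln b)).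
Proof.
move=> b0 tb; have b1 : 0 < b + 1 by rewrite ltr_wpDr// ltW.
have b2 : 0 < b + 1 + 1 by rewrite ltr_wpDr// ltW.
pose g a t := gamma_kernel a t * cos (0 * ln t + 0).
have intZ (r a : R) : 0 < a -> mu.-integrable `]0%R, +oo[ (EFin \o (fun t => r * g a t)).
  by move=> a0; apply: integrable_EFinZ => //; exact: integrable_gamma_kernel_cos.
pose c1 : R := 1 + tau ^+ 2; pose c2 : R := tau ^+ 2 / (2 * b); pose c3 : R := tau ^+ 2 * b / 2.
have i1 := intZ c1 _ b1; have i2 := intZ c2 _ b2; have i3 := intZ c3 _ b0.
have i12 : mu.-integrable `]0%R, +oo[ (EFin \o (fun t => c1 * g (b + 1) t - c2 * g (b + 1 + 1) t)).
  exact: (integrable_EFinB _ i1 i2).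
have i123 : mu.-integrable `]0%R, +oo[ (EFin \o (fun t => c1 * g (b + 1) t -
    c2 * g (b + 1 + 1) t - c3 * g b t)).
  exact: (integrable_EFinB _ i12 i3).
apply: (@lt_le_trans _ _ (\int[mu]_(t in `]0%R, +oo[)
    (c1 * g (b + 1) t - c2 * g (b + 1 + 1) t - c3 * g b t))); last first.
  apply: le_Rintegral => //; first exact: integrable_gamma_kernel_cos.
  move=> t; rewrite /= in_itv/= andbT => t0.
  rewrite /g !mul0r !addr0 cos0 !mulr1 !gamma_kernelS//.
  set k := gamma_kernel b t; have k0 : 0 <= k by exact: gamma_kernel_ge0.
  apply: (@le_trans _ _ (t * k * (1 - (tau * ln (t / b)) ^+ 2 / 2))); last first.
    rewrite ler_wpM2l ?mulr_ge0 ?(ltW t0)//.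
    apply: le_trans (cos_ge _) _; rewrite ln_div ?posrE// mulrBr.
    by [].
  have := sqr_le_coshB2 (ln (t / b)).
  rewrite expRN lnK ?posrE ?divr_gt0// invf_div => h.
  have h' : tau ^+ 2 / 2 * (t * k) * ln (t / b) ^+ 2 <=
      tau ^+ 2 / 2 * (t * k) * (t / b - 2 + b / t).
    apply: ler_wpM2l => //; apply: mulr_ge0; first by rewrite divr_ge0 ?sqr_ge0.
    by rewrite mulr_ge0// ltW.
  have E : tau ^+ 2 / 2 * (t * k) * (t / b - 2 + b / t) =
      c2 * (t * (t * k)) - tau ^+ 2 * (t * k) + c3 * k.
    by rewrite /c2 /c3; field; rewrite !gt_eqF.
  rewrite E in h'; rewrite exprMn /c1; lra.
rewrite RintegralB// RintegralB// !RintegralZl ?integrable_gamma_kernel_cos//.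
rewrite -![Rintegral _ _ _]/(gamma_integral _ 0 0).
rewrite (@gamma_integralS (b + 1))// mul0r subr0.
have Gb : gamma_integral b 0 0 = gamma_integral (b + 1) 0 0 / b.
  by rewrite gamma_integralS// mul0r subr0 mulrC mulKf// gt_eqF.
rewrite Gb; set G := gamma_integral (b + 1) 0 0.
have G0 : 0 < G by apply: gamma_integral00_gt0; rewrite lerDr ltW.
rewrite (_ : _ - _ = G * (1 - tau ^+ 2 / (2 * b))); last first.
  by rewrite /c1 /c2 /c3; field; rewrite gt_eqF.
by rewrite mulr_gt0// subr_gt0 ltr_pdivrMr ?mul1r// mulr_gt0.
Qed.

(** If both parts vanish at [a], the functional equation makes every phase vanish at every a + n.
    Once 2 (a + n) exceeds tau^2 this contradicts [gamma_integral_gt0]. *)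
Lemma gamma_integral_neq0 a tau : 0 < a ->
  ~ (gamma_integral a tau 0 = 0 /\ gamma_integral a tau (0 - pi / 2) = 0).
Proof.
move=> a0 [re0 im0].
have h0 n phi : gamma_integral (a + n%:R) tau phi = 0.
  elim: n phi => [|n ih] phi; first by rewrite addr0 gamma_integral_phase// re0 im0 !mulr0 subrr.
  by rewrite -natr1 addrA gamma_integralS ?ih ?mulr0 ?subrr// ltr_wpDr.
pose n := (Num.truncn (tau ^+ 2)).+1.
have ln_ : tau ^+ 2 < n%:R by exact: truncnS_gt.
have b0 : 0 < a + n%:R by rewrite ltr_wpDr.
have := @gamma_integral_gt0 (a + n%:R) tau b0; rewrite -addrA natr1 h0 ltxx => h.
suff : false by []; apply: h; apply: (lt_le_trans ln_).
have : 0 <= n%:R :> R by []; lra.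
Qed.

End gamma_function.

Section complex_gamma.
Context {R : realType}.
Notation mu := (@lebesgue_measure R).
Implicit Types (a tau : R) (z w : R[i]).

Lemma cexpCD z w : cexpC (z + w) = cexpC z * cexpC w.
Proof.
case: z w => [a b] [c d]; rewrite /cexpC /= expRD cosD sinD.
by apply/eqP; rewrite eq_complex /=; apply/andP; split; apply/eqP; ring.
Qed.

Lemma cpowRE a (c tau : R) :
  cpowR a (Complex c tau) =
  Complex (expR (c * ln a) * cos (tau * ln a)) (expR (c * ln a) * sin (tau * ln a)).
Proof. by rewrite /cpowR /cexpC /= !mulr0 subr0 add0r. Qed.

Lemma GammaCE a tau :
  GammaC (Complex a tau) = Complex (gamma_integral a tau 0) (gamma_integral a tau (0 - pi / 2)).
Proof.
rewrite /GammaC /CInt; congr Complex; apply: eq_Rintegral => t _.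
- by rewrite (_ : Complex a tau - 1 = Complex (a - 1) tau) ?cpowRE/=; [rewrite /gamma_kernel addr0; ring|congr Complex; rewrite subr0].
- rewrite (_ : Complex a tau - 1 = Complex (a - 1) tau) ?cpowRE/=; last by congr Complex; rewrite subr0.
  by rewrite /gamma_kernel add0r addrC cosBpihalf; ring.
Qed.

Lemma GammaC_neq0 a tau : 0 < a -> GammaC (Complex a tau) != 0.
Proof.
move=> a0; rewrite GammaCE; apply/negP => /eqP[h1 h2].
exact: (@gamma_integral_neq0 R a tau a0).
Qed.

Lemma GammaCS a tau : 0 < a ->
  GammaC (Complex (a + 1) tau) = Complex a tau * GammaC (Complex a tau).
Proof.
move=> a0; rewrite !GammaCE !gamma_integralS//.
rewrite (@gamma_integral_phase _ a tau (0 - pi / 2 - pi / 2))//.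
apply/eqP; rewrite eq_complex /=; apply/andP; split; apply/eqP; first by [].
rewrite (_ : 0 - pi / 2 - pi / 2 = - pi); last by field.
by rewrite cosN sinN cospi sinpi; ring.
Qed.

End complex_gamma.

(** * Mellin moments of 1 + R for a Gamma variable R *)

Section gamma_characteristic.
Context {R : realType}.
Notation mu := (@lebesgue_measure R).
Variables (n : nat) (b : R) (c : R).
Hypotheses (b0 : 0 < b) (c0 : c < 0).
Implicit Types (u tau phi : R).

Let C : R := (n`!%:R * b ^+ n.+1)^-1.

Let C0 : 0 < C.
Proof. by rewrite invr_gt0 mulr_gt0 ?exprn_gt0// ltr0n fact_gt0. Qed.

Let pw u : R := expR (c * ln (1 + u)).

Let pw_le1 u : 0 < u -> pw u <= 1.
Proof.
move=> u0; rewrite expR_le1 nmulr_rle0// ln_ge0// lerDl; exact: ltW.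
Qed.

Definition gamma_density u : R := C * (u ^+ n * expR (- (b^-1 * u))).

(** The real part of exp (i phi) E ((1 + R)^(c + i tau)) for [R] Gamma of shape n + 1 and scale [b];
    phases 0 and - pi / 2 give the two parts of the Mellin moment. *)
Definition gamma_char tau phi : R :=
  \int[mu]_(u in `]0%R, +oo[) (gamma_density u * (expR (c * ln (1 + u)) * cos (tau * ln (1 + u) + phi))).

(** The polynomial factor in the derivative of u^n exp (- u / b) (1 + u)^(c+1). The extra power of 1
    + u compensates the 1 / (1 + u) produced by differentiating sin (tau ln (1 + u) + phi). *)
Let dpoly u : R := (n%:R * u ^+ n.-1 - b^-1 * u ^+ n) * (1 + u) + (c + 1) * u ^+ n.

Let major u : R := (n%:R * C) * (u ^+ n.-1 * expR (- (b^-1 * u))) +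
  ((n%:R + b^-1 + `|c + 1|) * C) * (u ^+ n * expR (- (b^-1 * u))) +
  (b^-1 * C) * (u ^+ n.+1 * expR (- (b^-1 * u))).

Let dw u : R := C * dpoly u * expR (- (b^-1 * u)) * pw u.

Let dw_le u : 0 < u -> `|dw u| <= major u.
Proof.
move=> u0; rewrite /dw !normrM (gtr0_norm C0) (gtr0_norm (expR_gt0 _)) (gtr0_norm (expR_gt0 _)).
have h : `|dpoly u| <= n%:R * u ^+ n.-1 + (n%:R + b^-1 + `|c + 1|) * u ^+ n + b^-1 * u ^+ n.+1.
  have un k : 0 <= u ^+ k by rewrite exprn_ge0// ltW.
  have bV : 0 <= b^-1 by rewrite invr_ge0 ltW.
  have nu : n%:R * u ^+ n.-1 * u = n%:R * u ^+ n.
    by case: (n) => [|k]; rewrite ?mul0r// -mulrA -exprSr.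
  rewrite /dpoly; apply: (le_trans (ler_normD _ _)).
  rewrite [`|(c + 1) * _|]normrM (ger0_norm (un n)) normrM [`|1 + u|]gtr0_norm ?addr_gt0//.
  have : `|n%:R * u ^+ n.-1 - b^-1 * u ^+ n| <= n%:R * u ^+ n.-1 + b^-1 * u ^+ n.
    apply: (le_trans (ler_normB _ _)).
    by rewrite !ger0_norm ?mulr_ge0.
  move=> /(ler_wpM2r (ltW (addr_gt0 ltr01 u0))) /le_trans h.
  rewrite (le_trans (lerD (h _ (lexx _)) (lexx _)))//.
  rewrite [X in X + _](_ : _ = n%:R * u ^+ n.-1 + n%:R * u ^+ n.-1 * u + b^-1 * u ^+ n + b^-1 * (u ^+ n * u)); last by ring.
  rewrite nu exprSr; lra.
apply: (@le_trans _ _ (C * `|dpoly u| * expR (- (b^-1 * u)))).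
  by rewrite ler_piMr ?pw_le1// !mulr_ge0// ltW.
apply: (@le_trans _ _ (C * (n%:R * u ^+ n.-1 + (n%:R + b^-1 + `|c + 1|) * u ^+ n + b^-1 * u ^+ n.+1) * expR (- (b^-1 * u)))).
  by rewrite ler_wpM2r ?expR_ge0// ler_wpM2l// ltW.
by rewrite /major; lra.
Qed.

Let integrable_major : mu.-integrable `]0%R, +oo[ (EFin \o major).
Proof.
have bV : 0 < b^-1 by rewrite invr_gt0.
apply: integrable_EFinD => //; last first.
  by apply: integrable_EFinZ => //; exact: integrable_expn_expR.
by apply: integrable_EFinD => //; apply: integrable_EFinZ => //; exact: integrable_expn_expR.
Qed.

Let derivable_pw_cos u tau phi : 0 < 1 + u ->
  is_derive u (1 : R) (fun u => C * (u ^+ n * expR (- (b^-1 * u))) * ((1 + u) * pw u) * sin (tau * ln (1 + u) + phi))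
    (dw u * sin (tau * ln (1 + u) + phi) +
     tau * (gamma_density u * (pw u * cos (tau * ln (1 + u) + phi)))).
Proof.
move=> u1; rewrite /pw /dw /dpoly /gamma_density /pw; der => //; field.
by rewrite !gt_eqF.
Qed.

Let continuous_gd u tau phi : 0 < u -> {for u, continuous
  (fun u => gamma_density u * (expR (c * ln (1 + u)) * cos (tau * ln (1 + u) + phi)))}.
Proof.
move=> u0; have u1 : 0 < 1 + u by rewrite addr_gt0.
by eapply der_continuous; rewrite /gamma_density; repeat derive_step.
Qed.

Let continuous_dw u tau phi : 0 < u -> {for u, continuous
  (fun u => dw u * sin (tau * ln (1 + u) + phi))}.
Proof.
move=> u0; have u1 : 0 < 1 + u by rewrite addr_gt0.
by eapply der_continuous; rewrite /dw /dpoly /pw; repeat derive_step.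
Qed.

Lemma integrable_gamma_char tau phi : mu.-integrable `]0%R, +oo[
  (EFin \o (fun u => gamma_density u * (expR (c * ln (1 + u)) * cos (tau * ln (1 + u) + phi)))).
Proof.
have bV : 0 < b^-1 by rewrite invr_gt0.
have : mu.-integrable `]0%R, +oo[ (EFin \o gamma_density).
  by apply: integrable_EFinZ => //; exact: integrable_expn_expR.
apply: le_integrable => //.
  apply/measurable_EFinP; apply: measurable_continuous_pos => u; exact: continuous_gd.
move=> u; rewrite /= in_itv/= andbT => u0; rewrite lee_fin -/(gamma_density u).
rewrite normrM ler_piMr// normrM mulr_ile1// ?cos_max//.
by rewrite gtr0_norm ?expR_gt0//; exact: pw_le1.
Qed.

Let gamma_char_le tau phi : `|gamma_char tau phi| <= \int[mu]_(u in `]0%R, +oo[) gamma_density u.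
Proof.
apply: (le_trans (le_normr_Rintegral _ (integrable_gamma_char tau phi))) => //.
apply: le_Rintegral => //.
- by have := integrable_norm (integrable_gamma_char tau phi).
- apply: integrable_EFinZ => //; apply: integrable_expn_expR; by rewrite invr_gt0.
- move=> u; rewrite /= in_itv/= andbT => u0.
  have d0 : 0 <= gamma_density u.
    by rewrite mulr_ge0 ?mulr_ge0 ?exprn_ge0 ?expR_ge0//; exact: ltW.
  rewrite normrM (ger0_norm d0) ler_piMr// normrM mulr_ile1// ?cos_max//.
  by rewrite gtr0_norm ?expR_gt0//; exact: pw_le1.
Qed.

Let integrable_dw tau phi : mu.-integrable `]0%R, +oo[
  (EFin \o (fun u => dw u * sin (tau * ln (1 + u) + phi))).
Proof.
apply: le_integrable integrable_major => //.
  apply/measurable_EFinP; apply: measurable_continuous_pos => u; exact: continuous_dw.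
move=> u; rewrite /= in_itv/= andbT => u0; rewrite lee_fin normrM.
apply: le_trans (ler_norm _); apply: le_trans (dw_le u0).
by rewrite ler_piMr// sin_max.
Qed.

(* Integration by parts against d (sin (tau ln (1 + u) + phi)). *)
Let gamma_char_parts : exists M : R, forall tau phi, `|tau * gamma_char tau phi| <= M.
Proof.
have bV : 0 < b^-1 by rewrite invr_gt0.
exists (C + \int[mu]_(u in `]0%R, +oo[) major u) => tau phi.
pose f u := dw u * sin (tau * ln (1 + u) + phi) +
  tau * (gamma_density u * (expR (c * ln (1 + u)) * cos (tau * ln (1 + u) + phi))).
pose F u := C * (u ^+ n * expR (- (b^-1 * u))) * ((1 + u) * pw u) * sin (tau * ln (1 + u) + phi).
have i2 : mu.-integrable `]0%R, +oo[ (EFin \o (fun u =>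
    tau * (gamma_density u * (expR (c * ln (1 + u)) * cos (tau * ln (1 + u) + phi))))).
  by apply: integrable_EFinZ => //; exact: integrable_gamma_char.
have intf : mu.-integrable `]0%R, +oo[ (EFin \o f).
  exact: (integrable_EFinD _ (integrable_dw tau phi) i2).
have cf u : 0 < u -> {for u, continuous f}.
  move=> u0; have u1 : 0 < 1 + u by rewrite addr_gt0.
  by eapply der_continuous; rewrite /f /gamma_density /dw /dpoly /pw; repeat derive_step.
have dF u : 0 < u -> is_derive u (1 : R) F (f u).
  by move=> u0; apply: derivable_pw_cos; rewrite addr_gt0.
have F0 : F u @[u --> 0^'+] --> F 0.
  apply: cvg_at_right_filter; eapply der_continuous; apply: derivable_pw_cos.
  by rewrite addr0.
have Fy : F u @[u --> +oo] --> (0 : R).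
  apply/norm_cvg0P; apply: (@squeeze_cvgr _ _ _ _ (cst 0) (fun u =>
      C * (u ^+ n * expR (- (b^-1 * u))) + C * (u ^+ n.+1 * expR (- (b^-1 * u))))).
  - near=> u; rewrite normr_ge0/=; have u0 : 0 < u by near: u; exact: nbhs_pinfty_gt.
    have Cu : 0 <= C * (u ^+ n * expR (- (b^-1 * u))).
      by rewrite mulr_ge0 ?mulr_ge0 ?exprn_ge0 ?expR_ge0//; exact: ltW.
    rewrite /F normrM; apply: (@le_trans _ _ `|C * (u ^+ n * expR (- (b^-1 * u))) * ((1 + u) * pw u)|).
      by rewrite ler_piMr// sin_max.
    rewrite normrM (ger0_norm Cu) normrM [`|1 + u|]gtr0_norm ?addr_gt0//.
    rewrite [`|pw u|]gtr0_norm ?expR_gt0//.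
    apply: (@le_trans _ _ (C * (u ^+ n * expR (- (b^-1 * u))) * (1 + u))).
      by rewrite ler_wpM2l// ler_piMr ?pw_le1// addr_ge0// ltW.
    by rewrite exprSr; lra.
  - exact: cvg_cst.
  - rewrite -[X in _ --> X](addr0 0); apply: cvgD.
      by rewrite -[X in _ --> X](mulr0 C); apply: cvgM; [exact: cvg_cst|exact: cvg_expn_expR].
    by rewrite -[X in _ --> X](mulr0 C); apply: cvgM; [exact: cvg_cst|exact: cvg_expn_expR].
have := FTC2_0y cf dF F0 Fy intf.
move=> E0; have : \int[mu]_(u in `]0%R, +oo[) f u = 0 - F 0 by rewrite /Rintegral E0.
rewrite /f RintegralD// RintegralZl// ?integrable_gamma_char// -/(gamma_char tau phi) sub0r.
move=> /eqP; rewrite eq_sym addrC -subr_eq => /eqP <-.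
apply: (le_trans (ler_normB _ _)); apply: lerD.
  rewrite normrN /F !addr0 !mul1r mulr0 oppr0 expR0 mulr1 /pw addr0 ln1 !mulr0 expR0 mulr1 add0r.
  rewrite normrM; apply: (@le_trans _ _ `|C * 0 ^+ n|); first by rewrite ler_piMr// sin_max.
  rewrite normrM gtr0_norm// ler_piMr ?(ltW C0)// expr0n.
  by case: (n == 0)%N; rewrite ?normr1 ?normr0.
apply: (le_trans (le_normr_Rintegral _ _)) => //.
apply: le_Rintegral => //.
- by have := integrable_norm (integrable_dw tau phi).
- move=> u; rewrite /= in_itv/= andbT => u0; rewrite normrM.
  by apply: le_trans (dw_le u0); rewrite ler_piMr// sin_max.
Unshelve. all: by end_near. Qed.

Lemma gamma_char_decay : exists2 M : R, 0 <= M &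
  forall tau phi, 0 < tau -> `|gamma_char tau phi| <= M / (1 + tau).
Proof.
have [M h] := gamma_char_parts; exists (\int[mu]_(u in `]0%R, +oo[) gamma_density u + M).
  rewrite addr_ge0//; first exact: le_trans (normr_ge0 _) (gamma_char_le 0 0).
  exact: le_trans (normr_ge0 _) (h 0 0).
move=> tau phi tau0; rewrite ler_pdivlMr ?addr_gt0// mulrDr mulr1; apply: lerD; first exact: gamma_char_le.
by have := h tau phi; rewrite normrM (gtr0_norm tau0) mulrC.
Qed.

(** With gamma = phi + 1 + s the Tricomi integrand is t^n exp (- t / b) (1 + t)^s, an unnormalized
    Gamma density times the power to be averaged. Of the prefactor b^-(n + 1 + s), the part b^-(n +
    1) normalizes the density and b^-s is left. *)
Lemma PsiFactor_gamma tau :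
  PsiFactor n.+1%:R (real_complex R (n.+1%:R + 1) + real_complex R 1 * Complex c tau) b^-1 =
  cpowR b (- Complex c tau) * Complex (gamma_char tau 0) (gamma_char tau (0 - pi / 2)).
Proof.
have nb0 : n`!%:R * b ^+ n.+1 != 0 by rewrite mulf_neq0 ?expf_neq0 ?gt_eqF// ltr0n fact_gt0.
have CV : C^-1 = n`!%:R * b ^+ n.+1 by rewrite invrK.
have intE (g : R -> R) phi : (forall u, 0 < u -> g u = u ^+ n * expR (- (b^-1 * u)) *
      (expR (c * ln (1 + u)) * cos (tau * ln (1 + u) + phi))) ->
    \int[mu]_(u in `]0%R, +oo[) g u = C^-1 * gamma_char tau phi.
  move=> gE; rewrite /gamma_char -RintegralZl//; last exact: integrable_gamma_char.
  apply: eq_Rintegral => u; rewrite inE/= in_itv/= andbT => u0.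
  by rewrite gE// /gamma_density !mulrA mulVf ?mul1r// gt_eqF.
have pwE (u : R) : 0 < u -> u `^ (n.+1%:R - 1) = u ^+ n.
  by move=> u0; rewrite -natr1 addrK powR_mulrn// ltW.
have sE (z : R[i]) : z = Complex c tau ->
    real_complex R (n.+1%:R + 1) + real_complex R 1 * z - real_complex R n.+1%:R - 1 = Complex c tau.
  by move=> ->; apply/eqP; rewrite eq_complex /=; apply/andP; split; apply/eqP; ring.
rewrite /PsiFactor invr_gt0 b0 /Tricomi mulrA /CInt sE//.
rewrite (intE _ 0); last first.
  move=> u u0; rewrite pwE// cpowRE /= addr0; ring.
rewrite (intE _ (0 - pi / 2)); last first.
  move=> u u0; rewrite pwE// cpowRE /= add0r cosBpihalf; ring.
rewrite GammaRS CV.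
have -> : real_complex R (n.+1%:R + 1) + real_complex R 1 * Complex c tau - 1 =
    Complex (n.+1%:R + c) tau.
  by apply/eqP; rewrite eq_complex /=; apply/andP; split; apply/eqP; ring.
have -> : - Complex c tau = Complex (- c) (- tau) by [].
rewrite !cpowRE lnV ?posrE// mulrDl [in expR (n.+1%:R * _ + _)]expRD.
have -> : expR (n.+1%:R * - ln b) = (b ^+ n.+1)^-1.
  by rewrite mulrN expRN expRM_natl lnK.
have bn0 : b ^+ n.+1 != 0 by rewrite expf_neq0 ?gt_eqF.
have fn0 : n`!%:R != 0 :> R by rewrite pnatr_eq0 -lt0n fact_gt0.
rewrite !mulrN !mulNr.
by apply/eqP; rewrite eq_complex /=; apply/andP; split; apply/eqP; field; apply/andP.
Qed.

End gamma_characteristic.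

(** * Expectations of products of independent complex variables *)

Section complex_expectation.
Context d (T : measurableType d) (R : realType) (P : probability T R).

Lemma integrable_bounded (f : T -> R) (M : R) : measurable_fun setT f ->
  (forall t, `|f t| <= M) -> P.-integrable setT (EFin \o f).
Proof.
move=> mf fM; apply: (@le_integrable _ _ _ P setT _ _ (EFin \o cst M)) => //.
- exact/measurable_EFinP.
- by move=> t _; rewrite lee_fin (le_trans (fM t))//= ler_norm.
- exact: finite_measure_integrable_cst.
Qed.

Lemma Rintegral_probability_cst (r : R) : \int[P]_t r = r.
Proof.
by rewrite /Rintegral integral_cst// [X in (_ * X)%E](_ : _ = 1%E) ?mule1//; exact: probability_setT.
Qed.

Definition cexpectation (F : T -> R[i]) : R[i] :=
  Complex (\int[P]_t complex.Re (F t)) (\int[P]_t complex.Im (F t)).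

Variables (I : finType) (X : I -> T -> R).
Hypothesis mX : forall i, measurable_fun setT (X i).
Hypothesis indX : mutually_independent P X.

(** Adding the bounds [M] and [N] makes both factors nonnegative, the case already settled by
    decoupling; linearity removes the added terms. *)
Lemma bounded_expectation_indepM J (f g : T -> R) (M N : R) :
  measurable_fun setT (f : g_sigma_algebraType (cylinders X J) -> R) ->
  measurable_fun setT (g : g_sigma_algebraType (cylinders X (predC J)) -> R) ->
  (forall t, `|f t| <= M) -> (forall t, `|g t| <= N) ->
  \int[P]_t (f t * g t) = (\int[P]_t f t) * \int[P]_t g t.
Proof.
move=> mf mg fM gN.
have mf' := measurable_cylindersT mX mf; have mg' := measurable_cylindersT mX mg.
have if_ := integrable_bounded mf' fM; have ig := integrable_bounded mg' gN.
have ifg : P.-integrable setT (EFin \o (fun t => f t * g t)).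
  apply: (@integrable_bounded _ (M * N)); first exact: measurable_funM.
  by move=> t; rewrite normrM ler_pM.
have ic (r : R) : P.-integrable setT (EFin \o (fun t : T => r)).
  by apply: (@integrable_bounded _ `|r|) => //; exact: measurable_cst.
have h : (\int[P]_t ((f t + M) * (g t + N))%:E =
    (\int[P]_t (f t + M)%:E) * \int[P]_t (g t + N)%:E)%E.
  apply: (expectation_indepM mX indX (J := J)).
  - exact: measurable_funD.
  - exact: measurable_funD.
  - by move=> t; move: (fM t); rewrite ler_norml -subr_ge0 opprK => /andP[].
  - by move=> t; move: (gN t); rewrite ler_norml -subr_ge0 opprK => /andP[].
have ifM := integrable_EFinD (@measurableT _ T) if_ (ic M).
have igN := integrable_EFinD (@measurableT _ T) ig (ic N).
have : \int[P]_t ((f t + M) * (g t + N)) = (\int[P]_t (f t + M)) * \int[P]_t (g t + N).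
  by rewrite /Rintegral h fineM// ; exact: integrable_fin_num.
rewrite [LHS](_ : _ = \int[P]_t (f t * g t + N * f t + M * g t + M * N)); last first.
  by apply: eq_Rintegral => t _; ring.
have i1 := integrable_EFinZ (@measurableT _ T) N if_.
have i2 := integrable_EFinZ (@measurableT _ T) M ig.
have i3 := integrable_EFinD (@measurableT _ T) ifg i1.
have i4 := integrable_EFinD (@measurableT _ T) i3 i2.
rewrite !RintegralD// !RintegralZl// !Rintegral_probability_cst.
move=> h'; apply: (@addIr _ (N * \int[P]_t f t + M * \int[P]_t g t + M * N)).
by rewrite !addrA h'; ring.
Qed.

Definition bounded_measurable (J : pred I) (F : T -> R[i]) : Prop :=
  [/\ measurable_fun setT ((fun t => complex.Re (F t)) : g_sigma_algebraType (cylinders X J) -> R),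
      measurable_fun setT ((fun t => complex.Im (F t)) : g_sigma_algebraType (cylinders X J) -> R) &
      exists M, forall t, `|complex.Re (F t)| <= M /\ `|complex.Im (F t)| <= M].

Lemma cexpectation_indepM J (F G : T -> R[i]) :
  bounded_measurable J F -> bounded_measurable (predC J) G ->
  cexpectation (fun t => F t * G t) = cexpectation F * cexpectation G.
Proof.
move=> [mF1 mF2 [M FM]] [mG1 mG2 [N GN]].
have F1M t : `|complex.Re (F t)| <= M by case: (FM t).
have F2M t : `|complex.Im (F t)| <= M by case: (FM t).
have G1N t : `|complex.Re (G t)| <= N by case: (GN t).
have G2N t : `|complex.Im (G t)| <= N by case: (GN t).
have int (f g : T -> R) :
    measurable_fun setT (f : g_sigma_algebraType (cylinders X J) -> R) ->
    measurable_fun setT (g : g_sigma_algebraType (cylinders X (predC J)) -> R) ->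
    (forall t, `|f t| <= M) -> (forall t, `|g t| <= N) ->
    P.-integrable setT (EFin \o (fun t => f t * g t)).
  move=> mf mg fM gN; apply: (@integrable_bounded _ (M * N)).
    by apply: measurable_funM; [exact: measurable_cylindersT mf|exact: measurable_cylindersT mg].
  by move=> t; rewrite normrM ler_pM.
rewrite /cexpectation; apply/eqP; rewrite eq_complex /=; apply/andP; split; apply/eqP.
  rewrite -(bounded_expectation_indepM mF1 mG1 F1M G1N) -(bounded_expectation_indepM mF2 mG2 F2M G2N).
  rewrite -RintegralB//; [|exact: int|exact: int].
  by apply: eq_Rintegral => t _; case: (F t) (G t) => [a b] [a' b'].
rewrite -(bounded_expectation_indepM mF1 mG2 F1M G2N) -(bounded_expectation_indepM mF2 mG1 F2M G1N).
rewrite -RintegralD//; [|exact: int|exact: int].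
by apply: eq_Rintegral => t _; case: (F t) (G t) => [a b] [a' b'].
Qed.

Lemma bounded_measurableM J (F G : T -> R[i]) :
  bounded_measurable J F -> bounded_measurable J G -> bounded_measurable J (fun t => F t * G t).
Proof.
move=> [mF1 mF2 [M FM]] [mG1 mG2 [N GN]].
have E t : F t * G t = Complex (complex.Re (F t) * complex.Re (G t) - complex.Im (F t) * complex.Im (G t))
    (complex.Re (F t) * complex.Im (G t) + complex.Im (F t) * complex.Re (G t)).
  by case: (F t) (G t) => [a b] [a' b'].
have fgM (x y : R) : `|x| <= M -> `|y| <= N -> `|x * y| <= M * N.
  by move=> xM yN; rewrite normrM ler_pM.
split.
- under eq_fun do rewrite E /=.
  by apply: measurable_funB; exact: measurable_funM.
- under eq_fun do rewrite E /=.
  by apply: measurable_funD; exact: measurable_funM.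
exists (M * N + M * N) => t; rewrite E /=; have [F1 F2] := FM t; have [G1 G2] := GN t; split.
  by apply: (le_trans (ler_normB _ _)); apply: lerD; exact: fgM.
by apply: (le_trans (ler_normD _ _)); apply: lerD; exact: fgM.
Qed.

Lemma bounded_measurable_cst J (z : R[i]) : bounded_measurable J (fun=> z).
Proof.
split; [exact: measurable_cst|exact: measurable_cst|].
exists (`|complex.Re z| + `|complex.Im z|) => t.
by rewrite lerDl lerDr !normr_ge0.
Qed.

Lemma bounded_measurableW J J' F : {subset J <= J'} ->
  bounded_measurable J F -> bounded_measurable J' F.
Proof.
move=> JJ' [mF1 mF2 FM]; split => //.
- exact: measurable_cylindersW JJ' mF1.
- exact: measurable_cylindersW JJ' mF2.
Qed.

Lemma cexpectation_indep_prod (F : I -> T -> R[i]) :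
  (forall i, bounded_measurable (pred1 i) (F i)) ->
  cexpectation (fun t => \prod_i F i t) = \prod_i cexpectation (F i).
Proof.
move=> bF; have : uniq (index_enum I) by exact: index_enum_uniq.
elim: (index_enum I) => [_|i s ih /= /andP[is_ us]].
  under [X in cexpectation X]eq_fun do rewrite big_nil.
  by rewrite big_nil /cexpectation /= !Rintegral_probability_cst.
under [X in cexpectation X]eq_fun do rewrite big_cons.
rewrite big_cons -ih//; apply: (@cexpectation_indepM (pred1 i)) => //.
elim: s is_ {ih us} => [_|j s ih].
  under eq_fun do rewrite big_nil.
  exact: bounded_measurable_cst.
rewrite inE negb_or => /andP[ij is_]; under eq_fun do rewrite big_cons.
apply: bounded_measurableM; last exact: ih.
apply: bounded_measurableW (bF j) => k; rewrite !inE /= => /eqP ->.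
by rewrite eq_sym.
Qed.

End complex_expectation.

Section gamma_expectation.
Context d (T : measurableType d) (R : realType) (P : probability T R).
Notation mu := (@lebesgue_measure R).
Variables (K : nat) (c : 'I_K -> {posnum R}) (n : 'I_K -> nat).
Variable Y : 'I_K -> {RV P >-> R}.
Hypothesis indY : mutually_independent P (fun k => (Y k : T -> R)).
Hypothesis Ylaw : forall k, gamma_distributed P (Y k) (n k).+1%:R (c k)%:num.

Let density_ge0 k u : 0 < u -> 0 <= gamma_density (n k) (c k)%:num u.
Proof.
by move=> u0; rewrite /gamma_density !mulr_ge0 ?expR_ge0 ?invr_ge0 ?mulr_ge0 ?exprn_ge0// ltW.
Qed.

Lemma expectation_gamma_density (k : 'I_K) (h : R -> R) : measurable_fun setT h ->
  \int[P]_t h (Y k t) =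
  \int[mu]_(u in `]0%R, +oo[) (gamma_density (n k) (c k)%:num u * h u).
Proof.
move=> mh; rewrite /Rintegral; congr fine.
have nng (g : R -> R) : measurable_fun setT g -> (forall x, 0 <= g x) ->
    (\int[P]_t (g (Y k t))%:E =
     \int[mu]_(u in `]0%R, +oo[) (gamma_density (n k) (c k)%:num u * g u)%:E)%E.
  move=> mg g0; rewrite (expectation_gamma Ylaw k mg g0) integral_gamma_prob//.
  rewrite (@integral_gamma_pdfM R (n k) (c k)%:num g)//.
  by apply: eq_integral => u _; congr EFin; rewrite /gamma_density !mulrA.
have mhp : measurable_fun setT (fun x => Num.max (h x) 0) by exact: measurable_maxr.
have mhn : measurable_fun setT (fun x => Num.max (- h x) 0).
  by apply: measurable_maxr => //; exact: measurableT_comp.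
rewrite [LHS]integralE [RHS]integralE; congr (_ - _)%E.
- transitivity (\int[P]_t (Num.max (h (Y k t)) 0)%:E)%E.
    by apply: eq_integral => t _; rewrite funeposE EFin_max.
  rewrite (nng (fun x => Num.max (h x) 0))//; last by move=> x; rewrite le_max lexx orbT.
  apply: eq_integral => u; rewrite inE/= in_itv/= andbT => u0.
  by rewrite funeposE -EFin_max maxr_pMr ?mulr0 ?density_ge0.
- transitivity (\int[P]_t (Num.max (- h (Y k t)) 0)%:E)%E.
    by apply: eq_integral => t _; rewrite funenegE EFin_max EFinN.
  rewrite (nng (fun x => Num.max (- h x) 0))//; last by move=> x; rewrite le_max lexx orbT.
  apply: eq_integral => u; rewrite inE/= in_itv/= andbT => u0.
  by rewrite funenegE -EFinN -EFin_max maxr_pMr ?mulr0 ?density_ge0// mulrN.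
Qed.

Lemma cpowR_prod (J : finType) (a : J -> R) (w : R[i]) : (forall j, 0 < a j) ->
  cpowR (\prod_j a j) w = \prod_j cpowR (a j) w.
Proof.
move=> a0; suff : 0 < \prod_j a j /\ cpowR (\prod_j a j) w = \prod_j cpowR (a j) w by case.
elim/big_rec2 : _ => [|j z p _ [p0 ih]].
  by rewrite /cpowR ln1 rmorph0 mulr0 /cexpC /= expR0 cos0 sin0 mulr1 mulr0.
split; first exact: mulr_gt0.
by rewrite -ih /cpowR lnM ?posrE// rmorphD mulrDr cexpCD.
Qed.

Variables s tau : R.
Hypothesis s0 : s < 0.

Let g phi (y : R) : R := expR (s * ln (1 + `|y|)) * cos (tau * ln (1 + `|y|) + phi).

Let mg phi : measurable_fun setT (g phi).
Proof.
have ml : measurable_fun setT (fun y : R => ln (1 + `|y|)).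
  apply: measurableT_comp; first exact: measurable_ln.
  by apply: measurable_funD => //; exact: measurableT_comp.
apply: measurable_funM.
  by apply: measurableT_comp => //; exact: measurable_funM.
apply: measurableT_comp; first exact: (continuous_measurable_fun (@continuous_cos R)).
by apply: measurable_funD => //; exact: measurable_funM.
Qed.

Let g_le1 phi y : `|g phi y| <= 1.
Proof.
rewrite normrM mulr_ile1 ?cos_max// gtr0_norm ?expR_gt0// expR_le1.
by rewrite nmulr_rle0// ln_ge0// lerDl.
Qed.

Let gE y : cpowR (1 + `|y|) (Complex s tau) = Complex (g 0 y) (g (0 - pi / 2) y).
Proof. by rewrite cpowRE /g addr0 add0r cosBpihalf. Qed.

Lemma cexpectation_gamma_power :
  cexpectation P (fun t => cpowR (\prod_k (1 + `|Y k t|)) (Complex s tau)) =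
  \prod_k Complex (gamma_char (n k) (c k)%:num s tau 0)
                  (gamma_char (n k) (c k)%:num s tau (0 - pi / 2)).
Proof.
have mY k : measurable_fun setT (Y k : T -> R) by exact: measurable_funP.
transitivity (cexpectation P (fun t => \prod_k cpowR (1 + `|Y k t|) (Complex s tau))).
  congr cexpectation; apply/funext => t.
  by rewrite cpowR_prod// => k; rewrite ltr_pwDl.
rewrite (cexpectation_indep_prod mY indY).
  apply: eq_bigr => k _; rewrite /cexpectation /gamma_char; congr Complex.
  - transitivity (\int[P]_t g 0 (Y k t)); first by apply: eq_Rintegral => t _; rewrite gE.
    rewrite expectation_gamma_density//; apply: eq_Rintegral => u.
    by rewrite inE/= in_itv/= andbT => u0; rewrite /g gtr0_norm.
  - transitivity (\int[P]_t g (0 - pi / 2) (Y k t)).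
      by apply: eq_Rintegral => t _; rewrite gE.
    rewrite expectation_gamma_density//; apply: eq_Rintegral => u.
    by rewrite inE/= in_itv/= andbT => u0; rewrite /g gtr0_norm.
move=> k.
have mYk : measurable_fun setT ((Y k : T -> R) : g_sigma_algebraType
    (cylinders (fun k => (Y k : T -> R)) (pred1 k)) -> R).
  by apply: measurable_cylinder_fun => /=; rewrite eqxx.
split.
- have E : (fun t => complex.Re (cpowR (1 + `|Y k t|) (Complex s tau))) = g 0 \o Y k.
    by apply/funext => t; rewrite gE.
  by rewrite E; exact: measurableT_comp.
- have E : (fun t => complex.Im (cpowR (1 + `|Y k t|) (Complex s tau))) = g (0 - pi / 2) \o Y k.
    by apply/funext => t; rewrite gE.
  by rewrite E; exact: measurableT_comp.
- by exists 1 => t; rewrite gE /= !g_le1.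
Qed.

End gamma_expectation.

(** * Fourier inversion by Abel summation *)

Section real_fubini.
Context d1 d2 (T1 : measurableType d1) (T2 : measurableType d2) (R : realType).
Variables (m1 : {sigma_finite_measure set T1 -> \bar R}).
Variables (m2 : {sigma_finite_measure set T2 -> \bar R}).
Variables (D1 : set T1) (D2 : set T2).
Hypotheses (mD1 : measurable D1) (mD2 : measurable D2).
Variables (f : T1 * T2 -> R) (g1 : T1 -> R) (g2 : T2 -> R).
Hypothesis mf : measurable_fun setT f.
Hypothesis ig1 : m1.-integrable D1 (EFin \o g1).
Hypothesis ig2 : m2.-integrable D2 (EFin \o g2).
Hypothesis g10 : forall x, D1 x -> 0 <= g1 x.
Hypothesis g20 : forall x, D2 x -> 0 <= g2 x.
Hypothesis fg : forall x y, D1 x -> D2 y -> `|f (x, y)| <= g1 x * g2 y.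

(** Extension by zero outside the rectangle reduces Fubini on [D1] times [D2] to the whole product
    space, where the product majorant gives integrability. *)
Let F : T1 * T2 -> \bar R := (EFin \o f) \_ (D1 `*` D2).

Let mF : measurable_fun setT F.
Proof.
apply/(measurable_restrictT _ (measurableX mD1 mD2)).
by apply: measurable_funTS; exact/measurable_EFinP.
Qed.

Let F1 x : D1 x -> (fun y => F (x, y)) = (fun y => (f (x, y))%:E) \_ D2.
Proof.
move=> x1; apply/funext => y; rewrite /F !patchE.
by case: ifPn => [|]; rewrite ?inE ?notin_setE /=; case: ifPn => //; rewrite ?inE ?notin_setE/=; tauto.
Qed.

Let F2 y : D2 y -> (fun x => F (x, y)) = (fun x => (f (x, y))%:E) \_ D1.
Proof.
move=> y2; apply/funext => x; rewrite /F !patchE.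
by case: ifPn => [|]; rewrite ?inE ?notin_setE /=; case: ifPn => //; rewrite ?inE ?notin_setE/=; tauto.
Qed.

Let F0 x y : ~ D1 x \/ ~ D2 y -> F (x, y) = 0%E.
Proof. by move=> h; rewrite /F patchE; case: ifPn => //; rewrite inE => -[/= h1 h2]; tauto. Qed.

Let section1 x : D1 x -> m2.-integrable D2 (EFin \o (fun y => f (x, y))).
Proof.
move=> x1; have : m2.-integrable D2 (EFin \o (fun y => g1 x * g2 y)) by exact: integrable_EFinZ.
apply: le_integrable => //.
  apply/measurable_EFinP; apply: measurable_funTS.
  by apply: measurableT_comp => //; exact: measurable_pair1.
by move=> y y2; rewrite lee_fin; apply: le_trans (fg x1 y2) (ler_norm _).
Qed.

Let section2 y : D2 y -> m1.-integrable D1 (EFin \o (fun x => f (x, y))).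
Proof.
move=> y2; have : m1.-integrable D1 (EFin \o (fun x => g2 y * g1 x)) by exact: integrable_EFinZ.
apply: le_integrable => //.
  apply/measurable_EFinP; apply: measurable_funTS.
  by apply: measurableT_comp => //; exact: measurable_pair2.
by move=> x x1; rewrite lee_fin mulrC; apply: le_trans (fg x1 y2) (ler_norm _).
Qed.

Let iF : (m1 \x m2)%E.-integrable setT F.
Proof.
apply/(integrable12ltyP _ _ mF).
pose G2 := \int[m2]_(y in D2) g2 y.
have G20 : 0 <= G2 by apply: Rintegral_ge0.
have G2E : (\int[m2]_(y in D2) (g2 y)%:E = G2%:E)%E by rewrite fineK//; exact: integrable_fin_num.
apply: (@le_lt_trans _ _ (\int[m1]_(x in D1) (G2 * g1 x)%:E)%E).
  rewrite [leRHS]integral_mkcond; apply: ge0_le_integral => //.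
  - by move=> x _; exact: integral_ge0.
  - apply: (@measurable_fun_fubini_tonelli_F _ _ _ _ _ _ (fun z => `|F z|%E)) => //.
    exact: measurableT_comp.
  - apply/(measurable_restrictT _ mD1).
    by case/integrableP : (integrable_EFinZ mD1 G2 ig1).
  move=> x _; rewrite patchE; case: ifPn; rewrite ?inE ?notin_setE => x1; last first.
    by rewrite integral0_eq// => y _; rewrite F0 ?abse0//; left.
  rewrite mulrC EFinM -G2E -ge0_integralZl_EFin//; last 2 first.
  - by case/integrableP : ig2.
  - exact: g10.
  rewrite [leRHS]integral_mkcond; apply: ge0_le_integral => //.
  - apply: measurableT_comp => //; apply: measurableT_comp => //; exact: measurable_pair1.
  - apply/(measurable_restrictT _ mD2).
    by case/integrableP : (integrable_EFinZ mD2 (g1 x) ig2).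
  move=> y _; rewrite patchE; case: ifPn; rewrite ?inE ?notin_setE => y2; last first.
    by rewrite F0 ?abse0//; right.
  by rewrite /F patchE mem_set//= -EFinM lee_fin fg.
by have := integrable_EFinZ mD1 G2 ig1; move=> /integrable_fin_num => /(_ mD1); rewrite ltey_eq => ->.
Qed.

Lemma Rintegral_section_integrable :
  m1.-integrable D1 (EFin \o (fun x => \int[m2]_(y in D2) f (x, y))).
Proof.
apply/(integrable_mkcond _ mD1); have := integrable_fubini_F iF.
apply: eq_integrable => // x _; rewrite /fubini_F patchE.
case: ifPn; rewrite ?inE ?notin_setE => x1; last first.
  by rewrite integral0_eq// => y _; rewrite F0//; left.
by rewrite F1// -integral_mkcond /= fineK//; exact: (integrable_fin_num mD2 (section1 x1)).
Qed.

Lemma Rintegral_Fubini :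
  \int[m1]_(x in D1) (\int[m2]_(y in D2) f (x, y)) =
  \int[m2]_(y in D2) (\int[m1]_(x in D1) f (x, y)).
Proof.
rewrite /Rintegral; congr fine.
rewrite [LHS]integral_mkcond [RHS]integral_mkcond.
transitivity (\int[m1]_x \int[m2]_y F (x, y))%E.
  apply: eq_integral => x _; rewrite patchE.
  case: ifPn; rewrite ?inE ?notin_setE => x1; last first.
    by rewrite integral0_eq// => y _; rewrite F0//; left.
  by rewrite F1// -integral_mkcond /= fineK//; exact: (integrable_fin_num mD2 (section1 x1)).
rewrite (Fubini iF); apply: eq_integral => y _; rewrite patchE.
case: ifPn; rewrite ?inE ?notin_setE => y2; last first.
  by rewrite integral0_eq// => x _; rewrite F0//; right.
by rewrite F2// -integral_mkcond /= fineK//; exact: (integrable_fin_num mD1 (section2 y2)).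
Qed.

End real_fubini.

Section real_dominated_convergence.
Context d (T : measurableType d) (R : realType) (m : {measure set T -> \bar R}).
Variables (D : set T) (mD : measurable D).

Lemma Rdominated_cvg (f_ : (T -> R)^nat) (f g : T -> R) :
  (forall n, measurable_fun D (f_ n)) -> measurable_fun D f ->
  {ae m, forall x, D x -> f_ n x @[n --> \oo] --> f x} ->
  m.-integrable D (EFin \o g) -> (forall n x, D x -> `|f_ n x| <= g x) ->
  \int[m]_(x in D) f_ n x @[n --> \oo] --> \int[m]_(x in D) f x.
Proof.
move=> mf_ mf cf ig fg.
have [||||| if_ _ cvg] := @dominated_convergence _ _ R m D mD
  (fun n => EFin \o f_ n) (EFin \o f) (EFin \o g).
- by move=> n; exact/measurable_EFinP.
- exact/measurable_EFinP.
- by apply: filterS cf => x h Dx; apply: cvg_EFin; [exact: nearW|exact: h].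
- exact: ig.
- by apply: aeW => x n Dx; rewrite /= lee_fin fg.
rewrite /Rintegral; apply: fine_cvg; rewrite fineK; first exact: cvg.
exact: integrable_fin_num.
Qed.

End real_dominated_convergence.

(** * The Poisson kernel and its boundary limit *)

Section poisson_kernel.
Context {R : realType}.
Notation mu := (@lebesgue_measure R).
Implicit Types (a e tau theta L v y : R).

Lemma cvg_expRNMy a : 0 < a -> expR (- (a * v)) @[v --> +oo] --> (0 : R).
Proof. by move=> a0; have := cvg_expn_expR 0 a0; under eq_fun do rewrite expr0 mul1r. Qed.

Lemma integrable_expRNM a : 0 < a ->
  mu.-integrable `]0%R, +oo[ (EFin \o (fun v => expR (- (a * v)))).
Proof.
move=> a0; have := integrable_expn_expR 0 a0.
by apply: eq_integrable => // v _; rewrite /= expr0 mul1r.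
Qed.

Lemma integrable_expRNM_bounded a M (h : R -> R) : 0 < a ->
  (forall v, 0 < v -> {for v, continuous h}) -> (forall v, `|h v| <= M) ->
  mu.-integrable `]0%R, +oo[ (EFin \o (fun v => expR (- (a * v)) * h v)).
Proof.
move=> a0 ch hM.
have : mu.-integrable `]0%R, +oo[ (EFin \o (fun v => M * expR (- (a * v)))).
  by apply: integrable_EFinZ => //; exact: integrable_expRNM.
apply: le_integrable => //.
  apply/measurable_EFinP; apply: measurable_continuous_pos => v v0.
  by apply: cvgM; [exact: continuous_expRNM|exact: ch].
move=> v _; rewrite lee_fin normrM gtr0_norm ?expR_gt0// mulrC.
by apply: le_trans (ler_norm _); rewrite ler_wpM2r ?expR_ge0.
Qed.

Lemma cvg_bounded_expRNM a M (h : R -> R) : 0 < a -> (forall v, `|h v| <= M) ->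
  expR (- (a * v)) * h v @[v --> +oo] --> (0 : R).
Proof.
move=> a0 hM; apply/norm_cvg0P.
apply: (@squeeze_cvgr _ _ _ _ (cst 0) (fun v => M * expR (- (a * v)))).
- apply: nearW => v; rewrite normr_ge0/= normrM gtr0_norm ?expR_gt0// mulrC.
  by rewrite ler_wpM2r ?expR_ge0.
- exact: cvg_cst.
- rewrite -[X in _ --> X](mulr0 M); apply: cvgM; [exact: cvg_cst|exact: cvg_expRNMy].
Qed.

(** The value is the real part of exp (i theta) / (a - i tau). Read backwards, it writes the factor
    - 1 / s of the contour integrand as a Laplace integral of cosines. *)
Lemma Rintegral_expRNM_cos a tau theta : 0 < a ->
  \int[mu]_(v in `]0%R, +oo[) (expR (- (a * v)) * cos (tau * v + theta)) =
  (a * cos theta - tau * sin theta) / (a ^+ 2 + tau ^+ 2).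
Proof.
move=> a0; have d0 : a ^+ 2 + tau ^+ 2 != 0.
  by rewrite gt_eqF// ltr_wpDr ?sqr_ge0// exprn_gt0.
pose f v := expR (- (a * v)) * cos (tau * v + theta).
pose h v := (tau * sin (tau * v + theta) - a * cos (tau * v + theta)) / (a ^+ 2 + tau ^+ 2).
pose F v := expR (- (a * v)) * h v.
have cf v : 0 < v -> {for v, continuous f}.
  by move=> _; eapply der_continuous; rewrite /f; repeat derive_step.
have dF v : is_derive v (1 : R) F (f v).
  by rewrite /F /h /f; der; field.
have F0 : F v @[v --> 0^'+] --> F 0 by apply: cvg_at_right_filter; exact: der_continuous (dF 0).
have Fy : F v @[v --> +oo] --> (0 : R).
  apply: (@cvg_bounded_expRNM _ ((`|tau| + `|a|) / `|a ^+ 2 + tau ^+ 2|)) => // v.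
  rewrite /h normrM normfV ler_wpM2r// (le_trans (ler_normB _ _))// !normrM.
  by apply: lerD; rewrite ler_piMr// ?sin_max ?cos_max.
have intf : mu.-integrable `]0%R, +oo[ (EFin \o f).
  apply: (@integrable_expRNM_bounded _ 1) => // v; last exact: cos_max.
  by move=> _; eapply der_continuous; repeat derive_step.
have := FTC2_0y cf (fun v _ => dF v) F0 Fy intf.
rewrite /Rintegral => ->; rewrite /F /h !mulr0 oppr0 expR0 !add0r mul1r /=.
by rewrite -mulNr opprB.
Qed.

(** As e tends to 0, e / (e^2 + y^2) is pi times an approximate delta at y = 0. The limit is
    therefore pi exp (a L) when v = - L lies inside the half-line, and 0 when it lies outside. *)
Definition poisson_integral a e L : R :=
  \int[mu]_(v in `]0%R, +oo[) (expR (- (a * v)) * (e / (e ^+ 2 + (L + v) ^+ 2))).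

(** Writing the quotient as a Laplace integral in v gives a double integral that exp (- e tau) makes
    absolutely convergent. After the exchange, the integral of exp (- e tau) cos ((L + v) tau) over
    tau is the Poisson kernel. *)
Lemma poisson_integralE a e L : 0 < a -> 0 < e ->
  \int[mu]_(tau in `]0%R, +oo[) (expR (- (e * tau)) *
    ((a * cos (tau * L) - tau * sin (tau * L)) / (a ^+ 2 + tau ^+ 2))) =
  poisson_integral a e L.
Proof.
move=> a0 e0.
pose f (z : R * R) := expR (- (e * z.1)) * (expR (- (a * z.2)) * cos (z.1 * z.2 + z.1 * L)).
have mf : measurable_fun setT f.
  have mexp (s : R) : measurable_fun setT (fun x : R => expR (- (s * x))).
    exact: (continuous_measurable_fun (@continuous_expRNM R s)).
  apply: measurable_funM.
    by apply: (measurableT_comp (mexp e)); exact: measurable_fst.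
  apply: measurable_funM.
    by apply: (measurableT_comp (mexp a)); exact: measurable_snd.
  apply: measurableT_comp; first exact: (continuous_measurable_fun (@continuous_cos R)).
  apply: measurable_funD.
    by apply: measurable_funM; [exact: measurable_fst|exact: measurable_snd].
  by apply: measurable_funM => //; exact: measurable_fst.
transitivity (\int[mu]_(tau in `]0%R, +oo[) (\int[mu]_(v in `]0%R, +oo[) f (tau, v))).
  apply: eq_Rintegral => tau _; rewrite /f /= RintegralZl//.
    by rewrite Rintegral_expRNM_cos// [L * _]mulrC.
  apply: (@integrable_expRNM_bounded _ 1) => // v; last exact: cos_max.
  by move=> _; eapply der_continuous; repeat derive_step.
rewrite (@Rintegral_Fubini _ _ _ _ _ mu mu _ _ _ _ f
   (fun t => expR (- (e * t))) (fun v => expR (- (a * v))))//; last 3 first.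
- exact: integrable_expRNM.
- exact: integrable_expRNM.
- move=> x y _ _; rewrite /f /= normrM gtr0_norm ?expR_gt0// ler_wpM2l ?expR_ge0//.
  by rewrite normrM gtr0_norm ?expR_gt0// ler_piMr ?expR_ge0// cos_max.
apply: eq_Rintegral => v _; rewrite /f /=.
transitivity (\int[mu]_(t in `]0%R, +oo[) (expR (- (a * v)) * (expR (- (e * t)) * cos ((L + v) * t + 0)))).
  by apply: eq_Rintegral => t _; rewrite mulrCA; congr (_ * (_ * cos _)); ring.
rewrite RintegralZl//.
  by rewrite Rintegral_expRNM_cos// cos0 sin0 mulr1 mulr0 subr0.
apply: (@integrable_expRNM_bounded _ 1) => // t; last exact: cos_max.
by move=> _; eapply der_continuous; repeat derive_step.
Qed.

(** A primitive of the Poisson kernel, smoothing pi times the indicator of y > 0. *)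
Let step e y : R := atan (y / e) + pi / 2.

Let step_itv e y : 0 <= step e y <= pi.
Proof.
have := atan_gtNpi2 (y / e); have := atan_ltpi2 (y / e); rewrite /step => h1 h2.
by apply/andP; split; lra.
Qed.

Let step_norm e y : `|step e y| <= pi.
Proof. by have /andP[h1 h2] := step_itv e y; rewrite ger0_norm. Qed.

Let continuous_step e L v : {for v, continuous (fun v => step e (L + v))}.
Proof. by eapply der_continuous; rewrite /step; repeat derive_step. Qed.

Let derive_step_fun e L v : 0 < e ->
  is_derive v (1 : R) (fun v => step e (L + v)) (e / (e ^+ 2 + (L + v) ^+ 2)).
Proof.
move=> e0; rewrite /step; der.
rewrite (_ : 1 + ((L + v) / e) ^+ 2 = (e ^+ 2 + (L + v) ^+ 2) / e ^+ 2); last first.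
  by field; rewrite gt_eqF.
have den0 : e ^+ 2 + (L + v) ^+ 2 != 0.
  by rewrite gt_eqF// ltr_wpDr ?sqr_ge0// exprn_gt0.
by field; rewrite den0 gt_eqF.
Qed.

(** Near v = - L the kernels peak like 1 / |L + v| as e varies, which is not integrable. Moving the
    derivative onto the exponential leaves [step], bounded by pi uniformly in e, so that dominated
    convergence applies. *)
Let poisson_integral_parts a e L : 0 < a -> 0 < e ->
  poisson_integral a e L =
  a * \int[mu]_(v in `]0%R, +oo[) (expR (- (a * v)) * step e (L + v)) - step e L.
Proof.
move=> a0 e0.
have den0 v : 0 < e ^+ 2 + (L + v) ^+ 2 by rewrite ltr_wpDr ?sqr_ge0// exprn_gt0.
pose f1 v := expR (- (a * v)) * (e / (e ^+ 2 + (L + v) ^+ 2)).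
pose f2 v := expR (- (a * v)) * step e (L + v).
pose f v := f1 v - a * f2 v.
have dF v : is_derive v (1 : R) f2 (f v).
  have ds := derive_step_fun L v e0.
  by rewrite /f2 /f /f1; der; rewrite /f2; ring.
have i1 : mu.-integrable `]0%R, +oo[ (EFin \o f1).
  apply: (@integrable_expRNM_bounded _ e^-1) => // v.
    move=> _; have := den0 v => /lt0r_neq0 dv.
    by eapply der_continuous; repeat derive_step.
  rewrite ger0_norm ?divr_ge0 ?(ltW e0) ?(ltW (den0 v))// ler_pdivrMr//.
  have eN0 : e != 0 by rewrite gt_eqF.
  by rewrite mulrDr expr2 mulKf// lerDl mulr_ge0 ?sqr_ge0// invr_ge0 ltW.
have i2 : mu.-integrable `]0%R, +oo[ (EFin \o f2).
  by apply: (@integrable_expRNM_bounded _ pi) => // v _; exact: continuous_step.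
have i2' : mu.-integrable `]0%R, +oo[ (EFin \o (fun v => a * f2 v)) by exact: integrable_EFinZ.
have intf : mu.-integrable `]0%R, +oo[ (EFin \o f) by exact: (integrable_EFinB _ i1 i2').
have cf v : 0 < v -> {for v, continuous f}.
  move=> v0; have := den0 v => /lt0r_neq0 dv.
  by eapply der_continuous; rewrite /f /f1 /f2 /step; repeat derive_step.
have F0 : f2 v @[v --> 0^'+] --> f2 0 by apply: cvg_at_right_filter; exact: der_continuous (dF 0).
have Fy : f2 v @[v --> +oo] --> (0 : R) by exact: (@cvg_bounded_expRNM _ pi).
have E := FTC2_0y cf (fun v _ => dF v) F0 Fy intf.
have : \int[mu]_(v in `]0%R, +oo[) f v = 0 - f2 0 by rewrite /Rintegral E.
rewrite /f RintegralB// RintegralZl// /f2 mulr0 oppr0 expR0 mul1r addr0 sub0r.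
by move=> /eqP; rewrite subr_eq addrC => /eqP.
Qed.

Lemma Rintegral_expRNM a : 0 < a -> \int[mu]_(v in `]0%R, +oo[) expR (- (a * v)) = a^-1.
Proof.
move=> a0; have := @Rintegral_expRNM_cos a 0 0 a0.
have -> : (a * cos 0 - 0 * sin 0) / (a ^+ 2 + 0 ^+ 2) = a^-1.
  by rewrite cos0; field; rewrite gt_eqF.
move=> <-.
by apply: eq_Rintegral => v _; rewrite mul0r addr0 cos0 mulr1.
Qed.

Lemma laplace_cos_le a tau theta : 0 < a ->
  `|(a * cos theta - tau * sin theta) / (a ^+ 2 + tau ^+ 2)| <= a^-1.
Proof.
move=> a0; rewrite -(Rintegral_expRNM a0) -(Rintegral_expRNM_cos tau theta a0).
have i1 : mu.-integrable `]0%R, +oo[ (EFin \o (fun v => expR (- (a * v)) * cos (tau * v + theta))).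
  apply: (@integrable_expRNM_bounded _ 1) => // v; last exact: cos_max.
  by move=> _; eapply der_continuous; repeat derive_step.
apply: (le_trans (le_normr_Rintegral _ _)) => //; apply: le_Rintegral => //.
- by have := integrable_norm i1.
- exact: integrable_expRNM.
- by move=> v _; rewrite normrM gtr0_norm ?expR_gt0// ler_piMr ?expR_ge0// cos_max.
Qed.

Lemma poisson_integral_itv a e L : 0 < a -> 0 < e -> 0 <= poisson_integral a e L <= pi.
Proof.
move=> a0 e0; apply/andP; split.
  apply: Rintegral_ge0 => v _; rewrite mulr_ge0// divr_ge0 ?(ltW e0)//.
  by rewrite addr_ge0 ?sqr_ge0.
rewrite poisson_integral_parts//.
have /andP[s0 _] := step_itv e L.
apply: (@le_trans _ _ (a * \int[mu]_(v in `]0%R, +oo[) (expR (- (a * v)) * step e (L + v)))).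
  by rewrite gerBl.
rewrite (_ : pi = a * \int[mu]_(v in `]0%R, +oo[) (pi * expR (- (a * v)))); last first.
  by rewrite RintegralZl ?Rintegral_expRNM//; [field; rewrite gt_eqF|exact: integrable_expRNM].
rewrite ler_pM2l//; apply: le_Rintegral => //.
- by apply: (@integrable_expRNM_bounded _ pi) => // v _; exact: continuous_step.
- by apply: integrable_EFinZ => //; exact: integrable_expRNM.
- move=> v _; rewrite mulrC ler_wpM2r ?expR_ge0//.
  by have /andP[] := step_itv e (L + v).
Qed.

Let cvg_step y : y != 0 -> step (harmonic n) y @[n --> \oo] --> (if 0 < y then pi else 0).
Proof.
have pos z : 0 < z -> atan (z / harmonic n) @[n --> \oo] --> (pi / 2 : R).
  move=> z0; apply: (cvg_comp _ _ _ (@cvgy_atan R)).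
  under eq_fun do rewrite /harmonic invrK.
  suff : (z * n.+1%:R : R) @[n --> \oo] --> +oo by [].
  apply/cvgryPge => A; near=> n.
  rewrite mulrC -ler_pdivrMr//; apply: (@le_trans _ _ n%:R); last by rewrite ler_nat.
  by near: n; exact: nbhs_infty_ger.
move=> y0; rewrite /step; have [yp|yn] := ltP 0 y.
  have E : pi = pi / 2 + pi / 2 :> R by field.
  rewrite [X in _ --> X]E.
  by apply: cvgD; [exact: pos|exact: cvg_cst].
rewrite -[X in _ --> X](addNr (pi / 2)); apply: cvgD; last exact: cvg_cst.
have -> : (fun n => atan (y / harmonic n)) = (fun n => - atan (- y / harmonic n)).
  by apply/funext => n; rewrite mulNr atanN opprK.
by apply: cvgN; apply: pos; rewrite oppr_gt0 lt_neqAle y0.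
Unshelve. all: by end_near. Qed.

Let Rintegral_expRNM_ray a z : 0 < a -> 0 <= z ->
  \int[mu]_(v in `]z, +oo[) expR (- (a * v)) = expR (- (a * z)) / a.
Proof.
move=> a0 z0; pose F v := - (expR (- (a * v)) / a).
have dF v : is_derive v (1 : R) F (expR (- (a * v))).
  by rewrite /F; der; field; rewrite gt_eqF.
rewrite Rintegral_itv_obnd_cbnd; last first.
  apply: (@integrableS _ _ _ mu `]0%R, +oo[); last exact: integrable_expRNM.
  - exact: measurable_itv.
  - exact: measurable_itv.
  - by move=> v; rewrite /= !in_itv/= !andbT; exact: le_lt_trans.
rewrite (@Rintegral_ge0_continuous_FTC2y _ _ F z 0).
- by rewrite /F opprK add0r.
- by [].
- by apply: continuous_subspaceT => v; exact: continuous_expRNM.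
- rewrite -[X in _ --> X](oppr0 R) -(mul0r a^-1); apply: cvgN; apply: cvgM; last exact: cvg_cst.
  exact: cvg_expRNMy.
- by move=> v _; case: (dF v).
- by apply: cvg_at_right_filter; exact: der_continuous (dF z).
- by move=> v _; rewrite derive1E; case: (dF v).
Qed.

Lemma cvg_poisson_integral a L : 0 < a -> L != 0 ->
  poisson_integral a (harmonic n) L @[n --> \oo] --> (if L < 0 then pi * expR (a * L) else 0).
Proof.
move=> a0 L0.
under eq_fun do rewrite (poisson_integral_parts _ a0 (harmonic_gt0 _)).
pose f v := expR (- (a * v)) * (pi * \1_(`]- L, +oo[) v).
have cI : \int[mu]_(v in `]0%R, +oo[) (expR (- (a * v)) * step (harmonic n) (L + v)) @[n --> \oo]
    --> \int[mu]_(v in `]0%R, +oo[) f v.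
  apply: (@Rdominated_cvg _ _ _ mu _ _ _ _ (fun v => pi * expR (- (a * v)))) => //.
  - move=> n; apply: measurable_continuous_pos => v _.
    by apply: cvgM; [exact: continuous_expRNM|exact: continuous_step].
  - apply: measurable_funTS; apply: measurable_funM.
      exact: (continuous_measurable_fun (@continuous_expRNM R a)).
    by apply: measurable_funM => //; exact: (@measurable_indic _ (measurableTypeR R)).
  (* At v = - L the smoothed step stays at pi / 2; this single point is the exceptional null set. *)
  - exists [set - L]; split; [exact: measurable_set1|exact: lebesgue_measure_set1|].
    move=> v /= /not_implyP[v0 h]; apply: contrapT => vL; apply: h.
    apply: cvgM; first exact: cvg_cst.
    have Lv : L + v != 0 by rewrite addrC addr_eq0; exact/eqP.
    have := cvg_step Lv; rewrite indicE; congr (_ --> _).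
    have [h|h] := ltP 0 (L + v).
      by rewrite mem_set ?mulr1//= in_itv/= andbT -subr_gt0 opprK addrC.
    by rewrite memNset ?mulr0//= in_itv/= andbT -subr_gt0 opprK addrC => /lt_geF; rewrite h.
  - by apply: integrable_EFinZ => //; exact: integrable_expRNM.
  - move=> n v _; rewrite normrM gtr0_norm ?expR_gt0// mulrC ler_wpM2r ?expR_ge0//.
pose z := Num.max 0 (- L).
have IE : \int[mu]_(v in `]0%R, +oo[) f v = pi * (expR (- (a * z)) / a).
  transitivity (\int[mu]_(v in `]0%R, +oo[) ((fun v => pi * expR (- (a * v))) \_ `]- L, +oo[) v).
    apply: eq_Rintegral => v _; rewrite /f patchE indicE.
    by case: ifPn => _; rewrite ?mulr1 ?mulr0// mulrC.
  rewrite -Rintegral_mkcondr.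
  have -> : `]0%R, +oo[%classic `&` `]- L, +oo[%classic = `]z, +oo[%classic.
    by apply/seteqP; split => v; rewrite /= !in_itv/= !andbT /z gt_max => /andP.
  rewrite RintegralZl ?Rintegral_expRNM_ray// ?le_max ?lexx//.
  apply: (@integrableS _ _ _ mu `]0%R, +oo[); last exact: integrable_expRNM.
  - exact: measurable_itv.
  - exact: measurable_itv.
  - by move=> v; rewrite /= !in_itv/= !andbT /z gt_max => /andP[].
(* For L < 0 the integral term gives pi exp (a L) and the boundary term 0; for L > 0 both give pi
   and cancel. *)
rewrite (_ : (if L < 0 then pi * expR (a * L) else 0) =
    a * \int[mu]_(v in `]0%R, +oo[) f v - (if 0 < L then pi else 0)); last first.
  rewrite IE /z; have aN0 : a != 0 by rewrite gt_eqF.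
  have [Ln|Lp|/eqP] := ltgtP L 0; last by rewrite (negbTE L0).
  - rewrite max_r ?oppr_ge0 ?ltW// mulrN opprK subr0; field.
    by [].
  - rewrite max_l ?oppr_le0 ?ltW// mulr0 oppr0 expR0; field.
    by [].
by apply: cvgB; [apply: cvgM => //; exact: cvg_cst|exact: cvg_step].
Qed.

End poisson_kernel.

(** * Removing the Abel factor *)

Section inversion.
Context d (T : measurableType d) (R : realType) (P : probability T R).
Notation mu := (@lebesgue_measure R).

Lemma integrable_inv_sqr : mu.-integrable `]0%R, +oo[ (EFin \o (fun x : R => (1 + x) ^- 2)).
Proof.
have cf (x : R) : 0 < x -> {for x, continuous (fun x : R => (1 + x) ^- 2)}.
  move=> x0; have x1 : (1 + x) ^+ 2 != 0 by rewrite expf_neq0// gt_eqF// addr_gt0.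
  by eapply der_continuous; repeat derive_step.
apply/integrableP; split.
  by apply/measurable_EFinP; exact: measurable_continuous_pos.
under eq_integral do rewrite /= ger0_norm ?invr_ge0 ?sqr_ge0//.
pose F (x : R) := - (1 + x)^-1.
have dF (x : R) : 0 <= x -> is_derive x (1 : R) F ((1 + x) ^- 2).
  move=> x0; have x1 : 1 + x != 0 by rewrite gt_eqF// ltr_pwDl.
  by rewrite /F; der => //; field.
have F0 : F x @[x --> 0^'+] --> F 0.
  by apply: cvg_at_right_filter; exact: der_continuous (dF 0 (lexx _)).
have Fy : F x @[x --> +oo] --> (0 : R).
  rewrite -[X in _ --> X](oppr0 R); apply: cvgN; apply/gtr0_cvgV0.
    near=> x; have x0 : 0 < x by near: x; exact: nbhs_pinfty_gt.
    by rewrite addr_gt0.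
  apply/cvgryPge => A; near=> x.
  apply: (@le_trans _ _ x); last by rewrite lerDr.
  by near: x; apply: nbhs_pinfty_ge; exact: num_real.
rewrite (ge0_FTC2_0y cf (fun x x0 => dF x (ltW x0)) F0 Fy) ?ltry// => x _.
by rewrite invr_ge0 sqr_ge0.
Unshelve. all: by end_near. Qed.

Variables (a : R) (L : T -> R) (B M : R).
Hypotheses (a0 : 0 < a) (mL : measurable_fun setT L).
Hypothesis LB : forall t, expR (- (a * L t)) <= B.
Hypothesis L0 : P (L @^-1` [set 0]) = 0%E.

(** The real part of - exp (s y) / s at s = - a + i tau. *)
Definition inversion_kernel (tau y : R) : R :=
  expR (- (a * y)) * ((a * cos (tau * y) - tau * sin (tau * y)) / (a ^+ 2 + tau ^+ 2)).

Let Phi (tau : R) : R := \int[P]_t inversion_kernel tau (L t).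

Hypothesis Phi_decay : forall tau, 0 < tau -> `|Phi tau| <= M * (1 + tau) ^- 2.

Let B0 : 0 <= B.
Proof.
have [[t _]|T0] := pselect (exists t : T, True); last first.
  exfalso; have := probability_setT P.
  rewrite (_ : [set: T] = set0) ?measure0; last by apply/seteqP; split => // t _; apply: T0; exists t.
  by move=> /eqP; rewrite eqe eq_sym oner_eq0.
exact: le_trans (expR_ge0 _) (LB t).
Qed.

Let f e (z : R * T) : R := expR (- (e * z.1)) * inversion_kernel z.1 (L z.2).

Let mf e : measurable_fun setT (f e).
Proof.
have mexp (s : R) : measurable_fun setT (fun x : R => expR (- (s * x))).
  exact: (continuous_measurable_fun (@continuous_expRNM R s)).
have m1 : measurable_fun setT (fun z : R * T => z.1) by exact: measurable_fst.
have m2 : measurable_fun setT (fun z : R * T => L z.2).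
  by apply: (measurableT_comp mL); exact: measurable_snd.
have m12 : measurable_fun setT (fun z : R * T => z.1 * L z.2) by exact: measurable_funM.
apply: measurable_funM; first exact: (measurableT_comp (mexp e)).
apply: measurable_funM; first exact: (measurableT_comp (mexp a)).
apply: measurable_funM.
  apply: measurable_funB.
    apply: measurable_funM => //; apply: measurableT_comp m12.
    exact: (continuous_measurable_fun (@continuous_cos R)).
  apply: measurable_funM => //; apply: measurableT_comp m12.
  exact: (continuous_measurable_fun (@continuous_sin R)).
apply: (measurableT_comp (f := fun x : R => (a ^+ 2 + x ^+ 2)^-1)) m1.
apply: continuous_measurable_fun => x.
have x0 : a ^+ 2 + x ^+ 2 != 0 by rewrite gt_eqF// ltr_wpDr ?sqr_ge0// exprn_gt0.
by eapply der_continuous; repeat derive_step.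
Qed.

Let f_le e (x : R) (t : T) : `|f e (x, t)| <= expR (- (e * x)) * (B / a).
Proof.
rewrite /f normrM gtr0_norm ?expR_gt0// ler_wpM2l ?expR_ge0//= normrM.
by apply: ler_pM => //; [rewrite gtr0_norm ?expR_gt0|exact: laplace_cos_le].
Qed.

Let iP (r : R) : P.-integrable setT (EFin \o (fun t : T => r)).
Proof. by apply: (@integrable_bounded _ _ _ P _ `|r|) => //; exact: measurable_cst. Qed.

Let kernel_integrable tau : P.-integrable setT (EFin \o (fun t => inversion_kernel tau (L t))).
Proof.
apply: (@integrable_bounded _ _ _ P _ (B / a)).
  have -> : (fun t => inversion_kernel tau (L t)) = (fun t => f 0 (tau, t)).
    by apply/funext => t; rewrite /f /= mul0r oppr0 expR0 mul1r.
  exact: (measurableT_comp (mf 0) (measurable_pair1 tau)).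
move=> t; have := f_le 0 tau t.
by rewrite /f /= mul0r oppr0 expR0 !mul1r.
Qed.

Let PhiE e : 0 < e -> (fun x => \int[P]_t f e (x, t)) = (fun x => expR (- (e * x)) * Phi x).
Proof.
move=> e0; apply/funext => x; rewrite /f /= RintegralZl//; exact: kernel_integrable.
Qed.

Let iPhi e : 0 < e -> mu.-integrable `]0%R, +oo[ (EFin \o (fun x => expR (- (e * x)) * Phi x)).
Proof.
move=> e0; rewrite -(PhiE e0).
apply: (@Rintegral_section_integrable _ _ _ _ _ mu P _ _ (measurable_itv _) measurableT
  (f e) (fun x => expR (- (e * x))) (fun=> B / a)) => //.
- exact: mf.
- exact: integrable_expRNM.
- by move=> t _; rewrite divr_ge0// ltW.
Qed.

Let mPhi : measurable_fun (`]0%R, +oo[%classic : set R) Phi.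
Proof.
(* Measurability of [Phi] is obtained from Fubini for the regularized integrand at e = 1, by
   multiplying exp (x) back. *)
have -> : Phi = (fun x => expR (- ((- 1) * x)) * (expR (- (1 * x)) * Phi x)).
  by apply/funext => x; rewrite mulrA -expRD mulN1r mul1r opprK subrr expR0 mul1r.
apply: measurable_funM.
  by apply: measurable_funTS; exact: (continuous_measurable_fun (@continuous_expRNM R _)).
by case/integrableP: (iPhi ltr01) => /measurable_EFinP.
Qed.

Let major_integrable : mu.-integrable `]0%R, +oo[ (EFin \o (fun x : R => M * (1 + x) ^- 2)).
Proof. by apply: integrable_EFinZ => //; exact: integrable_inv_sqr. Qed.

Let section_integral e t : 0 < e ->
  \int[mu]_(x in `]0%R, +oo[) f e (x, t) = expR (- (a * L t)) * poisson_integral a e (L t).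
Proof.
move=> e0; rewrite -(poisson_integralE (L t) a0 e0) -RintegralZl//; last first.
  apply: (@integrable_expRNM_bounded _ _ a^-1) => // [x x0|x]; last exact: laplace_cos_le.
  have den : a ^+ 2 + x ^+ 2 != 0 by rewrite gt_eqF// ltr_wpDr ?sqr_ge0// exprn_gt0.
  by eapply der_continuous; repeat derive_step.
by apply: eq_Rintegral => x _; rewrite /f /inversion_kernel /= mulrCA.
Qed.

Let regularized e : 0 < e ->
  \int[mu]_(x in `]0%R, +oo[) (expR (- (e * x)) * Phi x) =
  \int[P]_t (expR (- (a * L t)) * poisson_integral a e (L t)).
Proof.
move=> e0; transitivity (\int[mu]_(x in `]0%R, +oo[) (\int[P]_t f e (x, t))).
  by apply: eq_Rintegral => x _; rewrite -(congr1 (fun g => g x) (PhiE e0)).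
rewrite (@Rintegral_Fubini _ _ _ _ _ mu P _ _ (measurable_itv _) measurableT
  (f e) (fun x => expR (- (e * x))) (fun=> B / a))//.
- by apply: eq_Rintegral => t _; exact: section_integral.
- exact: mf.
- exact: integrable_expRNM.
- by move=> t _; rewrite divr_ge0// ltW.
Qed.

Let measurable_regularized e : 0 < e ->
  measurable_fun setT (fun t => expR (- (a * L t)) * poisson_integral a e (L t)).
Proof.
move=> e0; rewrite -(funext (fun t => section_integral t e0)).
have mfs : measurable_fun setT (fun z : T * R => f e (z.2, z.1)).
  by apply: (measurableT_comp (mf e)); exact: measurable_swap.
suff /integrableP[/measurable_EFinP] : P.-integrable setT
    (EFin \o (fun t => \int[mu]_(x in `]0%R, +oo[) f e (x, t))) by [].
apply: (@Rintegral_section_integrable _ _ _ _ _ P mu _ _ measurableT (measurable_itv _)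
  (fun z => f e (z.2, z.1)) (fun=> B / a) (fun x => expR (- (e * x)))) => //.
- exact: integrable_expRNM.
- by move=> t _; rewrite divr_ge0// ltW.
- by move=> t x _ _; rewrite mulrC.
Qed.

(** The regularized frequency integral equals an expectation of [poisson_integral], and e tends to 0
    along 1 / (n + 1) on both sides. The assumed decay of [Phi] dominates the first, the constant B
    pi the second. The limit pi exp (a L) on L < 0 cancels the weight exp (- a L) and leaves a
    probability. *)
Theorem fourier_inversion :
  mu.-integrable `]0%R, +oo[ (EFin \o Phi) /\
  \int[mu]_(x in `]0%R, +oo[) Phi x = pi * fine (P (L @^-1` `]-oo, 0[)).
Proof.
split.
  apply: le_integrable major_integrable => //; first exact/measurable_EFinP.
  move=> x; rewrite /= in_itv/= andbT => x0; rewrite lee_fin.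
  by apply: le_trans (ler_norm _); exact: Phi_decay.
have mN : measurable (L @^-1` `]-oo, 0[) by rewrite -[X in measurable X]setTI; exact: mL.
have c1 : \int[mu]_(x in `]0%R, +oo[) (expR (- (harmonic n * x)) * Phi x) @[n --> \oo] -->
    \int[mu]_(x in `]0%R, +oo[) Phi x.
  apply: (@Rdominated_cvg _ _ _ mu _ _ _ _ (fun x : R => M * (1 + x) ^- 2)) => //.
  - move=> n; have /integrableP[/measurable_EFinP] := iPhi (@harmonic_gt0 R n).
    by [].
  - apply: aeW => x _; rewrite -[X in _ --> X]mul1r; apply: cvgM; last exact: cvg_cst.
    have : expR (- (x * harmonic n)) @[n --> \oo] --> expR (- (x * 0)).
      apply: (cvg_comp harmonic (fun y : R => expR (- (x * y))) (@cvg_harmonic R)).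
      exact: continuous_expRNM.
    by rewrite mulr0 oppr0 expR0; under eq_fun do rewrite mulrC.
  - move=> n x; rewrite /= in_itv/= andbT => x0.
    rewrite normrM gtr0_norm ?expR_gt0//; apply: le_trans (Phi_decay x0).
    by rewrite ler_piMl// expR_le1 oppr_le0 mulr_ge0 ?harmonic_ge0// ltW.
have c2 : \int[P]_t (expR (- (a * L t)) * poisson_integral a (harmonic n) (L t)) @[n --> \oo] -->
    \int[P]_t (pi * \1_(L @^-1` `]-oo, 0[) t).
  apply: (@Rdominated_cvg _ _ _ P _ _ _ _ (fun=> B * pi)) => //.
  - by move=> n; apply: measurable_regularized; exact: harmonic_gt0.
  - by apply: measurable_funM.
  (* The Poisson limit is available for L nonzero, so the null event L = 0 is set aside. *)
  - exists (L @^-1` [set 0]); split => //.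
      by rewrite -[X in measurable X]setTI; exact: mL.
    move=> t /= /not_implyP[_ h]; apply: contrapT => /eqP Lt0; apply: h.
    rewrite [X in _ --> X](_ : _ = expR (- (a * L t)) * (if L t < 0 then pi * expR (a * L t) else 0)).
      by apply: cvgM; [exact: cvg_cst|exact: cvg_poisson_integral].
    rewrite indicE; case: ifPn => Ln.
      by rewrite mem_set//= ?in_itv//= mulr1 mulrCA -expRD addNr expR0 mulr1.
    by rewrite memNset ?mulr0//= in_itv/= => /idP; rewrite (negbTE Ln).
  - move=> n t _; rewrite normrM gtr0_norm ?expR_gt0//.
    have /andP[h1 h2] := poisson_integral_itv (L t) a0 (@harmonic_gt0 R n).
    by rewrite ger0_norm// ler_pM.
have E : (fun n => \int[mu]_(x in `]0%R, +oo[) (expR (- (harmonic n * x)) * Phi x)) =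
    (fun n => \int[P]_t (expR (- (a * L t)) * poisson_integral a (harmonic n) (L t))).
  by apply/funext => n; apply: regularized; exact: harmonic_gt0.
rewrite E in c1; have /= -> := cvg_unique (@Rhausdorff R) c1 c2.
rewrite RintegralZl//; last first.
  apply: (@integrable_bounded _ _ _ P _ 1) => // t.
  by rewrite indicE; case: (_ \in _); rewrite ?normr1 ?normr0.
congr (_ * _); rewrite /Rintegral; congr fine.
by rewrite integral_indic// setIT.
Qed.

End inversion.

(** * Parity of integrands, measurability of averages, absence of atoms *)

Section parity.
Context {R : realType}.
Notation mu := (@lebesgue_measure R).
Implicit Types (f : R -> R).

Let ge0_integral_reflect (h : R -> \bar R) : measurable_fun setT h -> (forall x, 0 <= h x)%E ->
  (\int[mu]_(x in `]-oo, 0%R]) h (- x)%R = \int[mu]_(x in `]0%R, +oo[) h x)%E.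
Proof.
move=> mh h0; rewrite -ge0_integration_by_substitution0// integral_itv_obnd_cbnd//.
exact: measurable_funTS.
Qed.

Let ge0_integral_halves (h : R -> \bar R) : measurable_fun setT h -> (forall x, 0 <= h x)%E ->
  (\int[mu]_x h x = \int[mu]_(x in `]0%R, +oo[) h (- x)%R + \int[mu]_(x in `]0%R, +oo[) h x)%E.
Proof.
move=> mh h0; rewrite -(ge0_integral_reflect (h := fun x => h (- x))) //; last first.
  exact: measurableT_comp.
have -> : (\int[mu]_(x in `]-oo, 0%R]) h (- - x)%R = \int[mu]_(x in `]-oo, 0%R]) h x)%E.
  by apply: eq_integral => x _; rewrite opprK.
rewrite -ge0_integral_setU//.
- congr (integral _ _ _); apply/seteqP; split => // x _; rewrite /= !in_itv/= andbT.
  by case: (leP x 0); [left|right].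
- exact: measurable_funTS.
- by apply/disj_setPLR => x /=; rewrite !in_itv/= andbT => hx; apply/negP; rewrite -leNgt.
Qed.

(** The positive and negative parts are exchanged by reflection. If their common integral is
    infinite, the difference is infinite and [fine] returns 0, so the imaginary part of the contour
    integral calls for no decay estimate. *)
Lemma Rintegral_odd f : measurable_fun setT f -> (forall x, f (- x) = - f x) ->
  \int[mu]_x f x = 0.
Proof.
move=> mf fN; rewrite /Rintegral integralE.
have mp : measurable_fun setT ((EFin \o f)^\+)%E by apply: measurable_funepos; exact/measurable_EFinP.
have mn : measurable_fun setT ((EFin \o f)^\-)%E by apply: measurable_funeneg; exact/measurable_EFinP.
have E : (\int[mu]_x ((EFin \o f)^\- x) = \int[mu]_x ((EFin \o f)^\+ x))%E.
  rewrite !ge0_integral_halves// addeC; congr (_ + _)%E.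
    by apply: eq_integral => x _; rewrite funeposE funenegE /= fN -?EFinN ?opprK.
  by apply: eq_integral => x _; rewrite funeposE funenegE /= fN -?EFinN ?opprK.
rewrite E; case: (integral _ _ _) => //= r.
by rewrite subrr.
Qed.

Lemma Rintegral_even f : measurable_fun setT f -> (forall x, f (- x) = f x) ->
  mu.-integrable `]0%R, +oo[ (EFin \o f) ->
  \int[mu]_x f x = 2 * \int[mu]_(x in `]0%R, +oo[) f x.
Proof.
move=> mf fN intf; rewrite /Rintegral integralE [in RHS]integralE.
have mp : measurable_fun setT ((EFin \o f)^\+)%E by apply: measurable_funepos; exact/measurable_EFinP.
have mn : measurable_fun setT ((EFin \o f)^\-)%E by apply: measurable_funeneg; exact/measurable_EFinP.
rewrite !ge0_integral_halves//.
have ip : (\int[mu]_(x in `]0%R, +oo[) ((EFin \o f)^\+ x))%E \is a fin_num.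
  by apply: integrable_fin_num => //; exact: integrable_funepos.
have in_ : (\int[mu]_(x in `]0%R, +oo[) ((EFin \o f)^\- x))%E \is a fin_num.
  by apply: integrable_fin_num => //; exact: integrable_funeneg.
have -> : (\int[mu]_(x in `]0%R, +oo[) ((EFin \o f)^\+ (- x)%R) = \int[mu]_(x in `]0%R, +oo[) ((EFin \o f)^\+ x))%E.
  by apply: eq_integral => x _; rewrite !funeposE /= fN.
have -> : (\int[mu]_(x in `]0%R, +oo[) ((EFin \o f)^\- (- x)%R) = \int[mu]_(x in `]0%R, +oo[) ((EFin \o f)^\- x))%E.
  by apply: eq_integral => x _; rewrite !funenegE /= fN.
move: ip in_; case: (integral _ _ _) => // p _; case: (integral _ _ _) => // q _ /=.
by ring.
Qed.

End parity.

Section measurable_expectation.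
Context d1 d2 (T1 : measurableType d1) (T2 : measurableType d2) (R : realType).
Variable P : probability T2 R.

(** Adding the bound [M] makes the integrand nonnegative, where Tonelli gives measurability of the
    section integral; [M] is then subtracted. *)
Lemma measurable_Rintegral_section (f : T1 * T2 -> R) (M : R) : measurable_fun setT f ->
  (forall z, `|f z| <= M) -> measurable_fun setT (fun x => \int[P]_y f (x, y)).
Proof.
move=> mf fM.
have mfx x : measurable_fun setT (fun y => f (x, y)).
  by apply: measurableT_comp => //; exact: measurable_pair1.
have ifx x : P.-integrable setT (EFin \o (fun y => f (x, y))).
  by apply: (@integrable_bounded _ _ _ P _ M).
have iM : P.-integrable setT (EFin \o (fun y : T2 => M)).
  by apply: (@integrable_bounded _ _ _ P _ `|M|) => //; exact: measurable_cst.
have -> : (fun x => \int[P]_y f (x, y)) = (fun x => \int[P]_y (f (x, y) + M) - M).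
  by apply/funext => x; rewrite RintegralD// Rintegral_probability_cst addrK.
apply: measurable_funB => //; apply: measurableT_comp => //.
apply: (@measurable_fun_fubini_tonelli_F _ _ _ _ _ P (fun z => (f z + M)%:E)).
  by apply/measurable_EFinP; exact: measurable_funD.
by move=> z; rewrite lee_fin -[M]opprK subr_ge0; have := fM z; rewrite ler_norml => /andP[].
Qed.

End measurable_expectation.

Section absolutely_continuous.
Context d (T : measurableType d) (R : realType) (P : probability T R).
Variables (K : nat) (c : 'I_K -> {posnum R}) (n : 'I_K -> nat).
Variable Y : 'I_K -> {RV P >-> R}.
Hypothesis indY : mutually_independent P (fun k => (Y k : T -> R)).
Hypothesis Ylaw : forall k, gamma_distributed P (Y k) (n k).+1%:R (c k)%:num.

Let mY k : measurable_fun setT (Y k : T -> R).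
Proof. exact: measurable_funP. Qed.

Lemma gamma_norm_atomless k (r : R) : P [set t | `|Y k t| = r] = 0%E.
Proof.
have mr : measurable ([set r; - r] : set R) by exact: measurableU.
have mn : measurable_fun setT (fun t => `|Y k t|) by exact: measurableT_comp.
apply/eqP; rewrite eq_le measure_ge0 andbT.
apply: (@le_trans _ _ (P (Y k @^-1` [set r; - r]))).
  apply: le_measure; rewrite ?inE.
  - by rewrite -[X in measurable X]setTI; exact: (mn measurableT _ (measurable_set1 r)).
  - by rewrite -[X in measurable X]setTI; exact: mY.
  move=> t /= <-; have [Y0|Y0] := leP 0 (Y k t); [left|right].
    by rewrite /= ger0_norm.
  by rewrite /= ltr0_norm// opprK.
rewrite Ylaw// null_set_integral//.
  by apply/measurable_EFinP; apply: measurable_funTS; exact: measurable_gamma_pdf.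
rewrite measureU0//; exact: lebesgue_measure_set1.
Qed.

(* Given the other factors, the law of [Y k0] still has a density. *)
Lemma gamma_prod_atomless (k0 : 'I_K) (x : R) : P [set t | \prod_(k < K) (1 + `|Y k t|) = x] = 0%E.
Proof.
set A := [set t | _].
pose Z t := \prod_(k < K) (if k == k0 then 1 else 1 + `|Y k t|).
have mZ : measurable_fun setT (Z : g_sigma_algebraType (cylinders (fun k => (Y k : T -> R)) (predC1 k0)) -> R).
  apply: measurable_prod => k _; have [//|kk0] := eqVneq k k0; apply: measurable_funD => //.
  by apply: measurableT_comp => //; exact: measurable_cylinder_fun.
have Z0 t : 0 < Z t by apply: prodr_gt0 => k _; case: ifPn => //; rewrite ltr_pwDl.
have ZE t : \prod_(k < K) (1 + `|Y k t|) = (1 + `|Y k0 t|) * Z t.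
  rewrite /Z (bigD1 k0)//= [in RHS](bigD1 k0)//= eqxx mul1r; congr (_ * _).
  by apply: eq_bigr => k /negbTE ->.
have m2 : measurable_fun setT ((Y k0 : T -> R) : g_sigma_algebraType
    (cylinders (fun k => (Y k : T -> R)) (predC (predC1 k0))) -> R).
  by apply: measurable_cylinder_fun => /=; rewrite negbK.
pose F (z : g_sigma_algebraType (cylinders (fun k => (Y k : T -> R)) (predC1 k0)) *
    g_sigma_algebraType (cylinders (fun k => (Y k : T -> R)) (predC (predC1 k0)))) : \bar R :=
  (\1_([set x] : set R) ((1 + `|Y k0 z.2|) * Z z.1))%:E.
have mA : measurable A.
  have mprod : measurable_fun setT (fun t => \prod_(k < K) (1 + `|Y k t|)).
    by apply: measurable_prod => k _; apply: measurable_funD => //; exact: measurableT_comp.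
  by rewrite -[X in measurable X]setTI; exact: (mprod measurableT _ (measurable_set1 x)).
transitivity (\int[P]_t F (t, t))%E.
  rewrite -[A]setIT -integral_indic//; apply: eq_integral => t _.
  by rewrite /F !indicE /= -ZE.
rewrite (decouple_family mY indY (J := predC1 k0) (F := F)).
- apply: integral0_eq => t _.
  rewrite -(gamma_norm_atomless k0 (x / Z t - 1)) -[in RHS](setIT [set u | _]) -integral_indic//; last first.
    have mn : measurable_fun setT (fun t => `|Y k0 t|) by exact: measurableT_comp.
    by rewrite -[X in measurable X]setTI; exact: (mn measurableT _ (measurable_set1 _)).
  apply: eq_integral => u _; rewrite /F !indicE /=; congr (nat_of_bool _)%:R%:E.
  apply/idP/idP; rewrite !inE/= => h.
    by rewrite -h mulfK ?gt_eqF// addrC addKr.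
  by rewrite h addrCA subrr addr0 divfK// gt_eqF.
- apply/measurable_EFinP; apply: measurableT_comp => //.
  apply: measurable_funM; last exact: (measurableT_comp mZ measurable_fst).
  apply: measurable_funD => //; apply: measurableT_comp => //.
  exact: (measurableT_comp m2 measurable_snd).
- by move=> z; rewrite lee_fin.
Qed.

End absolutely_continuous.

(** * The Mellin-Barnes integral *)

Section fox_integrand.
Context {R : realType}.
Implicit Types (x y a tau : R) (w : R[i]).

Lemma cexpC0 : cexpC (0 : R[i]) = 1.
Proof. by rewrite /cexpC /= expR0 cos0 sin0 mulr1 mulr0. Qed.

Lemma cpowRD x w1 w2 : cpowR x (w1 + w2) = cpowR x w1 * cpowR x w2.
Proof. by rewrite /cpowR mulrDl cexpCD. Qed.

Lemma cpowRN x w : cpowR x w * cpowR x (- w) = 1.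
Proof. by rewrite -cpowRD subrr /cpowR mul0r cexpC0. Qed.

Lemma cpowR_div x y w : 0 < x -> 0 < y -> cpowR (x / y) w = cpowR x w * cpowR y (- w).
Proof.
move=> x0 y0; rewrite /cpowR ln_div ?posrE// rmorphB mulrBr cexpCD.
by rewrite mulNr.
Qed.

Lemma complexV_opp a tau : 0 < a -> - (Complex (- a) tau)^-1 =
  Complex (a / (a ^+ 2 + tau ^+ 2)) (tau / (a ^+ 2 + tau ^+ 2)).
Proof.
move=> a0; have d0 : a ^+ 2 + tau ^+ 2 != 0.
  by rewrite gt_eqF// ltr_wpDr ?sqr_ge0// exprn_gt0.
have z0 : Complex (- a) tau != 0 :> R[i].
  by apply/negP => /eqP[/eqP]; rewrite oppr_eq0 gt_eqF.
apply: (mulfI z0); rewrite mulrN divff//.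
by apply/eqP; rewrite eq_complex /=; apply/andP; split; apply/eqP; field.
Qed.

Variables (K : nat) (Om : 'I_K -> {posnum R}) (n : 'I_K -> nat).

Definition fox_params : seq (@param R) :=
  rcons [seq ((1, 1), ((Om k)%:num^-1, (n k).+1%:R)) | k <- enum 'I_K] ((0, 1), (0, 1)).

Definition gamma_char_prod (c tau : R) : R[i] :=
  \prod_(k < K) Complex (gamma_char (n k) (Om k)%:num c tau 0)
                        (gamma_char (n k) (Om k)%:num c tau (0 - pi / 2)).

(** The two tuples with A = 0 and phi = 1 contribute Gamma(- s) above and Gamma(1 - s) below. With c
    < 0 the functional equation holds at - s, and Gamma(- s) can be cancelled because it does not
    vanish. *)
Lemma foxM_gamma (c tau : R) : c < 0 ->
  foxM K 1 [:: ((1, 1), (0, 1))] fox_params (Complex c tau) =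
  - (Complex c tau)^-1 * (cpowR (\prod_k (Om k)%:num) (- Complex c tau) * gamma_char_prod c tau).
Proof.
move=> c0; set s := Complex c tau.
have sz : size [seq (((1, 1), ((Om k)%:num^-1, (n k).+1%:R)) : param) | k <- enum 'I_K] = K.
  by rewrite size_map size_enum_ord.
rewrite /foxM /fox_params size_rcons sz [size [:: _]]/=.
rewrite [\prod_(1 <= i < 1) _]big_geq// [X in X * _]divr1 (big_nat1 _ 0) (big_nat1 _ K).
rewrite [nth _ [:: _] 0]/=.
rewrite nth_rcons sz ltnn eqxx /=.
rewrite (_ : \prod_(0 <= j < K) _ = cpowR (\prod_k (Om k)%:num) (- s) * gamma_char_prod c tau); last first.
  rewrite big_mkord cpowR_prod// -big_split/=; apply: eq_bigr => k _.
  rewrite nth_rcons sz ltn_ord (nth_map k) ?size_enum_ord// nth_ord_enum.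
  by rewrite /par_phi /par_a /par_al /par_A /= PsiFactor_gamma.
rewrite /PsiFactor /par_phi /par_a /par_al /par_A /= ltxx.
rewrite [RHS]mulrC; congr (_ * _).
have a0 : 0 < - c by rewrite oppr_gt0.
have -> : (real_complex R (1 + 1 - 1) - real_complex R 1 * s - 1 = Complex (- c) (- tau))%R.
  by apply/eqP; rewrite eq_complex /=; apply/andP; split; apply/eqP; ring.
have -> : (real_complex R (1 + 1 - 0) - real_complex R 1 * s - 1 = Complex (- c + 1) (- tau))%R.
  by apply/eqP; rewrite eq_complex /=; apply/andP; split; apply/eqP; ring.
rewrite GammaCS//; have G0 := GammaC_neq0 (- tau) a0.
have g1 : real_complex R (GammaR 1) != 0.
  by rewrite (_ : GammaR 1 = 1) ?oner_eq0//; have := @GammaRS R 0; rewrite fact0.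
have sN : Complex (- c) (- tau) = - s by [].
have s0 : s != 0 by apply/negP => /eqP[/eqP]; rewrite lt_eqF.
by rewrite sN; field; rewrite s0 G0 g1.
Qed.

Lemma fox_integrand (c tau x : R) : c < 0 -> 0 < x ->
  foxM K 1 [:: ((1, 1), (0, 1))] fox_params (Complex c tau) *
    cpowR (x / \prod_k (Om k)%:num) (- Complex c tau) =
  - (Complex c tau)^-1 * (cpowR x (- Complex c tau) * gamma_char_prod c tau).
Proof.
move=> c0 x0; rewrite foxM_gamma// cpowR_div//; last exact: prodr_gt0.
rewrite opprK; have := cpowRN (\prod_k (Om k)%:num) (Complex c tau).
set p1 := cpowR _ _; set p2 := cpowR _ _ => p12.
rewrite (_ : _ * _ * _ = - (Complex c tau)^-1 * (cpowR x (- Complex c tau) * gamma_char_prod c tau) * (p1 * p2)).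
  by rewrite p12 mulr1.
by ring.
Qed.

(** The l1 norm is submultiplicative and is estimated directly from bounds on the two parts, which
    is how the decay of the moments is known. *)
Definition norm1 (z : R[i]) : R := `|complex.Re z| + `|complex.Im z|.

Lemma norm1_ge0 z : 0 <= norm1 z. Proof. exact: addr_ge0. Qed.

Lemma norm1M z w : norm1 (z * w) <= norm1 z * norm1 w.
Proof.
case: z w => [a b] [c d]; rewrite /norm1 /=.
apply: (le_trans (lerD (ler_normB _ _) (ler_normD _ _))).
by rewrite !normrM; lra.
Qed.

Lemma norm1_prod (J : finType) (z : J -> R[i]) : norm1 (\prod_j z j) <= \prod_j norm1 (z j).
Proof.
elim/big_rec2 : _ => [|j p q _ ih]; first by rewrite /norm1 /= normr1 normr0 addr0.
by apply: (le_trans (norm1M _ _)); rewrite ler_wpM2l// norm1_ge0.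
Qed.

Lemma norm1_cpowR x w : norm1 (cpowR x w) <= 2 * expR (complex.Re w * ln x).
Proof.
case: w => [c tau]; rewrite cpowRE /norm1 /= !normrM (gtr0_norm (expR_gt0 _)) -mulrDr mulrC.
rewrite ler_wpM2r ?expR_ge0//; apply: (le_trans (lerD (cos_max _) (sin_max _))).
by rewrite -natr1.
Qed.

(** Every factor is O (1 / (1 + tau)), so the product is O ((1 + tau)^-K), and K >= 1 leaves at
    least one power. *)
Lemma gamma_char_prod_decay (c : R) : c < 0 -> (0 < K)%N -> exists2 M : R, 0 <= M &
  forall tau, 0 < tau -> norm1 (gamma_char_prod c tau) <= M / (1 + tau).
Proof.
move=> c0 K0.
have /choice[M hM] : forall k : 'I_K, exists M : R, 0 <= M /\
    forall tau phi, 0 < tau -> `|gamma_char (n k) (Om k)%:num c tau phi| <= M / (1 + tau).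
  by move=> k; have [M M0 hM] := gamma_char_decay (n k) [gt0 of (Om k)%:num] c0; exists M.
exists (\prod_(k < K) (M k *+ 2)).
  by apply: prodr_ge0 => k _; rewrite mulrn_wge0//; case: (hM k).
move=> tau tau0; have tau1 : 1 <= 1 + tau by rewrite lerDl ltW.
have tau1' : 0 < 1 + tau by rewrite addr_gt0.
apply: (le_trans (norm1_prod _)).
apply: (@le_trans _ _ (\prod_(k < K) ((M k *+ 2) * (1 + tau)^-1))).
  apply: ler_prod => k _; rewrite norm1_ge0 [M k *+ 2]mulr2n [(M k + M k) / _]mulrDl /norm1.
  by have [_ h] := hM k; apply: lerD; exact: h.
rewrite big_split/= prodr_const card_ord ler_wpM2l//.
  by apply: prodr_ge0 => k _; rewrite mulrn_wge0//; case: (hM k).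
rewrite -[leRHS]expr1; apply: ler_wiXn2l => //.
  by rewrite invr_ge0 ltW.
by rewrite invf_le1.
Qed.

End fox_integrand.

(** * The H function as a distribution function *)

Section fox_cdf.
Context d (T : measurableType d) (R : realType) (P : probability T R).
Notation mu := (@lebesgue_measure R).

Lemma cexpectationZ (F : T -> R[i]) (z : R[i]) :
  P.-integrable setT (EFin \o (fun t => complex.Re (F t))) ->
  P.-integrable setT (EFin \o (fun t => complex.Im (F t))) ->
  cexpectation P (fun t => z * F t) = z * cexpectation P F.
Proof.
move=> iR iI; case: z => a b; rewrite /cexpectation.
have iZ (r : R) (f : T -> R) : P.-integrable setT (EFin \o f) ->
    P.-integrable setT (EFin \o (fun t => r * f t)) by exact: integrable_EFinZ.
apply/eqP; rewrite eq_complex /=; apply/andP; split; apply/eqP.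
  rewrite -!RintegralZl// -RintegralB//; [|exact: iZ|exact: iZ].
  by apply: eq_Rintegral => t _; case: (F t).
rewrite -!RintegralZl// -RintegralD//; [|exact: iZ|exact: iZ].
by apply: eq_Rintegral => t _; case: (F t).
Qed.

Variables (K : nat) (Om : 'I_K -> {posnum R}) (n : 'I_K -> nat).
Variable Y : 'I_K -> {RV P >-> R}.
Hypothesis indY : mutually_independent P (fun k => (Y k : T -> R)).
Hypothesis Ylaw : forall k, gamma_distributed P (Y k) (n k).+1%:R (Om k)%:num.
Variables (x a : R).
Hypotheses (K0 : (0 < K)%N) (x0 : 0 < x) (a0 : 0 < a).

Let A t : R := \prod_(k < K) (1 + `|Y k t|).

Let A1 t : 1 <= A t.
Proof.
rewrite /A; elim/big_ind : _ => // [u v u1 v1|k _]; last by rewrite lerDl.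
by rewrite mulr_ege1.
Qed.

Let A0 t : 0 < A t. Proof. exact: lt_le_trans (A1 t). Qed.

Let mA : measurable_fun setT A.
Proof.
apply: measurable_prod => k _; apply: measurable_funD => //.
exact: measurableT_comp.
Qed.

Let L t : R := ln (A t) - ln x.

Let mL : measurable_fun setT L.
Proof.
apply: measurable_funB => //; apply: measurableT_comp => //; exact: measurable_ln.
Qed.

Let LB t : expR (- (a * L t)) <= expR (a * ln x).
Proof.
rewrite ler_expR /L mulrBr opprB gerBl mulr_ge0 ?(ltW a0)//.
exact: ln_ge0.
Qed.

(** The real part of - exp (i phi) exp (s y) / s at s = - a + i tau: phase 0 is [inversion_kernel],
    phase - pi / 2 is the imaginary part of the contour integrand. *)
Let kernel (phi tau y : R) : R :=
  expR (- (a * y)) * ((a * cos (tau * y + phi) - tau * sin (tau * y + phi)) / (a ^+ 2 + tau ^+ 2)).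

Let measurable_kernel phi : measurable_fun setT (fun z : R * T => kernel phi z.1 (L z.2)).
Proof.
have m1 : measurable_fun setT (fun z : R * T => z.1) by exact: measurable_fst.
have m2 : measurable_fun setT (fun z : R * T => L z.2).
  by apply: (measurableT_comp mL); exact: measurable_snd.
have m12 : measurable_fun setT (fun z : R * T => z.1 * L z.2 + phi).
  by apply: measurable_funD => //; exact: measurable_funM.
apply: measurable_funM.
  exact: (measurableT_comp (continuous_measurable_fun (@continuous_expRNM R a))).
apply: measurable_funM.
  apply: measurable_funB.
    apply: measurable_funM => //; apply: measurableT_comp m12.
    exact: (continuous_measurable_fun (@continuous_cos R)).
  apply: measurable_funM => //; apply: measurableT_comp m12.
  exact: (continuous_measurable_fun (@continuous_sin R)).
apply: (measurableT_comp (f := fun x : R => (a ^+ 2 + x ^+ 2)^-1)) m1.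
apply: continuous_measurable_fun => y.
have y0 : a ^+ 2 + y ^+ 2 != 0 by rewrite gt_eqF// ltr_wpDr ?sqr_ge0// exprn_gt0.
by eapply der_continuous; repeat derive_step.
Qed.

Let kernel_le phi tau t : `|kernel phi tau (L t)| <= expR (a * ln x) / a.
Proof.
by rewrite normrM; apply: ler_pM => //; [rewrite gtr0_norm ?expR_gt0|exact: laplace_cos_le].
Qed.

Let kernel0 tau y : inversion_kernel a tau y = kernel 0 tau y.
Proof. by rewrite /kernel addr0. Qed.

Let integrable_kernel phi tau : P.-integrable setT (EFin \o (fun t => kernel phi tau (L t))).
Proof.
apply: (@integrable_bounded _ _ _ P _ (expR (a * ln x) / a)) => //.
exact: (measurableT_comp (measurable_kernel phi) (measurable_pair1 tau)).
Qed.

Let power_bounded tau : [/\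
  P.-integrable setT (EFin \o (fun t => complex.Re (cpowR (A t) (Complex (- a) tau)))) &
  P.-integrable setT (EFin \o (fun t => complex.Im (cpowR (A t) (Complex (- a) tau))))].
Proof.
have mlA : measurable_fun setT (fun t => ln (A t)) by apply: measurableT_comp => //; exact: measurable_ln.
have e1 t : `|expR (- a * ln (A t))| <= 1.
  by rewrite gtr0_norm ?expR_gt0// expR_le1 mulNr oppr_le0 mulr_ge0 ?(ltW a0)// ln_ge0.
have me : measurable_fun setT (fun t => expR (- a * ln (A t))).
  by apply: measurableT_comp => //; exact: measurable_funM.
split; apply: (@integrable_bounded _ _ _ P _ 1).
- under eq_fun do rewrite cpowRE /=.
  apply: measurable_funM => //; apply: measurableT_comp; last exact: measurable_funM.
  exact: (continuous_measurable_fun (@continuous_cos R)).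
- by move=> t; rewrite cpowRE /= normrM mulr_ile1// cos_max.
- under eq_fun do rewrite cpowRE /=.
  apply: measurable_funM => //; apply: measurableT_comp; last exact: measurable_funM.
  exact: (continuous_measurable_fun (@continuous_sin R)).
- by move=> t; rewrite cpowRE /= normrM mulr_ile1// sin_max.
Qed.

Let integrandE tau :
  - (Complex (- a) tau)^-1 * (cpowR x (- Complex (- a) tau) * gamma_char_prod Om n (- a) tau) =
  Complex (\int[P]_t inversion_kernel a tau (L t)) (\int[P]_t kernel (- (pi / 2)) tau (L t)).
Proof.
have aN : - a < 0 by rewrite oppr_lt0.
rewrite /gamma_char_prod -(cexpectation_gamma_power indY Ylaw tau aN) mulrA.
have [i1 i2] := power_bounded tau.
rewrite -cexpectationZ//.
have E t : - (Complex (- a) tau)^-1 * cpowR x (- Complex (- a) tau) *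
    cpowR (A t) (Complex (- a) tau) = Complex (kernel 0 tau (L t)) (kernel (- (pi / 2)) tau (L t)).
  rewrite -mulrA [cpowR x _ * _]mulrC -cpowR_div// complexV_opp// cpowRE ln_div ?posrE//.
  rewrite -/(L t) /kernel addr0 cosBpihalf sinBpihalf mulNr.
  by apply/eqP; rewrite eq_complex /=; apply/andP; split; apply/eqP; field;
    rewrite gt_eqF// ltr_wpDr ?sqr_ge0// exprn_gt0.
by congr Complex; apply: eq_Rintegral => t _; rewrite ?kernel0 E.
Qed.

Let Phi_decay : exists M, forall tau, 0 < tau ->
  `|\int[P]_t inversion_kernel a tau (L t)| <= M * (1 + tau) ^- 2.
Proof.
have aN : - a < 0 by rewrite oppr_lt0.
have [M M0 hM] := gamma_char_prod_decay Om n aN K0.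
(* The target is (a + tau) / (a^2 + tau^2) <= Q / (1 + tau). Expanding, (a + tau) (1 + tau) = a + (1
   + a) tau + tau^2 is at most c0 + 2 (a^2 + tau^2) by the square of 1 + a - tau, and c0 is at most
   c0 / a^2 times a^2 + tau^2. *)
pose c0 := a + (1 + a) ^+ 2; pose Q := 2 + c0 / a ^+ 2.
exists (Q * (2 * expR (a * ln x) * M)) => tau tau0.
have tau1 : 0 < 1 + tau by rewrite addr_gt0.
have den : 0 < a ^+ 2 + tau ^+ 2 by rewrite ltr_wpDr ?sqr_ge0// exprn_gt0.
have h1 : norm1 (- (Complex (- a) tau)^-1) <= Q / (1 + tau).
  rewrite complexV_opp// /norm1 /= !ger0_norm ?divr_ge0 ?(ltW a0) ?(ltW tau0) ?(ltW den)//.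
  rewrite -mulrDl ler_pdivrMr// mulrAC ler_pdivlMr//.
  rewrite (_ : Q * _ = 2 * (a ^+ 2 + tau ^+ 2) + c0 + c0 * tau ^+ 2 / a ^+ 2); last by rewrite /Q; field; rewrite gt_eqF.
  have c00 : 0 <= c0 by rewrite addr_ge0 ?sqr_ge0// ltW.
  have : 0 <= c0 * tau ^+ 2 / a ^+ 2 by rewrite mulr_ge0 ?invr_ge0 ?sqr_ge0// mulr_ge0 ?sqr_ge0.
  have := sqr_ge0 (1 + a - tau); have := sqr_ge0 a; have := sqr_ge0 (1 + a).
  rewrite /c0 !expr2; nra.
have h2 := norm1_cpowR x (- Complex (- a) tau).
have h3 := hM tau tau0.
have -> : \int[P]_t inversion_kernel a tau (L t) = complex.Re (- (Complex (- a) tau)^-1 *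
    (cpowR x (- Complex (- a) tau) * gamma_char_prod Om n (- a) tau)) by rewrite integrandE.
set z := _ * _; apply: (@le_trans _ _ (norm1 z)); first by rewrite lerDl.
rewrite /z; apply: (le_trans (norm1M _ _)).
apply: (@le_trans _ _ (Q / (1 + tau) * (2 * expR (a * ln x) * (M / (1 + tau))))).
  apply: ler_pM => //; rewrite ?norm1_ge0//; apply: (le_trans (norm1M _ _)).
  apply: ler_pM => //; rewrite ?norm1_ge0//.
  by move: h2; rewrite /= opprK.
by rewrite le_eqVlt; apply/orP; left; apply/eqP; field; rewrite gt_eqF.
Qed.

Let measurable_Rintegral_kernel phi : measurable_fun setT (fun tau => \int[P]_t kernel phi tau (L t)).
Proof.
apply: (@measurable_Rintegral_section _ _ _ _ _ P (fun z => kernel phi z.1 (L z.2)) _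
  (measurable_kernel phi)) => -[tau t]; exact: kernel_le.
Qed.

Theorem fox_cdf :
  let Z := foxY K 1 [:: ((1, 1), (0, 1))] (fox_params Om n) (- a) (x / \prod_(k < K) (Om k)%:num) in
  P [set t | \prod_(k < K) (1 + Y k t) <= x] = (complex.Re Z)%:E /\ complex.Im Z = 0.
Proof.
have aN : - a < 0 by rewrite oppr_lt0.
have [M PhiM] := Phi_decay.
have L0 : P (L @^-1` [set 0]) = 0%E.
  rewrite -(gamma_prod_atomless indY Ylaw (Ordinal K0) x); congr (P _).
  apply/seteqP; split => t /=; rewrite -/(A t) /L.
    by move=> /eqP; rewrite subr_eq0 => /eqP /ln_inj; apply; rewrite posrE.
  by move=> ->; rewrite subrr.
have [intPhi inv] := fourier_inversion a0 mL LB L0 PhiM.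
have cdf : P [set t | \prod_(k < K) (1 + Y k t) <= x] = P (L @^-1` `]-oo, 0[).
  rewrite (gamma_prod_cdf_abs Ylaw).
  (* Inversion yields the strict event A < x; the event A = x is null, so the closed one has the
     same probability. *)
  apply: (@eq_measure_off_null _ _ _ P _ _ (L @^-1` [set 0])) => //.
  - rewrite -[X in measurable X]setTI; exact: measurable_fun_le.
  - by rewrite -[X in measurable X]setTI; exact: mL.
  - by rewrite -[X in measurable X]setTI; exact: mL.
  apply/seteqP; split => t [] /=; rewrite in_itv/= -/(A t) /L.
    move=> Ax nL; split => //; rewrite lt_neqAle; apply/andP; split; first exact/eqP.
    by rewrite subr_le0 ler_ln ?posrE.
  by move=> /ltW; rewrite subr_le0 ler_ln ?posrE.
move=> Z.
have ZE : Z = real_complex R (pi *+ 2)^-1 *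
    Complex (\int[mu]_tau (\int[P]_t inversion_kernel a tau (L t)))
            (\int[mu]_tau (\int[P]_t kernel (- (pi / 2)) tau (L t))).
  rewrite /Z /foxY; congr (_ * _); rewrite /CInt; congr Complex; apply: eq_Rintegral => tau _;
  by rewrite fox_integrand// integrandE.
(* Changing tau to - tau conjugates the integrand: its imaginary part is odd and its real part even.
   The doubling of the half-line integral meets the normalization 1 / (2 pi). *)
have im0 : \int[mu]_tau (\int[P]_t kernel (- (pi / 2)) tau (L t)) = 0.
  apply: Rintegral_odd => [//|tau]; rewrite -[RHS]mulN1r -(RintegralZl _ measurableT (integrable_kernel _ tau)).
  apply: eq_Rintegral => t _.
  by rewrite /kernel !cosBpihalf !sinBpihalf mulNr cosN sinN sqrrN; ring.
have re : \int[mu]_tau (\int[P]_t inversion_kernel a tau (L t)) = 2 * (pi * fine (P (L @^-1` `]-oo, 0[))).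
  rewrite Rintegral_even ?inv// => [|tau].
    have -> : (fun tau => \int[P]_t inversion_kernel a tau (L t)) = (fun tau => \int[P]_t kernel 0 tau (L t)).
      by apply/funext => tau; apply: eq_Rintegral => t _; rewrite kernel0.
    exact: measurable_Rintegral_kernel.
  by apply: eq_Rintegral => t _; rewrite /inversion_kernel mulNr cosN sinN sqrrN mulrNN.
rewrite ZE im0 re /= cdf !mul0r !mulr0 subr0 addr0; split => //.
rewrite -[LHS]fineK; last first.
  apply: fin_num_measure.
  by rewrite -[X in measurable X]setTI; exact: mL.
have pi0 : pi != 0 :> R by rewrite gt_eqF// pi_gt0.
by congr EFin; move: (pi : R) pi0 => p p0; field.
Qed.

End fox_cdf.

Theorem theorem1 (R : realType) (K m : nat) (hK : (0 < K)%N) (hm : (0 < m)%N)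
  (sigma2 Pw lam : 'I_K -> R) (N0 : R)
  (hsigma : forall k, 0 < sigma2 k) (hPw : forall k, 0 < Pw k)
  (hlam : forall k, 0 <= lam k < 1) (hN0 : 0 < N0)
  (* theta k l true / theta k l false = real / imaginary part of vartheta_{k,l} *)
  (d : measure_display) (T : measurableType d) (P : probability T R)
  (theta : 'I_K.+1 -> 'I_m -> bool -> {RV P >-> R})
  (theta_indep : mutually_independent P
     (fun i : 'I_K.+1 * 'I_m * bool => (theta i.1.1 i.1.2 i.2 : T -> R)))
  (theta_law : forall k l b, normal_distributed P (theta k l b) 0 (2^-1))
  (d' : measure_display) (T' : measurableType d') (P' : probability T' R)
  (Rv : {ffun 'I_K -> nat} -> 'I_K -> {RV P' >-> R})
  (Rv_indep : forall ell, mutually_independent P' (fun k => (Rv ell k : T' -> R)))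
  (Rv_law : forall ell k, gamma_distributed P' (Rv ell k)
     (m + ell k)%:R (Pw k * sigma2 k * (1 - lam k ^+ 2) / (m%:R * N0))) :
  let Omega k := Pw k * sigma2 k * (1 - lam k ^+ 2) / (m%:R * N0) in
  let habs k t := Num.sqrt (sigma2 k / m%:R) *
      Num.sqrt (\sum_(l < m) \sum_(b : bool)
        (Num.sqrt (1 - lam k ^+ 2) * theta (lift ord0 k) l b t
         + lam k * theta ord0 l b t) ^+ 2) in
  let snr k t := Pw k * habs k t ^+ 2 / N0 in
  let G t := \prod_(k < K) (1 + snr k t) in
  let S := \sum_(k < K) lam k ^+ 2 / (1 - lam k ^+ 2) in
  let w k := lam k ^+ 2 / (1 - lam k ^+ 2) * (1 + S)^-1 in
  let W (ell : {ffun 'I_K -> nat}) :=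
      GammaR (m + \sum_(k < K) ell k)%:R / GammaR m%:R * (1 + S) ^- m *
      \prod_(k < K) (w k ^+ ell k / (ell k)`!%:R) in
  let A (ell : {ffun 'I_K -> nat}) t := \prod_(k < K) (1 + Rv ell k t) in
  (forall x : R,
     P [set t | G t <= x] =
     (\esum_(ell in [set: {ffun 'I_K -> nat}]) ((W ell)%:E * P' [set t | (A ell t <= x)%R]))%E)
  /\
  (forall (ell : {ffun 'I_K -> nat}) (x c : R), 0 < x -> c < 0 ->
     let Y := foxY K 1 [:: ((1, 1), (0, 1))]
                (rcons [seq ((1, 1), ((Omega k)^-1, (m + ell k)%:R)) | k <- enum 'I_K]
                       ((0, 1), (0, 1)))
                c (x / \prod_(k < K) Omega k) in
     P' [set t | A ell t <= x] = (complex.Re Y)%:E /\ complex.Im Y = 0).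
Proof.
(* Writing the positive m as a successor makes all shapes successors, so the values of Gamma become
   factorials. *)
case: m hm theta theta_indep theta_law Rv_law => [//|m] hm theta theta_indep theta_law Rv_law.
move=> Omega habs snr G S w W A.
have lam2 k : 0 < 1 - lam k ^+ 2.
  have /andP[l0 l1] := hlam k; rewrite subr_gt0 expr2 -[ltRHS]mulr1.
  by apply: ltr_pM.
have Omega0 k : 0 < Omega k.
  by rewrite /Omega divr_gt0// ?mulr_gt0// ltr0n.
pose c k : {posnum R} := PosNum (Omega0 k).
(* Pulling sqrt (1 - lambda_k^2) out of the channel vector leaves a standard vector shifted by r_k
   theta_0; the square of the factor pulled out is absorbed in [Omega k]. *)
pose r k := lam k / Num.sqrt (1 - lam k ^+ 2).
have r2 k : r k ^+ 2 = lam k ^+ 2 / (1 - lam k ^+ 2).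
  by rewrite /r expr_div_n sqr_sqrtr// ltW.
pose X (i : 'I_K.+1 * 'I_m.+1 * bool) : {RV P >-> R} := theta i.1.1 i.1.2 i.2.
have snrE k t : snr k t = (c k)%:num * quad_form X r k t t.
  rewrite /snr /habs /quad_form exprMn !sqr_sqrtr; last 2 first.
  - by apply: sumr_ge0 => l _; apply: sumr_ge0 => b _; exact: sqr_ge0.
  - by rewrite divr_ge0// ltW.
  rewrite pair_bigA /= (eq_bigr (fun j : 'I_m.+1 * bool => (1 - lam k ^+ 2) *
    (X (lift ord0 k, j.1, j.2) t + r k * X (ord0, j.1, j.2) t) ^+ 2)); last first.
    move=> [l b] _; rewrite /X /=.
    rewrite -[in RHS](sqr_sqrtr (ltW (lam2 k))) -exprMn mulrDr; congr ((_ + _) ^+ 2).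
    by rewrite /r !mulrA; congr (_ * _); field; rewrite gt_eqF// sqrtr_gt0.
  rewrite -mulr_sumr /c /= /Omega; field.
  by rewrite nat1r pnatr_eq0 andbT gt_eqF.
have WE ell : W ell = mix_weight m r ell.
  rewrite /W /mix_weight addSn !GammaRS /w /S.
  have SE : \sum_(k < K) lam k ^+ 2 / (1 - lam k ^+ 2) = \sum_(k < K) r k ^+ 2.
    by apply: eq_bigr => k _; rewrite r2.
  by rewrite SE; congr (_ * _); apply: eq_bigr => k _; rewrite r2.
split.
  move=> x.
  have GE t : G t = \prod_(k < K) (1 + (c k)%:num * quad_form X r k t t).
    by apply: eq_bigr => k _; rewrite snrE.
  rewrite (_ : [set t | G t <= x] =
      [set t | \prod_(k < K) (1 + (c k)%:num * quad_form X r k t t) <= x]); last first.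
    by apply/seteqP; split => t /=; rewrite GE.
  rewrite (mixture_cdf (X := X) (P' := P') (Y := Rv) (c := c) theta_indep
    (fun i => theta_law _ _ _) r Rv_indep Rv_law).
  by apply: eq_esum => ell _; rewrite WE.
move=> ell x s x0 s0.
have := fox_cdf (Om := c) (n := fun k => (m + ell k)%N) (Rv_indep ell) (Rv_law ell) hK x0
  (a := - s); rewrite opprK oppr_gt0; exact.
Qed.
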